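(* For all integers $k\geq 1$, $0\leq s<k$ and $n\geq 2k-s+\mathbf{1}_{[s=0]}$, the generalized Johnson graph $J(n,k,s)$ has a Hamilton cycle, unless $(n,k,s)\in\{(5,2,0),(5,3,1)\}$.
   Context: The generalized Johnson graph $J(n,k,s)$ has as vertices all $k$-element subsets of $[n]=\{1,\dots,n\}$, with an edge between two sets $A,B$ if and only if $|A\cap B|=s$. Here $\mathbf{1}_{[s=0]}$ equals $1$ if $s=0$ and $0$ otherwise. A Hamilton cycle is a cycle visiting every vertex exactly once. *)

(* Defs.v *)
From mathcomp Require Import all_boot.
Set Implicit Arguments. Unset Strict Implicit. Unset Printing Implicit Defensive.

Definition johnson_vertex (n k : nat) (A : {set 'I_n}) : bool := #|A| == k.

Definition johnson_adj (n s : nat) (A B : {set 'I_n}) : bool := #|A :&: B| == s.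

Definition johnson_hamiltonian (n k s : nat) : Prop :=
  exists c : seq {set 'I_n},
    [/\ 3 <= size c, uniq c,
        (forall A : {set 'I_n}, (A \in c) = johnson_vertex k A)
      & cycle (@johnson_adj n s) c].

(* Main.v *)
Require Import Defs.
From HB Require Import structures.
From mathcomp Require Import all_boot zify.
Set Implicit Arguments. Unset Strict Implicit. Unset Printing Implicit Defensive.

(** A generalized Johnson graph with s >= 1 is built inductively from
    J(n-1,k,s) and J(n-1,k-1,s-1): Hamilton cycles of both, moved by
    permutations of the ground set, are cut at one edge each and joined. This
    reduces everything to J(2k-s,k,s), which complementation turns into the
    Kneser graph K(2k-s,k-s), to the Kneser graphs K(n,k) with n >= 2k+1 and to
    J(6,3,1).

    Kneser graphs K(2k+m,k) with m >= 3. Write sets as words. The cyclic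
    parenthesis map (ones open, zeros close) sends every set to a disjoint one,
    so its orbits form a cycle factor. It is modified by a Hamilton cycle of
    K(2(k-1)+m,k-1) on the words ending in 10 or 01. Each arc x -> y carries two
    disjoint supersets, of x and of y; two arcs sharing one of them can be
    recombined, and since these links connect all orbits, all cycles merge.

    Odd graphs K(2k+1,k). Dyck words index paths in two middle levels of the
    cube of dimension 2k, and these give cycles partitioning the vertices. They
    are merged by exchanging edges along alternating cycles that form a
    hypertree, which is found by recursion on the decomposition 1u0v.

    Kneser graphs K(2k+2,k). Deleting one element turns a Hamilton cycle of
    K(2k+3,k+1) into a cyclic sequence of the k-subsets and the (k+1)-subsets of
    a (2k+2)-set; a complementary pair of halves Y, Z is removed by replacing
    Y s Z t with s followed by the reversal of t. *)

(** * Merging the cycles of a permutation *)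

(** The Kneser cases split by the excess [n - 2k] because it is the number of unmatched zeros of a
    word. The labels that link the orbits use the unmatched zeros 0, 1 and the last one, which must
    be distinct: hence excess at least three. There the induction carries two extra conditions. The
    successor of [z] avoids a superset [pad z], which is the room used to link words outside the
    lifted cycle to it; and the arc from [alt] to [alt'] is prescribed, because lifting a cycle to
    the endings 10 and 01 may split it in two, and a known arc is needed to join the halves.

    The obstacle in the odd case is K(5,2), the Petersen graph. The two trees of weight two cannot
    be merged, so wherever a factor of 1u0v has weight two the block breaks into two pieces that are
    attached separately. The recursion therefore starts at weight seven, and smaller weights rest on
    certificates. The same graph explains the separate treatment of K(4,1) and J(6,3,1), whose
    reductions would start from exceptional graphs. *)

Section MergeCycles.
Variables (T : choiceType) (L : eqType).

(** [V] is turned into the finite type [seq_sub V], on which an injective self-map has cyclic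
    orbits; [T] itself may be infinite. *)
Lemma injective_on_orbit (V : seq T) (g : T -> T) (x : T) :
  uniq V -> {in V, forall y, g y \in V} -> {in V &, injective g} -> x \in V ->
  exists c, [/\ uniq c, x \in c, {subset c <= V}, fcycle g c
    & {in V, forall y, (g y \in c) = (y \in c)}].
Proof.
move=> uV gV gI xV.
pose g' (u : seq_sub V) : seq_sub V := SeqSub (gV _ (valP u)).
have g'I : injective g'.
  by move=> u v [] /gI E; apply/val_inj; apply: E; apply: valP.
exists (map val (orbit g' (SeqSub xV))); split.
- by rewrite map_inj_uniq ?orbit_uniq //; apply: val_inj.
- by apply/mapP; exists (SeqSub xV); rewrite ?in_orbit.
- by move=> y /mapP[u _ ->]; apply: valP.
- rewrite cycle_map; apply: sub_cycle (cycle_orbit g'I _).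
  by move=> u v /= /eqP <-.
move=> y yV; rewrite -[y]/(val (SeqSub yV)).
rewrite -[g _]/(val (g' (SeqSub yV))) !(mem_map val_inj) -!fconnect_orbit.
by rewrite !(fconnect_sym g'I (SeqSub xV)) -same_fconnect1.
Qed.

Lemma injective_on_iter (V : seq T) (g : T -> T) (x : T) :
  uniq V -> {in V, forall y, g y \in V} -> {in V &, injective g} -> x \in V ->
  exists2 t, 0 < t & iter t g x = x.
Proof.
move=> uV gV gI xV.
have [c [uc xc _ fc _]] := injective_on_orbit uV gV gI xV.
exists (size c); first by case: c xc {uc fc}.
move: xc => /rot_to[i c' E]; rewrite -(size_rot i) E /=.
move: fc; rewrite -(rot_cycle i) E /= => /fpathP[j Ej].
have Ej' : j = (size c').+1 by rewrite -(size_traject g (g x) j) -Ej size_rcons.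
move: (congr1 (last x) Ej).
by rewrite last_rcons Ej' last_traject => /esym.
Qed.

Lemma cycle_decomposition (V : seq T) (g : T -> T) :
  uniq V -> {in V, forall y, g y \in V} -> {in V &, injective g} ->
  exists cs : seq (seq T), [/\ uniq (flatten cs), flatten cs =i V
    & forall c, c \in cs -> [/\ c != [::], fcycle g c
      & {in V, forall y, (g y \in c) = (y \in c)}]].
Proof.
elim: {V}(size V) {-2}V (leqnn (size V)) => [|n IH] V sV uV gV gI.
  by exists [::]; split=> // x; case: V sV {uV gV gI}.
case: (posnP (size V)) => [/size0nil->|sV0]; first by exists [::].
have [x xV] : exists x, x \in V by case: V sV0 {sV uV gV gI} => // x V _; exists x; rewrite inE eqxx.
have [c [uc xc cV fc gc]] := injective_on_orbit uV gV gI xV.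
pose W := [seq y <- V | y \notin c].
have WV y : y \in W -> y \in V by rewrite mem_filter => /andP[].
have [||||cs [ucs csW Hcs]] := IH W.
- rewrite -ltnS (leq_trans _ sV) // size_filter -(count_predC (fun y => y \notin c) V).
  by rewrite -addn1 leq_add2l -has_count; apply/hasP; exists x; rewrite //= xc.
- exact: filter_uniq.
- by move=> y; rewrite !mem_filter => /andP[yc yV]; rewrite gc // yc gV.
- by move=> y z /WV yV /WV zV; apply: gI.
exists (c :: cs); split=> /=.
- rewrite cat_uniq uc ucs andbT; apply/hasPn=> y.
  by rewrite csW mem_filter => /andP[].
- move=> y; rewrite mem_cat csW mem_filter; case: (boolP (y \in c)) => //= yc.
  by rewrite cV.
move=> d; rewrite inE => /orP[/eqP->|dcs]; first by split=> //; case: (c) xc.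
have [d0 fd gd] := Hcs d dcs; split=> // y yV.
case: (boolP (y \in c)) => yc; last by apply: gd; rewrite mem_filter yc.
have nd z : z \in c -> z \notin d.
  move=> zc; apply/negP=> zd.
  have : z \in W by rewrite -csW; apply/flattenP; exists d.
  by rewrite mem_filter zc.
by rewrite (negPf (nd y yc)) (negPf (nd _ _)) // gc.
Qed.

Lemma rot_to_last (c : seq T) x : x \in c ->
  exists2 d, perm_eq (rcons d x) c & forall e, cycle e (rcons d x) = cycle e c.
Proof.
move=> /rot_to[i d E]; exists d => [|e]; rewrite -rot1_cons -E ?rot_cycle //.
by rewrite perm_rot perm_rot.
Qed.

Lemma rot_to_head (c : seq T) x : x \in c ->
  exists2 d, perm_eq (x :: d) c & forall e, cycle e (x :: d) = cycle e c.
Proof. by move=> /rot_to[i d E]; exists d => [|e]; rewrite -E ?perm_rot ?rot_cycle. Qed.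

Variables (V : seq T) (g : T -> T) (t h : T -> L) (R : rel L).
(** An arc depends on its start only through the tail label, and on its end only through the head
    label of the arc of [g] entering it. This is what makes arcs with a common label
    exchangeable. *)
Let S x y := has (fun x' => (y == g x') && R (t x) (h x')) V.

(** With [x] and [y] rotated to the last places, concatenation exchanges their successors, which [S]
    allows because [S x] and [S y] coincide. *)
Lemma merge_tail c d x y : cycle S c -> cycle S d -> x \in c -> y \in d ->
  t x = t y -> exists2 e, perm_eq e (c ++ d) & cycle S e.
Proof.
move=> Sc Sd /rot_to_last[c' pc cc] /rot_to_last[d' pd cd] Et.
exists (rcons c' x ++ rcons d' y); first exact: perm_cat.
move: Sc Sd; rewrite -cc -cd.
have St : S x =1 S y by move=> z; rewrite /S Et.
case: c' {pc cc} => [|a c']; case: d' {pd cd} => [|b d']; 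
  rewrite /= ?cats0 ?cat_path ?rcons_path ?last_rcons ?cat_rcons ?last_cat /= ?rcons_path ?cat_path /= ?rcons_path /= ?last_rcons ?St.
- by move=> /andP[-> _] /andP[-> _].
- by move=> /andP[-> _] /andP[/andP[-> ->] ->].
- by move=> /andP[/andP[-> ->] ->] /andP[-> _].
by move=> /andP[/andP[-> ->] ->] /andP[/andP[-> ->] ->].
Qed.

Hypothesis gI : {in V &, injective g}.

(** The mirror image, with predecessors exchanged. Injectivity of [g] makes [x] the only preimage of
    [g x], so that entering [g x] is governed by [h x] alone. *)
Lemma merge_head c d x y : cycle S c -> cycle S d -> x \in V -> y \in V ->
  g x \in c -> g y \in d ->
  h x = h y -> exists2 e, perm_eq e (c ++ d) & cycle S e.
Proof.
move=> Sc Sd xV yV /rot_to_head[c' pc cc] /rot_to_head[d' pd cd] Eh.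
exists ((g x :: c') ++ (g y :: d')); first exact: perm_cat.
have SE z w : w \in V -> S z (g w) = R (t z) (h w).
  move=> wV; apply/hasP/idP=> [[w' w'V /andP[/eqP/gI E]]|H]; first by rewrite E.
  by exists w; rewrite ?eqxx.
move: Sc Sd; rewrite -cc -cd /= rcons_cat cat_path /= !rcons_path !SE // Eh.
by move=> /andP[-> ->] /andP[-> ->].
Qed.

Lemma merge_cycles :
  uniq V -> {in V, forall x, g x \in V} -> {in V, forall x, R (t x) (h x)} ->
  (forall Q : T -> bool, {in V, forall x, Q (g x) = Q x} ->
     {in V &, forall x y, t x = t y -> Q x = Q y} ->
     {in V &, forall x y, h x = h y -> Q x = Q y} ->
     {in V &, forall x y, Q x = Q y}) ->
  exists c, [/\ uniq c, c =i V & cycle S c].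
Proof.
move=> uV gV HR conn.
have [cs [ucs csV Hcs]] := cycle_decomposition uV gV gI.
have {}Hcs c : c \in cs -> [/\ c != [::], cycle S c & {in V, forall y, (g y \in c) = (y \in c)}].
  move=> ccs; have [c0 fc gc] := Hcs c ccs; split=> //.
  apply: (sub_in_cycle (P := mem V)) fc.
    move=> x y xV _ /= /eqP <-; apply/hasP; exists x; rewrite // eqxx.
    exact: HR.
  apply/allP=> x xc; have xV : x \in V by rewrite -csV; apply/flattenP; exists c.
  exact: xV.
(* After an exchange a list is no longer a cycle of [g], but its support is still a union of orbits;
   the induction keeps only this closure under [g]. *)
elim: {cs}(size cs) {-2}cs (leqnn (size cs)) ucs csV Hcs => [|n IH] cs scs ucs csV Hcs.
  by exists [::]; split=> // x; rewrite -csV; case: cs scs {ucs csV Hcs}.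
case: cs scs ucs csV Hcs => [|c [|c2 cs]] scs ucs csV Hcs.
- by exists [::].
- exists c; have [_ Sc _] := Hcs c (mem_head _ _); split=> //.
    by move: ucs; rewrite /= cats0.
  by move=> x; rewrite -csV /= cats0.
set ds := c2 :: cs in ucs csV Hcs scs *.
have [c0 Sc gc] := Hcs c (mem_head _ _).
have cV x : x \in c -> x \in V by rewrite -csV mem_cat => ->.
have step d e : d \in ds -> perm_eq e (c ++ d) -> cycle S e ->
    exists c, [/\ uniq c, c =i V & cycle S c].
  move=> dds pe Se.
  have pds : perm_eq (d :: rem d ds) ds by rewrite perm_sym perm_to_rem.
  have pf : perm_eq (flatten (e :: rem d ds)) (flatten (c :: ds)).
    apply: perm_trans (perm_flatten (_ : perm_eq (c :: d :: rem d ds) _)).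
      by rewrite /= catA perm_cat2r.
    by rewrite perm_cons.
  have [_ _ gd] : [/\ d != [::], cycle S d & {in V, forall y, (g y \in d) = (y \in d)}].
    by apply: Hcs; rewrite inE dds orbT.
  apply: (IH (e :: rem d ds)).
  - by have := perm_size pds; move: scs; rewrite /ds /=; lia.
  - by rewrite (perm_uniq pf).
  - by move=> x; rewrite (perm_mem pf) csV.
  move=> a; rewrite inE => /orP[/eqP->|/mem_rem ads]; last by apply: Hcs; rewrite inE ads orbT.
  split=> //.
    by rewrite -size_eq0 (perm_size pe) size_cat addn_eq0 size_eq0 (negPf c0).
  by move=> y yV; rewrite !(perm_mem pe) !mem_cat gc // gd.
have out y : y \in V -> y \notin c -> exists2 d, d \in ds & y \in d.
  have {csV}csV z : z \in V = (z \in c) || (z \in flatten ds) by rewrite -csV mem_cat.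
  by rewrite csV => /orP[->//|/flattenP[d dds yd] _]; exists d.
have Sd d : d \in ds -> [/\ d != [::], cycle S d & {in V, forall y, (g y \in d) = (y \in d)}].
  by move=> dds; apply: Hcs; rewrite inE dds orbT.
(* Connectivity is applied to membership in the first cycle. If no shared label leaves [c], this
   predicate is constant on [V], although [c2] lies outside it. *)
pose Q := fun x => x \in c.
pose goal := exists c, [/\ uniq c, c =i V & cycle S c].
have [/existsP|] := boolP [exists x : seq_sub V, [exists y : seq_sub V, (t (val x) == t (val y)) && Q (val x) && ~~ Q (val y)]].
  move=> [[x xV] /existsP[[y yV] /= /andP[/andP[/eqP Et xc] yc]]].
  have [d dds yd] := out y yV yc; have [_ cd _] := Sd d dds.
  have [e pe Se] := merge_tail Sc cd xc yd Et; exact: step pe Se.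
move=> /existsPn Ht.
have [/existsP|] := boolP [exists x : seq_sub V, [exists y : seq_sub V, (h (val x) == h (val y)) && Q (val x) && ~~ Q (val y)]].
  move=> [[x xV] /existsP[[y yV] /= /andP[/andP[/eqP Et xc] yc]]].
  have [d dds yd] := out y yV yc; have [_ cd gd] := Sd d dds.
  have [||e pe Se] := merge_head Sc cd xV yV _ _ Et; [by rewrite gc| by rewrite gd|].
  exact: step pe Se.
move=> /existsPn Hh.
have two (l : T -> L) : (forall x : seq_sub V, ~~ [exists y : seq_sub V, (l (val x) == l (val y)) && Q (val x) && ~~ Q (val y)]) ->
    {in V &, forall x y, l x = l y -> Q x = Q y}.
  move=> Hl x y xV yV E.
  have := Hl (SeqSub xV); rewrite negb_exists => /forallP/(_ (SeqSub yV)) /=.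
  have := Hl (SeqSub yV); rewrite negb_exists => /forallP/(_ (SeqSub xV)) /=.
  by rewrite E eqxx; case: (Q x); case: (Q y).
have := conn Q gc (two _ Ht) (two _ Hh).
have [a ac] : exists a, a \in c by case: (c) c0 => // a s _; exists a; rewrite mem_head.
have [b bc] : exists a, a \in c2.
  by have [d0 _ _] := Sd c2 (mem_head _ _); case: (c2) d0 => // b s _; exists b; rewrite mem_head.
move=> /(_ a b (cV a ac)); rewrite -csV mem_cat /= mem_cat bc orbT => /(_ isT).
rewrite /Q ac => /esym bc'.
by move: ucs; rewrite cat_uniq => /and3P[_ /hasPn/(_ b)]; rewrite mem_cat bc /= bc' => /(_ isT).
Qed.

End MergeCycles.

Lemma cycle_next_invariant (T : eqType) (c : seq T) (Q : T -> bool) :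
  uniq c -> {in c, forall x, Q (next c x) = Q x} -> {in c &, forall x y, Q x = Q y}.
Proof.
move=> uc Qc x y xc yc; move: (xc) => /rot_to[i d E].
have fd : fpath (next c) x d.
  have := cycle_next uc; rewrite -(rot_cycle i) E /= rcons_path.
  by case/andP.
have Ed : d = traject (next c) (next c x) (size d).
  by move: fd => /fpathP[j ->]; rewrite size_traject.
have : y \in x :: d by rewrite -E mem_rot.
rewrite Ed -[x :: _]/(traject (next c) x (size d).+1) => /trajectP[j _ ->].
have H k : (iter k (next c) x \in c) && (Q x == Q (iter k (next c) x)).
  by elim: k => [|k /andP[IH1 IH2]]; rewrite ?xc ?eqxx //= mem_next IH1 Qc.
by have /andP[_ /eqP] := H j.
Qed.

(** * Words and the parenthesis map *)

Definition disjointw (s t : bitseq) := ~~ has (fun p => p.1 && p.2) (zip s t).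

Lemma disjointw_cons a b s t : disjointw (a :: s) (b :: t) = ~~ (a && b) && disjointw s t.
Proof. by rewrite /disjointw /= negb_or. Qed.

Lemma disjointw_cat s t s' t' : size s = size t ->
  disjointw (s ++ s') (t ++ t') = disjointw s t && disjointw s' t'.
Proof. by move=> E; rewrite /disjointw zip_cat // has_cat negb_or. Qed.

Lemma disjointwC s t : disjointw s t = disjointw t s.
Proof.
elim: s t => [|a s IH] [|b t] //.
by rewrite !disjointw_cons IH andbC; case: a; case: b; rewrite ?andbT ?andbF.
Qed.

Lemma disjointw_negb s : disjointw s (map negb s).
Proof. by elim: s => // a s IH; rewrite disjointw_cons IH; case: a. Qed.

Definition subw (s t : bitseq) := all (fun p => p.1 ==> p.2) (zip s t).

Lemma subw_cons a b s t : subw (a :: s) (b :: t) = (a ==> b) && subw s t.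
Proof. by []. Qed.

Lemma subw_cat s t s' t' : size s = size t -> subw (s ++ s') (t ++ t') = subw s t && subw s' t'.
Proof. by move=> E; rewrite /subw zip_cat // all_cat. Qed.

Lemma subw_refl s : subw s s.
Proof. by elim: s => // -[] s IH. Qed.

Lemma disjointw_sub s t u : size s = size t -> subw s t -> disjointw t u -> disjointw s u.
Proof.
elim: s t u => [|a s IH] [|b t] [|c u] //= [E].
by rewrite subw_cons !disjointw_cons => /andP[ab /(IH _ u E) H] /andP[bc /H ->]; move: ab bc; case: a; case: b; case: c.
Qed.

Lemma disjointw_eq s t : size s = size t -> count id s + count id t = size s ->
  disjointw s t -> t = map negb s.
Proof.
elim: s t => [|a s IH] [|b t] //= [E] H; rewrite disjointw_cons => /andP[ab d].
have : count id s + count id t <= size s.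
  elim: s t E d {IH H} => [|a' s IH] [|b' t] //= [E].
  by rewrite disjointw_cons => /andP[ab' /(IH _ E)]; case: a' ab'; case: b' => //=; lia.
move: H; case: a ab; case: b => //= _ H; rewrite ?add0n in H *; first [lia | by move=> _; rewrite (IH t) //; lia].
Qed.

Definition words (n k : nat) : seq bitseq :=
  [seq tval t | t : n.-tuple bool <- enum {: n.-tuple bool} & count id t == k].

Lemma mem_words n k x : (x \in words n k) = (size x == n) && (count id x == k).
Proof.
apply/mapP/andP => [[t]|[/eqP sx cx]].
  by rewrite mem_filter => /andP[ct _] ->; rewrite size_tuple.
by exists (Tuple (introT eqP sx)); rewrite // mem_filter mem_enum /= cx.
Qed.

Lemma words_uniq n k : uniq (words n k).
Proof. rewrite map_inj_uniq; first by rewrite filter_uniq // enum_uniq.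
by move=> s t; apply: val_inj. Qed.

Lemma wordsP n k x : reflect (size x = n /\ count id x = k) (x \in words n k).
Proof. by rewrite mem_words; apply: (iffP andP) => -[/eqP-> /eqP->]. Qed.

(** * Bracket matching with a number of brackets already open *)

Definition step (l : nat) (b : bool) := if b then l.+1 else l.-1.
Definition load (l : nat) (x : bitseq) := foldl step l x.

Arguments load : simpl never.

Lemma load_cat l x y : load l (x ++ y) = load (load l x) y.
Proof. exact: foldl_cat. Qed.

Lemma load_cons l b x : load l (b :: x) = load (step l b) x.
Proof. by []. Qed.

(** Either the walk from [l] is never cut off at zero and ends at the second term, or it is cut off
    once and from then on agrees with the walk from zero. *)
Lemma load_max l x :
  load l x = maxn (load 0 x) (l + count id x - (size x - count id x)).
Proof.
elim: x l => [|b x IH] l; first by rewrite /load /=; lia.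
rewrite !load_cons IH (IH (step 0 b)).
have := count_size id x; case: b; rewrite /step /=; lia.
Qed.

Lemma load_mono l l' x : l <= l' -> load l x <= load l' x.
Proof. by move=> ll; rewrite (load_max l) (load_max l'); lia. Qed.

(* Scanning [x] with [l] brackets already open (ones open, zeros close), this
   marks the matched zeros, and also the [j]-th unmatched zero for each [j] in
   [P]; the first unmatched zero has number [i]. *)
Fixpoint mark (P : pred nat) (i l : nat) (x : bitseq) : bitseq :=
  if x is b :: x' then
    if b then false :: mark P i l.+1 x'
    else if l is l'.+1 then true :: mark P i l' x' else P i :: mark P i.+1 0 x'
  else [::].

(** Unmatched zeros are numbered as in [mark], so a filled word is disjoint from a marked one as
    soon as the two index sets are ([disjointw_fill_mark]). *)
Fixpoint fill (P : pred nat) (i l : nat) (x : bitseq) : bitseq :=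
  if x is b :: x' then
    if b then true :: fill P i l.+1 x'
    else if l is l'.+1 then false :: fill P i l' x' else P i :: fill P i.+1 0 x'
  else [::].

Fixpoint unmatched (l : nat) (x : bitseq) : nat :=
  if x is b :: x' then
    if b then unmatched l.+1 x'
    else if l is l'.+1 then unmatched l' x' else (unmatched 0 x').+1
  else 0.

Lemma size_mark P i l x : size (mark P i l x) = size x.
Proof. by elim: x i l => //= -[] x IH i [|l] /=; rewrite IH. Qed.

Lemma size_fill P i l x : size (fill P i l x) = size x.
Proof. by elim: x i l => //= -[] x IH i [|l] /=; rewrite IH. Qed.

Lemma mark_cat P i l x y :
  mark P i l (x ++ y) = mark P i l x ++ mark P (i + unmatched l x) (load l x) y.
Proof. by elim: x i l => /= [|[] x IH] i [|l] /=; rewrite ?addn0 ?IH //= addSnnS. Qed.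

Lemma fill_cat P i l x y :
  fill P i l (x ++ y) = fill P i l x ++ fill P (i + unmatched l x) (load l x) y.
Proof. by elim: x i l => /= [|[] x IH] i [|l] /=; rewrite ?addn0 ?IH //= addSnnS. Qed.

Lemma unmatched_cat l x y :
  unmatched l (x ++ y) = unmatched l x + unmatched (load l x) y.
Proof. by elim: x l => /= [|[] x IH] [|l] //=; rewrite IH. Qed.

Lemma mark_ext (P P' : pred nat) i l x : (forall j, i <= j < i + unmatched l x -> P j = P' j) ->
  mark P i l x = mark P' i l x.
Proof.
elim: x i l => //= -[] x IH i [|l] H; rewrite ?IH //; last by move=> j ?; apply: H; lia.
by rewrite H //; lia.
Qed.

Lemma fill_ext (P P' : pred nat) i l x : (forall j, i <= j < i + unmatched l x -> P j = P' j) ->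
  fill P i l x = fill P' i l x.
Proof.
elim: x i l => //= -[] x IH i [|l] H; rewrite ?IH //; last by move=> j ?; apply: H; lia.
by rewrite H //; lia.
Qed.

Lemma fill0 i l x : fill pred0 i l x = x.
Proof. by elim: x i l => //= -[] x IH i [|l] /=; rewrite IH. Qed.

Lemma disjointw_fill_mark (P P' : pred nat) i l x : (forall j, i <= j < i + unmatched l x -> ~~ (P j && P' j)) ->
  disjointw (fill P i l x) (mark P' i l x).
Proof.
elim: x i l => //= -[] x IH i [|l] H; rewrite disjointw_cons /= IH ?andbF ?H //; first [lia | by move=> j ?; apply: H; lia].
Qed.

Lemma subw_fill (P P' : pred nat) i l x : (forall j, P j -> P' j) ->
  subw (fill P i l x) (fill P' i l x).
Proof. 
move=> H; elim: x i l => //= -[] x IH i [|l]; rewrite subw_cons /= IH ?andbT //.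
by apply/implyP/H.
Qed.

Lemma subw_mark (P P' : pred nat) i l x : (forall j, P j -> P' j) ->
  subw (mark P i l x) (mark P' i l x).
Proof. 
move=> H; elim: x i l => //= -[] x IH i [|l]; rewrite subw_cons /= IH ?andbT //.
by apply/implyP/H.
Qed.

Lemma mark0 i i' l x : mark pred0 i l x = mark pred0 i' l x.
Proof. by elim: x i i' l => //= -[] x IH i i' [|l]; congr (_ :: _); apply: IH. Qed.

Lemma mark_high (P : pred nat) i l x : (forall j, i <= j -> ~~ P j) -> mark P i l x = mark pred0 0 l x.
Proof.
elim: x i l => //= -[] x IH i [|l] H; rewrite ?IH //.
  by rewrite (negPf (H _ _)) // (mark0 0 1).
by move=> j ?; apply: H; lia.
Qed.

(** The [s - i] extra open brackets are closed by the next [s - i] unmatched zeros. *)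
Lemma mark_shift s i l x : i <= s ->
  mark pred0 0 (l + (s - i)) x = mark (fun j => j < s) i l x.
Proof.
elim: x i l => //= -[] x IH i l lis.
  by rewrite -IH // addSn.
case: l => [|l]; last by rewrite addSn -IH.
rewrite add0n; case: (ltnP i s) => his.
  by rewrite -IH // add0n -(subnSK his).
have -> : s - i = 0 by lia.
by rewrite (mark_high (i := 1)) // (mark_high (i := i.+1)) // => j ?; lia.
Qed.

(** The one placed at zero [t] is closed by the following unmatched zero [t.+1]. Later zeros are
    renumbered, harmlessly since [P] is false there. *)
Lemma mark_fill (P : pred nat) t i l x : i <= t -> (forall j, t <= j -> ~~ P j) ->
  mark P i l (fill (pred1 t) i l x) = mark (fun j => P j || (j == t.+1)) i l x.
Proof.
elim: x i l => //= -[] x IH i l it HP /=; first by rewrite IH.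
case: l => [|l] /=; last by rewrite IH.
have [->|ne] /= := eqVneq i t; last first.
  by rewrite IH ?orbF //; last lia; congr (_ :: _); rewrite ltn_eqF ?orbF //; lia.
rewrite (negPf (HP _ (leqnn t))) /= ltn_eqF //; congr (_ :: _).
rewrite (@fill_ext _ pred0) ?fill0; last by move=> j ?; rewrite /= gtn_eqF //; lia.
rewrite mark_high //; have -> : 1 = 0 + (t.+2 - t.+1) by lia.
rewrite mark_shift //; apply: mark_ext => j ?.
by rewrite (negPf (HP _ _)) /=; lia.
Qed.

Lemma load_succ l x : load l.+1 x = load l x + (unmatched l x == 0).
Proof.
elim: x l => [|[] x IH] l /=; first by rewrite addn1.
  by rewrite !load_cons IH.
by case: l => [|l]; rewrite !load_cons ?addn0 // IH.
Qed.

Lemma load_fill t i l x : i <= t ->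
  load l (fill (pred1 t) i l x) = load l x + (t.+1 == i + unmatched l x).
Proof.
elim: x i l => [|[] x IH] i l it /=; first by rewrite /=; lia.
  by rewrite !load_cons IH.
case: l => [|l] /=; last by rewrite !load_cons IH.
have [->|ne] /= := eqVneq i t; last by rewrite !load_cons IH ?addSnnS //; lia.
rewrite (@fill_ext _ pred0) ?fill0; last by move=> j ?; rewrite /= gtn_eqF //; lia.
by rewrite !load_cons /= load_succ addnS; congr addn; lia.
Qed.

Lemma count_mark i l x : load l x + count id (mark pred0 i l x) = l + count id x.
Proof.
elim: x i l => /= [|[] x IH] i l; rewrite ?load_cons ?addn0 //=.
  by rewrite !add0n; move: (IH i l.+1); lia.
by case: l => [|l] /=; [rewrite !add0n IH|move: (IH i l); lia].
Qed.

Lemma unmatched_count i l x : unmatched l x + count id (mark pred0 i l x) + count id x = size x.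
Proof.
elim: x i l => //= -[] x IH i l /=; first by rewrite -(IH i l.+1); lia.
by case: l => [|l] /=; [rewrite -(IH i.+1 0)|rewrite -(IH i l)]; lia.
Qed.

(** One preliminary pass therefore determines the number of brackets open across the end in the
    cyclic reading; this justifies [paren]. *)
Lemma load_stationary x : (count id x).*2 <= size x -> load (load 0 x) x = load 0 x.
Proof. by move=> H; rewrite load_max; lia. Qed.

Lemma stationary_unique l x : (count id x).*2 < size x -> load l x = l -> l = load 0 x.
Proof. by move=> H; rewrite load_max; lia. Qed.

(** Read backwards, a matched zero reopens its bracket and a one closes it again; an unmatched zero
    is met at load zero and changes nothing. Thus [paren] can be undone. *)
Lemma load_rev i l x : load (load l x) (rev (mark pred0 i l x)) = l.
Proof.
elim: x i l => //= -[] x IH i l; first by rewrite load_cons rev_cons -cats1 load_cat IH.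
by case: l => [|l]; rewrite load_cons rev_cons -cats1 load_cat IH.
Qed.

Lemma mark_inj i i' l l' x x' : size x = size x' -> load l x = load l' x' ->
  mark pred0 i l x = mark pred0 i' l' x' -> x = x' /\ l = l'.
Proof.
elim: x x' i i' l l' => [|b x IH] [|b' x'] //= i i' l l' [sx].
rewrite !load_cons => El Em.
have [i1 [i1' Em']] : exists i1 i1', mark pred0 i1 (step l b) x = mark pred0 i1' (step l' b') x'.
  by case: b b' l l' {El} Em => -[] [|l] [|l'] //= [Em]; do 2 eexists; exact: Em.
have [-> Es] := IH _ _ _ _ _ sx El Em'.
case: b b' l l' {El Em'} Em Es => -[] [|l] [|l'] //= _; rewrite /step //=; first [by move=> *; subst | by case=> *; subst].
Qed.

(* The cyclic parenthesis map: [load 0 x] is the number of brackets open when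
   the word [x], read cyclically, passes through its end. *)
Definition paren (x : bitseq) := mark pred0 0 (load 0 x) x.

Lemma size_paren x : size (paren x) = size x.
Proof. exact: size_mark. Qed.

Lemma count_paren x : (count id x).*2 <= size x -> count id (paren x) = count id x.
Proof.
move=> H; have := count_mark 0 (load 0 x) x; rewrite load_stationary //.
by move/addnI.
Qed.

Lemma paren_words n k x : k.*2 <= n -> x \in words n k -> paren x \in words n k.
Proof.
move=> kn /wordsP[sx cx]; apply/wordsP; rewrite size_paren sx count_paren ?cx //.
by rewrite sx.
Qed.

Lemma paren_inj n k : k.*2 < n -> {in words n k &, injective paren}.
Proof.
move=> kn x y /wordsP[sx cx] /wordsP[sy cy] E.
(* Inverting [mark] needs the final load. It is a stationary load of the reversed image, and such a
   load is unique because zeros outnumber ones strictly. *)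
have H z : size z = n -> count id z = k -> load 0 z = load 0 (rev (paren z)).
  move=> sz cz; apply: stationary_unique.
    by rewrite count_rev size_rev size_paren count_paren ?cz ?sz // ltnW.
  by rewrite -{1}load_stationary ?cz ?sz 1?ltnW // load_rev.
have El : load 0 x = load 0 y by rewrite (H x) // (H y) // E.
have [||] := mark_inj _ _ E; rewrite ?sx ?sy //.
by rewrite !load_stationary ?cx ?cy ?sx ?sy // ltnW.
Qed.

Lemma unmatched_stationary x : (count id x).*2 <= size x ->
  unmatched (load 0 x) x = size x - (count id x).*2.
Proof.
move=> H; have := unmatched_count 0 (load 0 x) x; have := count_paren H.
by rewrite /paren => -> ; lia.
Qed.

Lemma disjointw_paren x : disjointw x (paren x).
Proof. by rewrite -{1}[x](fill0 0 (load 0 x)); apply: disjointw_fill_mark. Qed.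

Lemma nth_mark i l x p : p < size x ->
  nth false (mark pred0 i l x) p = ~~ nth false x p && (0 < load l (take p x)).
Proof.
elim: x i l p => // b x IH i l [|p] /=; first by case: b; case: l.
by move=> px; rewrite load_cons -(IH i) //; case: b; case: l => // *; rewrite (@mark_high _ i.+1) ?(@mark_high _ i).
Qed.

Definition loadat x p := load (load 0 x) (take p x).

Lemma loadatS x p : p < size x -> loadat x p.+1 = step (loadat x p) (nth false x p).
Proof. by move=> px; rewrite /loadat (take_nth false) // -cats1 load_cat. Qed.

Lemma nth_paren x p : p < size x ->
  nth false (paren x) p = ~~ nth false x p && (0 < loadat x p).
Proof. exact: nth_mark. Qed.

Definition Uat x p := ~~ nth false x p && (loadat x p == 0).

(* Adjacent positions receive the same number of visits by unmatched zeros
   over a period, since the sum over a period of the xor terms is shift invariant. *)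
Lemma xor_paren x p : p.+1 < size x ->
  (nth false (paren x) p (+) nth false (paren x) p.+1) + Uat x p
  = (nth false x p (+) nth false x p.+1) + Uat x p.+1.
Proof.
move=> px; have px' := ltnW px.
rewrite (nth_paren px) (nth_paren px') /Uat (loadatS px').
by case: (nth false x p); case: (nth false x p.+1) => //=; case: (loadat x p) => [|[|l]].
Qed.

Lemma unmatched_Uat x : 0 < unmatched (load 0 x) x -> exists2 p, p < size x & Uat x p.
Proof.
rewrite /Uat /loadat; elim: x (load 0 x) => //= b x IH l.
have H : 0 < unmatched (step l b) x -> exists2 p, p < (size x).+1 &
    ~~ nth false (b :: x) p && (load l (take p (b :: x)) == 0).
  by move=> /IH[p px Hp]; exists p.+1.
case: b H => //= H; case: l H => [|l] //= H _.
by exists 0.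
Qed.

Lemma monotone_periodic (a : nat -> nat) t : 0 < t -> (forall i, a (i + t) = a i) ->
  (forall i, a i <= a i.+1) -> forall i, a i.+1 = a i.
Proof.
move=> t0 per mono i.
have H j : a i <= a (i + j).
  by elim: j => [|j IH]; rewrite ?addn0 // addnS (leq_trans IH).
have H' j : a i.+1 <= a (i.+1 + j).
  by elim: j => [|j IH]; rewrite ?addn0 // addnS (leq_trans IH).
have := H' t.-1; rewrite addSnnS prednK // per => h.
by apply/eqP; rewrite eqn_leq h mono.
Qed.

(** If position [q] is never an unmatched zero along the orbit, [xor_paren] makes the xor of the
    letters at [q] and [q.+1] monotone in time; being periodic it is constant, so [q.+1] is never
    one either, and conversely. A single missed position would then exclude all, but every word has
    [n - 2k > 0] unmatched zeros. *)
Lemma paren_visits n k x p : k.*2 < n -> x \in words n k -> p < n ->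
  exists i, Uat (iter i paren x) p.
Proof.
move=> kn xV pn.
have [t t0 Et] := injective_on_iter (words_uniq n k)
  (fun y => @paren_words n k y (ltnW kn)) (@paren_inj n k kn) xV.
have iV i : iter i paren x \in words n k.
  by elim: i => //= i; apply/paren_words/ltnW.
have per i : iter (i + t) paren x = iter i paren x by rewrite iterD Et.
pose xorat p i := nat_of_bool (nth false (iter i paren x) p (+) nth false (iter i paren x) p.+1).
have perx q i : xorat q (i + t) = xorat q i by rewrite /xorat per.
have eqx q i : q.+1 < n ->
    xorat q i.+1 + Uat (iter i paren x) q = xorat q i + Uat (iter i paren x) q.+1.
  by move=> qn; rewrite /xorat iterS xor_paren //; have /wordsP[->] := iV i.
have bij q : q.+1 < n -> (forall i, ~~ Uat (iter i paren x) q) <->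
    (forall i, ~~ Uat (iter i paren x) q.+1).
  move=> qn; split=> H i; have := eqx q i qn.
    have mono j : xorat q j <= xorat q j.+1.
      by have := eqx q j qn; rewrite (negPf (H j)); lia.
    by have := monotone_periodic t0 (perx q) mono i; rewrite (negPf (H i)); lia.
  pose b j := 1 - xorat q j.
  have mono j : b j <= b j.+1.
    by have := eqx q j qn; rewrite (negPf (H j)) /b; lia.
  have perb j : b (j + t) = b j by rewrite /b perx.
  have := monotone_periodic t0 perb mono i; rewrite (negPf (H i)) /b.
  have le1 : xorat q i <= 1 by rewrite /xorat; case: (_ (+) _).
  by case: (Uat _ _) => //; lia.
have [/forallP E|] := boolP [forall i : 'I_t, ~~ Uat (iter i paren x) p]; last first.
  by rewrite negb_forall => /existsP[i]; rewrite negbK => Hi; exists i.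
have never i : ~~ Uat (iter i paren x) p.
  elim/ltn_ind: i => i IH; case: (ltnP i t) => it; first exact: (E (Ordinal it)).
  by rewrite -(subnK it) per; apply: IH; lia.
have zero i : ~~ Uat (iter i paren x) 0.
  move: pn never {E} i; elim: (p) => // q IH qn never; apply: IH; first exact: ltnW.
  by apply/bij.
have all q : q < n -> forall i, ~~ Uat (iter i paren x) q.
  elim: q => [|q IH] qn; first exact: zero.
  exact: (bij q qn).1 (IH (ltnW qn)).
have /wordsP[sx cx] := xV.
have [] := @unmatched_Uat x; first by rewrite unmatched_stationary sx cx ?subn_gt0 // ltnW.
by move=> q qn Uq; have := all q; rewrite -sx => /(_ qn 0); rewrite Uq.
Qed.

Lemma count_fill t i l x : i <= t < i + unmatched l x ->
  count id (fill (pred1 t) i l x) = (count id x).+1.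
Proof.
elim: x i l => /= [|[] x IH] i l /= it; first by lia.
  by rewrite IH ?addnS.
case: l it => [|l] /= it; last by rewrite IH.
have [E|ne] /= := eqVneq i t; last by rewrite IH //; lia.
by rewrite (@fill_ext _ pred0) ?fill0 ?add1n // => j ?; rewrite /= gtn_eqF //; lia.
Qed.

Lemma mark_fill_last (P : pred nat) t i l x : i <= t -> t.+1 = i + unmatched l x ->
  (forall j, t <= j -> ~~ P j) -> mark P i l (fill (pred1 t) i l x) = mark P i l x.
Proof.
move=> it Et HP; rewrite mark_fill //; apply: mark_ext => j ?.
by rewrite [j == _]ltn_eqF ?orbF //; lia.
Qed.

(** The single bracket left open is either one of the initial [l], or a letter of [y]. In the second
    case erasing it leaves an unmatched zero, the last one. For [l = 0] this identifies the words of
    load 1 with the values of [pad] at words of load 0. *)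
Lemma open_one_split i l y : load l y = 1 ->
  [/\ 0 < l, load l.-1 y = 0 & unmatched l.-1 y = 0] \/
  (exists z, [/\ y = fill (pred1 (i + unmatched l z).-1) i l z, size z = size y,
     0 < unmatched l z & load l z = 0]).
Proof.
elim: y i l => [|b y IH] i l; first by rewrite /load /= => ->; left.
rewrite load_cons => /IH{}IH.
have {}IH : [\/ [/\ 0 < step l b, load (step l b).-1 y = 0 & unmatched (step l b).-1 y = 0]
  | exists z, [/\ b :: y = fill (pred1 (i + unmatched l (b :: z)).-1) i l (b :: z), size z = size y,
     0 < unmatched l (b :: z) & load l (b :: z) = 0]].
  case: b IH; case: l => [|l] IH.
  - by case: (IH i) => [?|[z [E1 E2 E3 E4]]]; [left|right; exists z; rewrite /= -E1].
  - by case: (IH i) => [?|[z [E1 E2 E3 E4]]]; [left|right; exists z; rewrite /= -E1].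
  - case: (IH i.+1) => [?|[z [E1 E2 E3 E4]]]; [left|right; exists z] => //=.
    have -> : (i + (unmatched 0 z).+1).-1 = (i.+1 + unmatched 0 z).-1 by lia.
    by move: E1 E3; rewrite /= => E1 E3; rewrite -E1 ltn_eqF //; lia.
  - by case: (IH i) => [?|[z [E1 E2 E3 E4]]]; [left|right; exists z; rewrite /= -E1].
case: IH => [[l0 E1 E2]|[z [E1 E2 E3 E4]]]; last by right; exists (b :: z); rewrite /= E2.
case: b l l0 E1 E2 => -[|l] //= l0 E1 E2.
- right; exists (false :: y) => /=; rewrite E2 addn1 eqxx load_cons E1; split=> //.
  by rewrite (@fill_ext _ pred0) ?fill0 // => j; rewrite E2; lia.
- by left.
by left; case: l l0 E1 E2.
Qed.

Lemma load_nil l : load l [::] = l.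
Proof. by []. Qed.

(** When no bracket is open at the end, filling the last unmatched zero leaves all marks unchanged
    ([mark_fill_last]). *)
Definition pad (z : bitseq) : bitseq :=
  if load 0 z == 0 then fill (pred1 (unmatched 0 z).-1) 0 0 z else z.

Lemma size_pad z : size (pad z) = size z.
Proof. by rewrite /pad; case: ifP => // _; rewrite size_fill. Qed.

Lemma subw_pad z : subw z (pad z).
Proof.
rewrite /pad; case: ifP => _; last exact: subw_refl.
by rewrite -{1}[z](fill0 0 0); apply: subw_fill.
Qed.

Lemma pad_cat10 y : pad (y ++ [:: true; false]) = pad y ++ [:: true; false].
Proof.
rewrite /pad load_cat !load_cons load_nil unmatched_cat /= addn0.
by case: eqP => // E; rewrite fill_cat E.
Qed.

Lemma pad_cat01 y : pad (y ++ [:: false; true]) = y ++ [:: false; true].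
Proof. by rewrite /pad load_cat. Qed.

Lemma pad_cat11 y : pad (y ++ [:: true; true]) = y ++ [:: true; true].
Proof. by rewrite /pad load_cat. Qed.

Lemma pad_cat00 y : load 0 y <= 1 -> pad (y ++ [:: false; false]) = y ++ [:: false; true].
Proof.
rewrite /pad load_cat => ly; case: eqP => [_|]; last by case: (load 0 y) ly => [|[]].
rewrite unmatched_cat fill_cat (@fill_ext _ pred0) ?fill0.
  by case: (load 0 y) ly => [|[]] //= _; rewrite ?addn0 ?addn1 ?addn2 /= ?eqxx // [_ == _]ltn_eqF.
by move=> j /=; case: (load 0 y) ly => [|[]] //=; lia.
Qed.

Definition alt (k m : nat) : bitseq := flatten (nseq k [:: true; false]) ++ nseq m false.
Definition alt' (k m : nat) : bitseq := flatten (nseq k [:: false; true]) ++ nseq m false.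

Lemma mark_nseq0 P i m : mark P i 0 (nseq m false) = [seq P j | j <- iota i m].
Proof. by elim: m i => //= m IH i; rewrite IH. Qed.

Lemma fill_nseq0 P i m : fill P i 0 (nseq m false) = [seq P j | j <- iota i m].
Proof. by elim: m i => //= m IH i; rewrite IH. Qed.

Lemma alt_word k m : alt k m \in words (k.*2 + m) k.
Proof.
apply/wordsP; elim: k => [|k [IH1 IH2]]; last by rewrite /= IH1 IH2.
by rewrite /alt /= size_nseq count_nseq mul0n.
Qed.

Lemma alt'_word k m : alt' k m \in words (k.*2 + m) k.
Proof.
apply/wordsP; elim: k => [|k [IH1 IH2]]; last by rewrite /= IH1 IH2.
by rewrite /alt' /= size_nseq count_nseq mul0n.
Qed.

Lemma load_alt k m : load 0 (alt k m) = 0.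
Proof. by elim: k => [|k IH]; [elim: m|rewrite /alt /= !load_cons]. Qed.

Lemma unmatched_alt k m : unmatched 0 (alt k m) = m.
Proof. by elim: k => [|k IH] //; elim: m => //= m ->. Qed.

Lemma mark_alt P k m : mark P 0 0 (alt k m) = flatten (nseq k [:: false; true]) ++ map P (iota 0 m).
Proof. by elim: k => [|k IH] /=; [exact: mark_nseq0|rewrite IH]. Qed.

Lemma fill_alt P i k m : fill P i 0 (alt k m) = flatten (nseq k [:: true; false]) ++ map P (iota i m).
Proof. by elim: k => [|k IH] /=; [exact: fill_nseq0|rewrite IH]. Qed.

Lemma mark0_alt k m : mark pred0 0 0 (alt k m) = alt' k m.
Proof. by rewrite mark_alt; congr (_ ++ _); elim: m 0 => //= m IH i; rewrite IH. Qed.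

Lemma paren_alt k m : paren (alt k m) = alt' k m.
Proof. by rewrite /paren load_alt mark0_alt. Qed.

Lemma load2_alt k m F G : alt k m = F ++ true :: G -> load 2 F = 2.
Proof.
elim: k F => [|k IH] F; last by case: F => [|[] [|[] F]] //= [/IH].
move=> E; have : true \in nseq m false by rewrite -[nseq _ _]/(alt 0 m) E mem_cat mem_head orbT.
by rewrite mem_nseq andbF.
Qed.

Lemma alternate_shift k s : flatten (nseq k [:: false; true]) ++ false :: s =
  false :: flatten (nseq k [:: true; false]) ++ s.
Proof. by elim: k => //= k ->. Qed.

Lemma alternate_rcons k s : flatten (nseq k.+1 [:: true; false]) ++ s =
  flatten (nseq k [:: true; false]) ++ true :: false :: s.
Proof. by elim: k => //= k IH; rewrite -IH. Qed.

Lemma fill_first l y : 0 < unmatched l y ->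
  exists F G, fill (pred1 0) 0 l y = F ++ true :: G /\ load l F = 0.
Proof.
elim: y l => //= -[] y IH l.
  by move=> /IH[F [G [-> E]]]; exists (true :: F), G.
case: l => [|l] /=; first by exists [::], (fill (pred1 0) 1 0 y).
by move=> /IH[F [G [-> E]]]; exists (false :: F), G.
Qed.

Lemma load_ones l j : load l (nseq j true) = l + j.
Proof. by elim: j l => [|j IH] l; rewrite ?addn0 // load_cons IH addSnnS. Qed.

Lemma mark_ones P i l j : mark P i l (nseq j true) = nseq j false.
Proof. by elim: j l => //= j IH l; rewrite IH. Qed.

Lemma fill_ones P i l j : fill P i l (nseq j true) = nseq j true.
Proof. by elim: j l => //= j IH l; rewrite IH. Qed.

Lemma unmatched_ones l j : unmatched l (nseq j true) = 0.
Proof. by elim: j l => //= j IH l; rewrite IH. Qed.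

(** * Kneser graphs of excess at least three *)

(** Both the avoidance of [pad z] and the prescribed arc, on which the cycle agrees with [paren],
    serve the induction on [k]. *)
Definition padded_cycle (m k : nat) (c : seq bitseq) :=
  [/\ uniq c, c =i words (k.*2 + m) k, cycle (fun z w => disjointw (pad z) w) c
    & next c (alt k m) = alt' k m].

Ltac nat_lia :=
  repeat match goal with H : ?T |- _ =>
    lazymatch T with
    | nat => fail | bool => fail | is_true (leq _ _) => fail | @eq nat _ _ => fail
    | is_true (negb (@eq_op _ _ _)) => fail | is_true (andb (leq _ _) (leq _ _)) => fail
    | _ => clear H
    end
  end; lia.

Section KneserStep.
Variables (m a : nat) (c : seq bitseq).
Hypotheses (m_gt2 : 2 < m) (Hc : padded_cycle m a c).

Let N := a.*2 + m.
Let n := a.+1.*2 + m.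
Let z1 := alt a m.
Let V := words n a.+1.

(* A permutation of the words of length [n] sending every word to a disjoint one.
   On the words ending in 10 or 01 it follows the cycle [c]. *)
Definition gstep (x : bitseq) : bitseq :=
  let y := take N x in
  match drop N x with
  | [:: true; false] => next c y ++ [:: false; true]
  | [:: false; true] => next c y ++ [:: true; false]
  | [:: false; false] =>
      if load 0 y == 1 then mark (pred1 0) 0 0 y ++ [:: false; false] else paren x
  | _ => paren x
  end.

Let runlen (x : bitseq) := find negb (rev x).
(** No bracket is open just before the zero that precedes the final run of ones, so this zero is
    unmatched. *)
Let at_unmatched (x : bitseq) := load (load 0 x) (take (size x - (runlen x).+1) x) == 0.

(* Every arc [x -> gstep x] gets a tail label containing [pad x] and a disjoint
   head label containing [gstep x]; the heads of two arcs with the same tail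
   label, or the tails of two arcs with the same head label, can be swapped. *)
Definition tail_label (x : bitseq) : bitseq :=
  let y := take N x in
  match drop N x with
  | [:: true; false] => pad x
  | [:: false; true] =>
      if y == z1 then fill (pred1 (m - 2)) 0 0 z1 ++ [:: false; true]
      else pad y ++ [:: false; true]
  | [:: false; false] => if x == alt a.+1 m then map negb (alt' a.+1 m) else pad x
  | _ => if at_unmatched x then
           fill (pred1 (if odd (runlen x) then 1 else m.-1)) 0 (load 0 x) x
         else x
  end.

(** The tail label of [z1] followed by 01 fills zero [m - 2], to make a link of its own (see
    [Qnext_z1]), so its link with [pad z1] followed by 00 is a common head label instead. For words
    ending in 11 the parity of the final run selects the zero, so that runs of length [j] and
    [j - 1] can share a tail label if [j] is odd and a head label if [j] is even. *)
Definition head_label (x : bitseq) : bitseq :=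
  let y := take N x in
  match drop N x with
  | [:: true; false] => gstep x
  | [:: false; true] => if y == z1 then mark (pred1 0) 0 0 z1 ++ [:: true; false] else gstep x
  | [:: false; false] =>
      if load 0 y == 1 then
        if y == pad z1 then mark (pred1 0) 0 0 z1 ++ [:: true; false]
        else mark (fun j => j < 2) 0 0 y ++ [:: false; false]
      else gstep x
  | _ => if at_unmatched x then
           mark (pred1 (if odd (runlen x) then 0 else 1)) 0 (load 0 x) x
         else paren x
  end.

Let uc : uniq c. Proof. by case: Hc. Qed.
Let cW : c =i words N a. Proof. by case: Hc. Qed.
Let cyc : cycle (fun z w => disjointw (pad z) w) c. Proof. by case: Hc. Qed.
Let next_z1 : next c z1 = alt' a m. Proof. by case: Hc. Qed.

Let next_word y : y \in words N a -> next c y \in words N a.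
Proof. by rewrite -!cW mem_next. Qed.

Let disj_next y : y \in words N a -> disjointw (pad y) (next c y).
Proof. by rewrite -cW; apply: next_cycle cyc. Qed.

Let next_inj : injective (next c).
Proof. exact: can_inj (prev_next uc). Qed.

Let z1W : z1 \in words N a. Proof. exact: alt_word. Qed.

Section Eqs.
Variable y : bitseq.
Hypothesis sy : size y = N.
Let tdE s : (take N (y ++ s) = y) * (drop N (y ++ s) = s).
Proof. by rewrite -sy take_size_cat ?drop_size_cat. Qed.
Lemma gstep10 : gstep (y ++ [:: true; false]) = next c y ++ [:: false; true].
Proof. by rewrite /gstep !tdE. Qed.
Lemma gstep01 : gstep (y ++ [:: false; true]) = next c y ++ [:: true; false].
Proof. by rewrite /gstep !tdE. Qed.
Lemma gstep11 : gstep (y ++ [:: true; true]) = paren (y ++ [:: true; true]).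
Proof. by rewrite /gstep !tdE. Qed.
Lemma gstep00 : gstep (y ++ [:: false; false]) =
  if load 0 y == 1 then mark (pred1 0) 0 0 y ++ [:: false; false] else paren (y ++ [:: false; false]).
Proof. by rewrite /gstep !tdE. Qed.
Lemma tail10 : tail_label (y ++ [:: true; false]) = pad y ++ [:: true; false].
Proof. by rewrite /tail_label !tdE pad_cat10. Qed.
Lemma tail01 : tail_label (y ++ [:: false; true]) =
  if y == z1 then fill (pred1 (m - 2)) 0 0 z1 ++ [:: false; true] else pad y ++ [:: false; true].
Proof. by rewrite /tail_label !tdE. Qed.
Lemma tail00 : tail_label (y ++ [:: false; false]) =
  if y ++ [:: false; false] == alt a.+1 m then map negb (alt' a.+1 m) else pad (y ++ [:: false; false]).
Proof. by rewrite /tail_label !tdE. Qed.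
Lemma tail11 : tail_label (y ++ [:: true; true]) = let x := y ++ [:: true; true] in
  if at_unmatched x then
    fill (pred1 (if odd (runlen x) then 1 else m.-1)) 0 (load 0 x) x else x.
Proof. by rewrite /tail_label !tdE. Qed.
Lemma head10 : head_label (y ++ [:: true; false]) = next c y ++ [:: false; true].
Proof. by rewrite /head_label !tdE gstep10. Qed.
Lemma head01 : head_label (y ++ [:: false; true]) =
  if y == z1 then mark (pred1 0) 0 0 z1 ++ [:: true; false] else next c y ++ [:: true; false].
Proof. by rewrite /head_label !tdE gstep01. Qed.
Lemma head00 : head_label (y ++ [:: false; false]) =
  if load 0 y == 1 then
    if y == pad z1 then mark (pred1 0) 0 0 z1 ++ [:: true; false]
    else mark (fun j => j < 2) 0 0 y ++ [:: false; false]
  else paren (y ++ [:: false; false]).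
Proof. by rewrite /head_label !tdE gstep00; case: eqP. Qed.
Lemma head11 : head_label (y ++ [:: true; true]) = let x := y ++ [:: true; true] in
  if at_unmatched x then
    mark (pred1 (if odd (runlen x) then 0 else 1)) 0 (load 0 x) x else paren x.
Proof. by rewrite /head_label !tdE. Qed.
End Eqs.

Let nE : n = N.+2. Proof. by rewrite /n /N. Qed.

Let split2 x : x \in V -> exists y c1 c2, [/\ size y = N, x = y ++ [:: c1; c2] &
  count id y + (c1 + c2) = a.+1].
Proof.
move=> /wordsP[sx cx]; exists (take N x).
have s1 : size (take N x) = N by rewrite size_takel // sx nE; lia.
have : size (drop N x) = 2 by rewrite size_drop sx nE; lia.
case E : (drop N x) => [|c1 [|c2 []]] // _; exists c1, c2; rewrite -E cat_take_drop; split=> //.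
by rewrite -cx -{2}(cat_take_drop N x) count_cat E /= addn0.
Qed.

Let V2 y (c1 c2 : bool) : size y = N -> count id y + (c1 + c2) = a.+1 -> y ++ [:: c1; c2] \in V.
Proof. by move=> sy cy; apply/wordsP; rewrite size_cat sy nE count_cat -cy /= addn0 addn2. Qed.

Let stat z : z \in words N a -> (count id z).*2 <= size z.
Proof. by move=> /wordsP[-> ->]; rewrite /N; lia. Qed.

Let unm z : z \in words N a -> load 0 z = 0 -> unmatched 0 z = m.
Proof.
move=> zW z0; have := unmatched_stationary (stat zW); rewrite z0 => ->.
by move/wordsP: zW => [-> ->]; rewrite /N; lia.
Qed.

Let statV x : x \in V -> (count id x).*2 <= size x.
Proof. by move=> /wordsP[-> ->]; rewrite /n; lia. Qed.

Let unmV x : x \in V -> unmatched (load 0 x) x = m.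
Proof.
move=> xV; rewrite (unmatched_stationary (statV xV)).
by move/wordsP: xV => [-> ->]; rewrite /n; lia.
Qed.

Let padE z : z \in words N a -> load 0 z = 0 -> pad z = fill (pred1 m.-1) 0 0 z.
Proof. by move=> zW z0; rewrite /pad z0 unm. Qed.

Let load1_pad y : size y = N -> count id y = a.+1 -> load 0 y = 1 ->
  exists z, [/\ z \in words N a, load 0 z = 0 & y = pad z].
Proof.
move=> sy cy ly; have [[]//|[z [E1 E2 E3 E4]]] := open_one_split 0 ly.
have zW : z \in words N a.
  apply/wordsP; rewrite E2 sy; split=> //; apply/eqP; rewrite -eqSS -cy {1}E1 count_fill //.
  by rewrite add0n; lia.
by exists z; rewrite /pad E4 eqxx.
Qed.

Let load_pad z : z \in words N a -> load 0 z = 0 -> load 0 (pad z) = 1.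
Proof. by move=> zW z0; rewrite padE // load_fill // z0 unm //; lia. Qed.

Let mark_pad (P : pred nat) z : z \in words N a -> load 0 z = 0 ->
  (forall j, m.-1 <= j -> ~~ P j) -> mark P 0 0 (pad z) = mark P 0 0 z.
Proof.
by move=> zW z0 HP; rewrite padE // mark_fill_last // unm //; lia.
Qed.

Let pad_inj z z' : z \in words N a -> z' \in words N a -> load 0 z = 0 -> load 0 z' = 0 ->
  pad z = pad z' -> z = z'.
Proof.
move=> zW zW' z0 z0' E.
have [|||//] := @mark_inj 0 0 0 0 z z'; rewrite ?z0 ?z0' //.
  by move/wordsP: zW => [-> _]; move/wordsP: zW' => [-> _].
by rewrite -(mark_pad zW) // -[RHS](mark_pad zW') // E.
Qed.

(** Since [z] followed by 01 is moved along [c], its image under [paren], a word ending in 00, is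
    left without a preimage. The word [pad z] followed by 00 takes it over, as its own image under
    [paren] would end in 10. *)
Let gstep_pad z : z \in words N a -> load 0 z = 0 ->
  gstep (pad z ++ [:: false; false]) = paren (z ++ [:: false; true]).
Proof.
move=> zW z0; have /wordsP[sz _] := zW.
rewrite gstep00 ?size_pad // load_pad // eqxx mark_pad //; last by move=> j /=; lia.
rewrite /paren load_cat z0 mark_cat.
have -> : mark (pred1 0) 0 0 z = mark pred0 0 1 z.
  by rewrite (@mark_shift 1 0 0) //; apply: mark_ext => -[].
by congr (_ ++ _); rewrite load_succ z0 unm //; case: m m_gt2.
Qed.

Let mixed (x : bitseq) := exists y b, x = y ++ [:: b; ~~ b] /\ y \in words N a.

(* Outside the mixed words [gstep] is [paren], except that [pad z ++ 00] is treated as [z ++ 01]. *)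
Let gstep_nonmixed x : x \in V -> mixed x \/ exists w b,
  [/\ w \in V, gstep x = paren w, drop N (paren w) = [:: b; b] &
    (w = x /\ exists y b, x = y ++ [:: b; b]) \/ exists z, [/\ z \in words N a, load 0 z = 0, x = pad z ++ [:: false; false] & w = z ++ [:: false; true]]].
Proof.
move=> xV; have [y [c1 [c2 [sy Ex cy]]]] := split2 xV.
have dE i l s : drop N (mark pred0 i l (y ++ s)) = mark pred0 (i + unmatched l y) (load l y) s.
  by rewrite mark_cat drop_size_cat // size_mark.
case: (eqVneq c1 c2) => [E|ne]; last first.
  left; exists y, c1; split; first by rewrite Ex; case: c1 c2 ne {Ex cy} => [] [].
  by apply/wordsP; split=> //; case: c1 c2 ne cy {Ex} => [] [] //= _; lia.
right; subst c2; case: c1 => [] in Ex cy.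
  exists x, false; split=> //; last by left; split=> //; exists y, true.
    by rewrite Ex gstep11.
  by rewrite Ex /paren load_cat dE.
have cy' : count id y = a.+1 by move: cy; rewrite addn0.
case: (eqVneq (load 0 y) 1) => [ly|ny].
  have [z [zW z0 Ey]] := load1_pad sy cy' ly; have /wordsP[sz cz] := zW.
  exists (z ++ [:: false; true]), false; split.
  - by apply: V2 => //; rewrite cz addn1.
  - by rewrite Ex Ey gstep_pad.
  - rewrite /paren load_cat z0 mark_cat drop_size_cat ?size_mark //.
    by rewrite load_succ z0 unm //; case: m m_gt2.
  by right; exists z; rewrite Ex Ey.
have mono := load_mono y (leq0n (load 0 x)).
exists x, (1 < load (load 0 x) y); split=> //; last by left; split=> //; exists y, false.
  by rewrite Ex gstep00 // (negPf ny).
rewrite {1}/paren {2}Ex dE; move: mono.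
have -> : load 0 x = (load 0 y).-2 by rewrite Ex load_cat.
move E: (load 0 y) ny => l; case: l E => [|[|l]] // E _; first by rewrite /= E.
by case: (load _ y) => [|[|l']].
Qed.

Let gstepV x : x \in V -> gstep x \in V.
Proof.
move=> xV; have [[y [b [-> yW]]]|[w [b [wV -> _ _]]]] := gstep_nonmixed xV; last first.
  by apply: paren_words => //; rewrite /n; lia.
have /wordsP[sy cy] := yW; have /wordsP[sy' cy'] := next_word yW.
case: b => /=; rewrite (gstep10, gstep01) //; apply: V2 => //; rewrite cy'; lia.
Qed.

Let size_gstep x : x \in V -> size (gstep x) = n.
Proof. by move/gstepV/wordsP => []. Qed.

Let cat2_inj y y' (s s' : bitseq) : size y = N -> size y' = N -> y ++ s = y' ++ s' -> y = y' /\ s = s'.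
Proof. by move=> sy sy' /eqP; rewrite eqseq_cat ?sy ?sy' // => /andP[/eqP-> /eqP->]. Qed.

Let gstep_inj : {in V &, injective gstep}.
Proof.
have mix y b : y \in words N a -> gstep (y ++ [:: b; ~~ b]) = next c y ++ [:: ~~ b; b].
  by move=> /wordsP[sy _]; case: b; rewrite (gstep10, gstep01).
have dmix y b d : y \in words N a -> drop N (gstep (y ++ [:: b; ~~ b])) <> [:: d; d].
  move=> yW; have /wordsP[sy' _] := next_word yW; rewrite mix // drop_size_cat //.
  by case: b; case: d.
move=> x x' xV xV'; have [[y [b [-> yW]]]|[w [b [wV Ew dw Hw]]]] := gstep_nonmixed xV;
  have [[y' [b' [-> yW']]]|[w' [b' [wV' Ew' dw' Hw']]]] := gstep_nonmixed xV'.
- rewrite !mix //; have /wordsP[sy _] := next_word yW; have /wordsP[sy' _] := next_word yW'.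
  by move=> /cat2_inj[] // /next_inj -> [_ ->].
- by move=> E; case: (dmix y b b' yW); rewrite E Ew'.
- by move=> E; case: (dmix y' b' b yW'); rewrite -E Ew.
rewrite Ew Ew' => /(@paren_inj n a.+1) E.
have {}E : w = w' by apply: E => //; rewrite /n; lia.
case: Hw Hw' => [[Wx [y1 [b1 Ex]]]|[z [zW z0 -> Ez]]] [[Wx' [y2 [b2 Ex']]]|[z' [zW' z0' -> Ez']]] //.
- by rewrite -Wx -Wx'.
- move: E; rewrite Ez' Wx Ex => /(congr1 (drop N)); have /wordsP[sz _] := zW'.
  have sy1 : size y1 = N by move/wordsP: xV => []; rewrite Ex size_cat nE /=; lia.
  by rewrite !drop_size_cat //; case: b1 {Ex}.
- move: E; rewrite Ez Wx' Ex' => /(congr1 (drop N)); have /wordsP[sz _] := zW.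
  have sy1 : size y2 = N by move/wordsP: xV' => []; rewrite Ex' size_cat nE /=; lia.
  by rewrite !drop_size_cat //; case: b2 {Ex'}.
have /wordsP[sz _] := zW; have /wordsP[sz' _] := zW'.
by move: E; rewrite Ez Ez' => /cat2_inj[] // ->.
Qed.

Let alt_split : alt a.+1 m = alt a.+1 (m - 2) ++ [:: false; false].
Proof. by rewrite {1}/alt -{1}(subnK (ltnW m_gt2)) nseqD catA. Qed.

Let size_alt_split : size (alt a.+1 (m - 2)) = N.
Proof. by have /wordsP[-> _] := alt_word a.+1 (m - 2); rewrite /N; lia. Qed.

Lemma tail_label_alt : tail_label (alt a.+1 m) = map negb (alt' a.+1 m).
Proof. by rewrite {1}alt_split tail00 // -alt_split eqxx. Qed.

Let gstep_alt : gstep (alt a.+1 m) = alt' a.+1 m.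
Proof. by rewrite {1}alt_split gstep00 // load_alt -alt_split paren_alt. Qed.

Let head_alt : head_label (alt a.+1 m) = alt' a.+1 m.
Proof. by rewrite {1}alt_split head00 // load_alt -alt_split paren_alt. Qed.

Let disj_pad_mark x : disjointw (pad x) (mark pred0 0 (load 0 x) x).
Proof.
rewrite /pad; case: eqP => [->|_].
  by apply: disjointw_fill_mark => j; rewrite andbF.
exact: disjointw_paren.
Qed.

Lemma size_tail_label x : x \in V -> size (tail_label x) = n.
Proof.
move=> xV; have [y [c1 [c2 [sy Ex cy]]]] := split2 xV; have /wordsP[sx _] := xV.
case: c1 c2 Ex {cy} => [] [] Ex.
- by rewrite Ex tail11 //= -Ex; case: ifP; rewrite ?size_fill.
- by rewrite Ex tail10 // -pad_cat10 -Ex size_pad.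
- have /wordsP[sz _] := z1W.
  by rewrite Ex tail01 //; case: ifP => _; rewrite size_cat ?size_fill ?size_pad ?sy ?sz nE addn2.
rewrite Ex tail00 // -Ex; case: ifP => _; rewrite ?size_pad // size_map.
by have /wordsP[] := alt'_word a.+1 m.
Qed.

Lemma size_head_label x : x \in V -> size (head_label x) = n.
Proof.
move=> xV; have [y [c1 [c2 [sy Ex cy]]]] := split2 xV; have /wordsP[sx _] := xV.
have /wordsP[sz _] := z1W.
case: c1 c2 Ex cy => [] [] Ex cy.
- by rewrite Ex head11 //= -Ex; case: ifP; rewrite ?size_mark ?size_paren.
- by rewrite Ex head10 // -gstep10 // -Ex size_gstep.
- rewrite Ex head01 //; case: ifP => _; last by rewrite -gstep01 // -Ex size_gstep.
  by rewrite size_cat ?size_mark ?sz nE addn2.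
rewrite Ex head00 // -Ex; case: ifP => _; last by rewrite size_paren.
by case: ifP => _; rewrite size_cat size_mark ?sz ?sy nE addn2.
Qed.

Let sub_mark_z1 : subw (alt' a m) (mark (pred1 0) 0 0 z1).
Proof. by rewrite -mark0_alt; apply: subw_mark. Qed.

(** Off the lifted arcs, disjointness says that filled and marked zeros have different numbers:
    [m - 1] against 0 and 1, [m - 2] against 0, and 1 against 0. This is where [m > 2] enters. *)
Lemma label_props x : x \in V ->
  [/\ disjointw (tail_label x) (head_label x), subw (pad x) (tail_label x)
    & subw (gstep x) (head_label x)].
Proof.
move=> xV; have [y [c1 [c2 [sy Ex cy]]]] := split2 xV; have /wordsP[sx _] := xV.
have /wordsP[sz1 cz1] := z1W; have /wordsP[sz2 _] := alt'_word a m.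
case: c1 c2 Ex cy => [] [] Ex cy.
- rewrite Ex tail11 // head11 // gstep11 // pad_cat11 -Ex /=.
  case: ifP => _; last by rewrite disjointw_paren !subw_refl.
  split.
  + apply: disjointw_fill_mark => j _ /=; case: (odd _); lia.
  + by rewrite -{1}[x](fill0 0 (load 0 x)); apply: subw_fill.
  exact: subw_mark.
- have yW : y \in words N a by apply/wordsP; split=> //; move: cy => /=; lia.
  have /wordsP[sy' _] := next_word yW.
  rewrite Ex tail10 // head10 // gstep10 // pad_cat10 !subw_refl; split=> //.
  by rewrite disjointw_cat ?size_pad ?sy ?sy' // disj_next.
- have yW : y \in words N a by apply/wordsP; split=> //; move: cy => /=; lia.
  have /wordsP[sy' _] := next_word yW.
  rewrite Ex tail01 // head01 // gstep01 // pad_cat01.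
  case: eqP => [->|_]; last first.
    by rewrite disjointw_cat ?size_pad ?sy ?sy' // disj_next // subw_cat ?size_pad ?subw_pad // !subw_refl.
  rewrite disjointw_cat ?size_fill ?size_mark // subw_cat ?size_fill // subw_cat ?size_mark ?next_z1 ?sz1 ?sz2 //.
  rewrite sub_mark_z1 !subw_refl disjointw_fill_mark; last by move=> j _ /=; lia.
  by split=> //; rewrite -{1}[z1](fill0 0 0) subw_fill.
have cy' : count id y = a.+1 by move: cy; rewrite addn0.
case: (eqVneq x (alt a.+1 m)) => [Exa|nxa].
  rewrite Exa tail_label_alt head_alt gstep_alt subw_refl disjointwC disjointw_negb; split=> //.
  have := disj_pad_mark (alt a.+1 m); rewrite load_alt mark0_alt.
  have : size (alt a.+1 m) = size (alt' a.+1 m).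
    by have /wordsP[-> _] := alt_word a.+1 m; have /wordsP[-> _] := alt'_word a.+1 m.
  rewrite -size_pad; elim: (pad _) (alt' _ _) => [|b s IH] [|b' s'] //= [E].
  by rewrite disjointw_cons subw_cons => /andP[bb /(IH _ E) ->]; case: b bb; case: b'.
rewrite Ex tail00 // -Ex (negPf nxa) Ex head00 // gstep00 // subw_refl.
case: (eqVneq (load 0 y) 1) => ly; last first.
  by rewrite subw_refl -Ex disj_pad_mark.
rewrite pad_cat00 ?ly //.
have [z [zW z0 Ey]] := load1_pad sy cy' ly.
have lt1 j : m.-1 <= j -> ~~ pred1 0 j by move=> /= ?; lia.
have lt2 j : m.-1 <= j -> ~~ (j < 2) by move=> /= ?; lia.
rewrite Ey !mark_pad //; have /wordsP[sz _] := zW.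
case: eqP => [/pad_inj E|_].
  rewrite E ?load_alt //.
  rewrite disjointw_cat ?size_pad ?size_mark // subw_cat // !subw_refl padE ?load_alt //.
  by rewrite disjointw_fill_mark // => j _ /=; lia.
rewrite disjointw_cat ?size_pad ?size_mark // subw_cat ?size_mark // !subw_refl padE //.
rewrite disjointw_fill_mark; last by move=> j _ /=; lia.
by rewrite subw_mark // => j /= /eqP ->.
Qed.

(** * Connectivity of the cycle factor under the shared labels *)

Section Connected.
Variable Q : bitseq -> bool.
Hypotheses (Qg : {in V, forall x, Q (gstep x) = Q x})
  (QT : {in V &, forall x y, tail_label x = tail_label y -> Q x = Q y})
  (QH : {in V &, forall x y, head_label x = head_label y -> Q x = Q y}).

Let q0 := Q (z1 ++ [:: false; true]).

Let mixedV z b : z \in words N a -> z ++ [:: b; ~~ b] \in V.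
Proof. by move=> /wordsP[sz cz]; apply: V2 => //; case: b; rewrite cz addn1. Qed.

Let padV z : z \in words N a -> load 0 z = 0 -> pad z ++ [:: false; false] \in V.
Proof.
move=> zW z0; have /wordsP[sz cz] := zW; apply: V2; rewrite ?size_pad //.
by rewrite padE // count_fill ?cz ?addn0 // unm //; lia.
Qed.

Let Q01 z : z \in words N a -> Q (z ++ [:: false; true]) = Q (next c z ++ [:: true; false]).
Proof. by move=> zW; have /wordsP[sz _] := zW; rewrite -gstep01 // Qg //; apply: (@mixedV z false). Qed.

Let Q10 z : z \in words N a -> Q (z ++ [:: true; false]) = Q (next c z ++ [:: false; true]).
Proof. by move=> zW; have /wordsP[sz _] := zW; rewrite -gstep10 // Qg //; apply: (@mixedV z true). Qed.

Let Qpad z : z \in words N a -> load 0 z = 0 ->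
  Q (pad z ++ [:: false; false]) = Q (z ++ [:: false; true]).
Proof.
move=> zW z0; have /wordsP[sz cz] := zW.
case: (eqVneq z z1) => [->|nz].
  have /wordsP[sz1 cz1] := z1W.
  apply: QH; [by apply: padV; rewrite ?load_alt| exact: (@mixedV z1 false)|].
  by rewrite head00 ?size_pad // load_pad ?load_alt // !eqxx head01 // eqxx.
apply: QT; [exact: padV|exact: (@mixedV z false)|].
rewrite tail00 ?size_pad // tail01 // (negPf nz) pad_cat00 ?load_pad //.
case: eqP => // E; move: E; rewrite alt_split => /cat2_inj[]; rewrite ?size_pad // => E.
by move: (load_pad zW z0); rewrite E load_alt.
Qed.

(** On mixed words [gstep] alternates the endings 01 and 10, so [c] may lift to two cycles. The word
    [y], which is [z1] with zero [m - 2] filled, connects them: [y] followed by 00 shares the tail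
    label of [z1] followed by 01, and [gstep] sends it to [pad (alt' a m)] followed by 00. *)
Let Qnext_z1 : Q (next c z1 ++ [:: false; true]) = q0.
Proof.
have /wordsP[sz1 cz1] := z1W.
have m0 : alt' a m = false :: alt a m.-1.
  by rewrite /alt' -(ltn_predK m_gt2) /= alternate_shift.
have z20 : load 0 (alt' a m) = 0 by rewrite m0 load_cons load_alt.
rewrite next_z1 -Qpad ?alt'_word //.
set y := fill (pred1 (m - 2)) 0 0 z1.
have sy : size y = N by rewrite size_fill.
have ly : load 0 y = 0.
  rewrite /y load_fill // /z1 load_alt unmatched_alt; lia.
have yV : y ++ [:: false; false] \in V.
  by apply: V2; rewrite // count_fill ?cz1 ?addn0 // unmatched_alt; lia.
have <- : gstep (y ++ [:: false; false]) = pad (alt' a m) ++ [:: false; false].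
  rewrite gstep00 // ly /paren load_cat ly mark_cat ly; congr (_ ++ _).
  rewrite /y mark_fill // (padE (alt'_word a m) z20) m0.
  rewrite mark_alt /= fill_alt -(ltn_predK m_gt2) /= alternate_shift.
  have -> : (0 == m.-1) = false by lia.
  by congr (_ :: _ ++ _); apply: eq_map => j /=; lia.
rewrite Qg //; apply: QT => //; first exact: (@mixedV z1 false).
rewrite tail00 // tail01 // eqxx pad_cat00 ?ly //; case: eqP => // E; move: E.
rewrite alt_split => /cat2_inj[] //; rewrite /y fill_alt /alt alternate_rcons => /eqP.
rewrite eqseq_cat // eqxx; case: (m) m_gt2 => [|[|[|m']]] //.
Qed.

Let Qmixed z b : z \in words N a -> Q (z ++ [:: b; ~~ b]) = q0.
Proof.
(* Only two steps of [gstep] restore the ending 01, so the statement invariant under [next c]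
   concerns two consecutive words. *)
pose Q' z := (Q (z ++ [:: false; true]) == q0) && (Q (next c z ++ [:: false; true]) == q0).
have Q'n : {in c, forall z, Q' (next c z) = Q' z}.
  by move=> y; rewrite cW => yW; rewrite /Q' (Q01 yW) Q10 ?next_word // andbC.
move=> zW; have : Q' z by rewrite (cycle_next_invariant uc Q'n _ (_ : z1 \in c)) ?cW // /Q' Qnext_z1 !eqxx.
by case: b => /andP[/eqP E /eqP E'] //; rewrite Q10.
Qed.

Let run_labels B j : let v := B ++ false :: nseq j true in
  v \in V -> 2 <= j -> load j B = 0 ->
  [/\ load 0 v = j, tail_label v = fill (pred1 (if odd j then 1 else m.-1)) 0 j v
    & head_label v = mark (pred1 (if odd j then 0 else 1)) 0 j v].
Proof.
move=> v vV j2 lB; have /wordsP[sv _] := vV.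
have lv : load 0 v = j.
  have := load_mono B (leq0n j); rewrite lB leqn0 => /eqP B0.
  by rewrite load_cat B0 load_cons load_ones.
have rv : runlen v = j.
  rewrite /runlen rev_cat rev_cons rev_nseq -cats1 -catA find_cat /=.
  by rewrite has_nseq andbF /= size_nseq addn0.
have uv : at_unmatched v.
  rewrite /at_unmatched rv lv size_cat /= size_nseq addnK take_size_cat //.
  by rewrite lB.
have [y [sy Ey]] : exists y, size y = N /\ v = y ++ [:: true; true].
  exists (B ++ false :: nseq (j - 2) true); split.
    by move: sv; rewrite nE !size_cat /= !size_nseq; nat_lia.
  by rewrite /v -{1}(subnK j2) nseqD -catA.
split=> //; first by rewrite Ey tail11 //= -Ey uv rv lv.
by rewrite Ey head11 //= -Ey uv rv lv.
Qed.

Let unm_run B j : B ++ false :: nseq j true \in V -> load j B = 0 ->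
  unmatched j B = m.-1.
Proof.
move=> vV lB.
have lv : load 0 (B ++ false :: nseq j true) = j.
  have := load_mono B (leq0n j); rewrite lB leqn0 => /eqP B0.
  by rewrite load_cat B0 load_cons load_ones.
have := unmV vV; rewrite lv unmatched_cat lB /= unmatched_ones; nat_lia.
Qed.

(* A word ending in a run of ones after an unmatched zero shares a label with a
   word whose final run is shorter, or with a word [pad z ++ 00]. *)
Let run_good B j : let v := B ++ false :: nseq j true in
  v \in V -> 2 <= j -> load j B = 0 ->
  (forall x i, x \in V -> size B < i < n.-1 -> nth false x i != nth false x i.+1 -> Q x = q0) ->
  Q v = q0.
Proof.
move=> v vV j2 lB IH; have /wordsP[sv cv] := vV.
have [lv tv hv] := run_labels vV j2 lB; have uB := unm_run vV lB.
set X := B ++ [:: false].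
have EX s : B ++ false :: s = X ++ s by rewrite /X -catA.
have lX : load j X = 0 by rewrite /X load_cat lB.
have uX : unmatched j X = m by rewrite /X unmatched_cat lB uB /=; nat_lia.
have sX : size X = (size B).+1 by rewrite size_cat addn1.
have cX : count id X = count id B by rewrite count_cat addn0.
have cvX : count id B + j = a.+1 by rewrite -cv /v EX count_cat cX count_nseq mul1n.
have svX : (size B).+1 + j = n by rewrite -sv /v size_cat /= size_nseq; nat_lia.
case: (eqVneq j 2) => [Ej|jn2].
  pose z := fill (pred1 0) 0 2 X.
  subst j.
  have zW : z \in words N a.
    apply/wordsP; rewrite size_fill sX; split; first by rewrite /N; move: svX nE; nat_lia.
    by rewrite count_fill ?uX ?cX; nat_lia.
  have z0 : load 0 z = 0.
    apply/eqP; rewrite -leqn0 (leq_trans (load_mono z (leq0n 2))) //.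
    by rewrite load_fill // lX uX; nat_lia.
  rewrite (QH vV (padV zW z0)) ?Qpad //; first exact: (@Qmixed z false).
  have /wordsP[sz _] := zW.
  rewrite hv /v EX mark_cat head00 ?size_pad // load_pad // eqxx.
  case: eqP => [/pad_inj Ez|_].
    (* The filled one of [z] is met at load 0 when two brackets are open at the start, whereas every
       one of an [alt] word is met at load 2. *)
    have [|F [G [E lF]]] := @fill_first 2 X; first by rewrite uX; nat_lia.
    rewrite -/z (Ez zW z1W) ?load_alt // in E.
    by have := load2_alt E; rewrite lF.
  rewrite mark_ones; congr (_ ++ _).
  rewrite mark_pad //; last by move=> i /= ?; nat_lia.
  by rewrite -(@mark_shift 2 0 0) // subn0 add0n mark_fill.
(* Zero [t] becomes a one and the final run loses one. For odd [j] the two words differ only in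
   which of zero 1 and the zero before the run is filled, hence the common tail label. For even [j]
   the new one at zero 0 is closed by zero 1, and the heads agree. *)
pose t := if odd j then 1 else 0; pose X' := fill (pred1 t) 0 j X.
have tm : t.+1 < m by rewrite /t; case: (odd j); nat_lia.
have lX' : load j.-1 X' = 0.
  apply/eqP; rewrite -leqn0 (leq_trans (load_mono X' (leq_pred j))) //.
  by rewrite load_fill // lX uX; nat_lia.
set v' := X' ++ false :: nseq j.-1 true.
have vV' : v' \in V.
  apply/wordsP; rewrite size_cat /= size_fill size_nseq sX; split; first by nat_lia.
  by rewrite count_cat count_fill ?uX ?cX /= ?count_nseq; nat_lia.
have j1 : 2 <= j.-1 by nat_lia.
have [lv' tv' hv'] := run_labels vV' j1 lX'.
have uX' := unm_run vV' lX'.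
have Qv' : Q v' = q0.
  apply: (IH v' (size B).+1) => //; first by nat_lia.
  by rewrite !nth_cat size_fill sX ltnn subnn ltnNge leqnSn subSnn /= nth_nseq (ltnW j1).
have odd' : odd j.-1 = ~~ odd j by rewrite -[in RHS](ltn_predK j2) /= negbK.
rewrite -Qv'; case: (boolP (odd j)) => oj.
  apply: QT => //; rewrite tv tv' odd' oj /v /v' EX (fill_cat _ _ _ X) (fill_cat _ _ _ X').
  rewrite fill_ones add0n lX' uX' [fill _ _ 0 (_ :: _)]/= eqxx fill_ones.
  rewrite [in RHS](@fill_ext _ pred0) ?fill0; last by move=> i /=; nat_lia.
  have -> : nseq j true = true :: nseq j.-1 true by rewrite -{1}(ltn_predK j2).
  by rewrite /X' /t oj.
apply: QH => //; rewrite hv hv' odd' (negPf oj) /v /v' EX (mark_cat _ _ _ X) (mark_cat _ _ _ X').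
rewrite mark_ones lX' uX' [mark _ _ 0 (_ :: _)]/= mark_ones.
rewrite [_ == _](_ : _ = false); last by nat_lia.
have -> : nseq j false = false :: nseq j.-1 false by rewrite -{1}(ltn_predK j2).
congr (_ ++ _).
have -> : mark (pred1 0) 0 j.-1 X' = mark pred0 0 j X'.
  rewrite -{2}(ltn_predK j2) -[in RHS]addn1 (@mark_shift 1 0 j.-1) //.
  by apply: mark_ext => -[].
by rewrite /X' /t (negPf oj) mark_fill.
Qed.

(** A word not linked to the mixed words has an orbit on which [gstep] is [paren] and, by induction,
    letters are constant after [i]. An unmatched zero at [i] followed by ones is excluded by
    [run_good]. So by [xor_paren] the letters at [i] and [i.+1] stay different and [i] is never an
    unmatched zero, against [paren_visits]. *)
Let tail_good j : forall x i, x \in V -> N - j <= i < n.-1 ->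
  nth false x i != nth false x i.+1 -> Q x = q0.
Proof.
elim: j => [|j IH] x i xV.
  have [y [c1 [c2 [sy Ex cy]]]] := split2 xV.
  rewrite subn0 nE ltnS -eqn_leq => /eqP <-.
  rewrite Ex !nth_cat sy ltnn subnn ltnNge leqnSn subSnn /= => ne.
  have -> : c2 = ~~ c1 by case: c1 c2 ne {Ex cy} => [] [].
  apply: Qmixed; apply/wordsP; split=> //; case: c1 c2 ne cy {Ex} => [] [] //= _; nat_lia.
case: (leqP (N - j) i) => [ji|ij] /andP[ji' iN] ne.
  by apply: (IH x i); rewrite ?ji.
apply/eqP; apply: contraTT isT => /eqP nx; exfalso.
have itV t : iter t gstep x \in V by elim: t => //= t; apply: gstepV.
have itQ t : Q (iter t gstep x) <> q0 by elim: t => //= t; rewrite Qg.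
have itE t : iter t gstep x = iter t paren x.
  elim: t => //= t <-; have [[y [b [E yW]]]|[w [_ [_ -> _ [[-> _] //|[z [zW z0 E _]]]]]]] := gstep_nonmixed (itV t).
    by case: (itQ t); rewrite E Qmixed.
  by case: (itQ t); rewrite E Qpad // (@Qmixed z false).
have itC t k : i < k < n -> nth false (iter t gstep x) k = nth false (iter t gstep x) i.+1.
  move=> /andP[]; elim: k => // k IHk; rewrite ltnS leq_eqVlt => /orP[/eqP-> //|ik] kn.
  rewrite -IHk // ?(ltnW kn) //; apply/esym/eqP; apply: contraTT isT => ne'; exfalso.
  by apply: (itQ t); apply: (IH _ k) => //; apply/andP; split; nat_lia.
have notU t : Uat (iter t gstep x) i -> ~~ nth false (iter t gstep x) i.+1.
  move=> /andP[ni li]; apply/negP=> ni1; apply: (itQ t).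
  have vV := itV t; set v := iter t gstep x in vV ni li ni1 *.
  have /wordsP[sv _] := vV.
  have Ev : v = take i v ++ false :: nseq (n - i.+1) true.
    rewrite -{1}(cat_take_drop i v) (drop_nth false) ?sv; last by nat_lia.
    rewrite (negPf ni); congr (_ ++ _ :: _); apply: (@eq_from_nth _ false).
      by rewrite size_drop size_nseq sv.
    move=> k; rewrite size_drop sv => kn; rewrite nth_drop nth_nseq kn itC //.
    by nat_lia.
  have si : size (take i v) = i by rewrite size_takel // sv; nat_lia.
  have B0 : load 0 (take i v) = 0.
    have := load_mono (take i v) (leq0n (load 0 v)).
    by rewrite -/(loadat v i) (eqP li) leqn0 => /eqP.
  have lv : load 0 v = n - i.+1 by rewrite Ev load_cat B0 load_cons load_ones.
  rewrite Ev; apply: run_good; rewrite -?Ev //; first by move: nE; nat_lia.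
    by rewrite -lv; apply/eqP.
  move=> w k wV; rewrite si => ikn; apply: IH => //; nat_lia.
have alternate t : (nth false (iter t gstep x) i (+) nth false (iter t gstep x) i.+1)
    && ~~ Uat (iter t gstep x) i.
  have U s : nth false (iter s gstep x) i (+) nth false (iter s gstep x) i.+1 -> ~~ Uat (iter s gstep x) i.
    move=> xs; apply/negP=> Us; move: (notU s Us) (Us) xs; rewrite /Uat => /negPf-> /andP[/negPf->].
    by [].
  elim: t => [|t /andP[IH1 IH2]]; first by rewrite U /= -?negb_eqb ?ne.
  suff xs : nth false (iter t.+1 gstep x) i (+) nth false (iter t.+1 gstep x) i.+1.
    by rewrite xs (U _ xs).
  have := @xor_paren (iter t gstep x) i; have /wordsP[-> _] := itV t.
  rewrite IH1 (negPf IH2) itE -iterS -itE addn0 => H.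
  by case: (_ (+) _) H => //= H; move: H; nat_lia.
have [||t] := @paren_visits n a.+1 x i _ xV; [by rewrite /n; nat_lia|by nat_lia|].
by rewrite -itE; have /andP[_ /negPf->] := alternate t.
Qed.

Lemma gstep_connected : {in V &, forall x y, Q x = Q y}.
Proof.
suff H x : x \in V -> Q x = q0 by move=> x y /H-> /H->.
move=> xV; have /wordsP[sx cx] := xV.
have [/existsP[i Hi]|] := boolP [exists i : 'I_n.-1, nth false x i != nth false x i.+1].
  by apply: (@tail_good N x i) => //; rewrite subnn /=.
rewrite negb_exists => /forallP H.
have E k : k < n -> nth false x k = nth false x 0.
  elim: k => // k IH kn; have kn' : k < n.-1 by nat_lia.
  by have := H (Ordinal kn'); rewrite negbK /= => /eqP <-; apply: IH; nat_lia.
have Ex : x = nseq n (nth false x 0).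
  apply: (@eq_from_nth _ false); rewrite ?size_nseq // => k; rewrite sx => kn.
  by rewrite nth_nseq kn E.
by move: cx; rewrite Ex count_nseq; case: (nth _ _ _); rewrite ?mul0n // mul1n /n; nat_lia.
Qed.

End Connected.

Lemma padded_cycle_step : exists c', padded_cycle m a.+1 c'.
Proof.
have [||||| c' [uc' cV' Sc']] := @merge_cycles _ _ V gstep tail_label head_label disjointw.
- exact: gstep_inj.
- exact: words_uniq.
- exact: gstepV.
- by move=> x /label_props[].
- by move=> Q; apply: gstep_connected.
have S x y : x \in V -> y \in V -> has (fun x' => (y == gstep x') && disjointw (tail_label x) (head_label x')) V ->
    disjointw (tail_label x) y.
  move=> xV yV /hasP[x' xV' /andP[/eqP -> d]].
  have [_ _ sH] := label_props xV'; rewrite disjointwC.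
  by apply: disjointw_sub sH _; rewrite ?size_gstep ?size_head_label // disjointwC.
exists c'; split=> //.
- apply: (sub_in_cycle (P := mem V)) Sc'; last by apply/allP=> x; rewrite cV'.
  move=> x y xV yV /S - /(_ xV yV) d; have [_ sT _] := label_props xV.
  apply: disjointw_sub sT d; rewrite size_pad size_tail_label //.
  by have /wordsP[] := xV.
have aV : alt a.+1 m \in V by exact: alt_word.
have nV : next c' (alt a.+1 m) \in V by rewrite -cV' mem_next cV'.
have := next_cycle Sc' (_ : alt a.+1 m \in c'); rewrite cV' => /(_ aV) /(S _ _ aV nV).
(* The tail label is the complement of [alt'], so [alt'] itself is the only word of the right weight
   disjoint from it: no exchange can destroy the prescribed arc. *)
rewrite tail_label_alt => d; have /wordsP[sy cy] := nV.
have /wordsP[sa ca] := alt'_word a.+1 m.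
rewrite (disjointw_eq _ _ d) ?size_map ?sa ?sy //; first by rewrite (mapK negbK).
have := count_predC id (alt' a.+1 m).
by rewrite count_map cy sa ca addnC.
Qed.

End KneserStep.

Lemma padded_cycle_exists m k : 2 < m -> exists c, padded_cycle m k c.
Proof.
move=> m2; elim: k => [|k [c Hc]]; last exact: padded_cycle_step Hc.
(* For weight 0 the empty set is the only vertex and its own successor; [alt 0 m] and [alt' 0 m]
   coincide. *)
exists [:: nseq m false]; split=> //.
- move=> x; rewrite inE mem_words; apply/eqP/andP => [->|[/eqP sx /eqP cx]].
    by rewrite size_nseq count_nseq mul0n.
  apply: (@eq_from_nth _ false); rewrite ?size_nseq // => i; rewrite sx => im.
  rewrite nth_nseq im; apply/negbTE/negP=> xi.
  by move/eqP: cx; rewrite -leqn0 leqNgt -has_count => /negP[]; apply/hasP; exists (nth false x i); rewrite // mem_nth // sx.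
- rewrite /= andbT /pad.
  have -> : load 0 (nseq m false) = 0 by elim: (m).
  have Eu : unmatched 0 (nseq m false) = m by elim: (m) => //= m' ->.
  rewrite eqxx Eu fill_nseq0.
  by elim: m 0 {m2 Eu} (m.-1) => //= m IH i j; rewrite disjointw_cons IH andbF.
by rewrite /alt /= eqxx.
Qed.

(** * Odd graphs *)

Inductive tree := E | N of tree & tree.

Fixpoint tree_eqb (s t : tree) : bool :=
  match s, t with
  | E, E => true
  | N a b, N c d => tree_eqb a c && tree_eqb b d
  | _, _ => false
  end.

Lemma tree_eqbP : Equality.axiom tree_eqb.
Proof.
elim=> [|a IHa b IHb] [|c d] /=; try by constructor.
by apply: (iffP andP) => [[/IHa-> /IHb->]|[<- <-]] //; split; [apply/IHa|apply/IHb].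
Qed.

HB.instance Definition _ := hasDecEq.Build tree tree_eqbP.

Fixpoint weight (t : tree) : nat := if t is N u v then (weight u + weight v).+1 else 0.

Fixpoint dyck (t : tree) : bitseq :=
  if t is N u v then true :: dyck u ++ false :: dyck v else [::].

Notation "~w x" := (map negb x) (at level 30).

(** The lifted path of [u], traversed backwards, runs from 1u1v, one flip from 1u0v, to 1(~u)1v; a
    flip of the first letter gives 0(~u)1v, where the lifted path of [v] begins. *)
Definition upper (v : tree) (m : bitseq) : bitseq := true :: ~w m ++ true :: dyck v.
Definition lower (u : tree) (m : bitseq) : bitseq := false :: ~w (dyck u) ++ true :: m.

(* A path in the middle levels [k] and [k+1] of the cube of dimension [2k], with
   [k = weight t], from [dyck t] to its complement. Adding the edge between its
   ends gives a cycle of the odd graph K(2k+1,k). *)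
Fixpoint tpath (t : tree) : seq bitseq :=
  if t is N u v then
    dyck t :: rev (map (upper v) (tpath u)) ++ map (lower u) (tpath v)
  else [:: [::]].

Lemma size_dyck t : size (dyck t) = (weight t).*2.
Proof. by elim: t => //= u IHu v IHv; rewrite size_cat /= IHu IHv; lia. Qed.

Lemma count_dyck t : count id (dyck t) = weight t.
Proof. by elim: t => //= u IHu v IHv; rewrite count_cat /= IHu IHv; lia. Qed.

Lemma count_negb x : count id (~w x) + count id x = size x.
Proof. by elim: x => //= -[] x /=; lia. Qed.

Lemma negb_wK : involutive (map negb).
Proof. by move=> x; rewrite mapK //; exact: negbK. Qed.

Lemma upper_inj v : injective (upper v).
Proof.
move=> x y [E]; have sE : size (~w x) = size (~w y).
  by move: (congr1 size E); rewrite !size_cat; move/addIn.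
by move/eqP: E; rewrite eqseq_cat // => /andP[/eqP/(can_inj negb_wK)].
Qed.

Lemma lower_inj u : injective (lower u).
Proof. by move=> x y [] /eqP; rewrite eqseq_cat // => /andP[_ /eqP[]]. Qed.

Definition middle (k : nat) (x : bitseq) := (size x == k.*2) && (k <= count id x <= k.+1).

Lemma middle_upper k v m : middle k m -> middle (k + weight v).+1 (upper v m).
Proof.
move=> /andP[/eqP sm cm]; rewrite /middle /upper /= size_cat count_cat /= size_map.
by rewrite size_dyck count_dyck; have := count_negb m; lia.
Qed.

Lemma middle_lower k u m : middle k m -> middle (weight u + k).+1 (lower u m).
Proof.
move=> /andP[/eqP sm cm]; rewrite /middle /lower /= size_cat count_cat /= size_map.
by have := count_negb (dyck u); rewrite size_dyck count_dyck; lia.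
Qed.

Lemma tpath_middle t : all (middle (weight t)) (tpath t).
Proof.
elim: t => //= u IHu v IHv; rewrite all_cat all_rev !all_map.
apply/and3P; split.
- have := size_dyck (N u v); have := count_dyck (N u v); rewrite /middle /= => -> ->.
  by rewrite eqxx leqnn leqnSn.
- by apply/allP=> m mu /=; apply/middle_upper/(allP IHu).
by apply/allP=> m mv /=; apply/middle_lower/(allP IHv).
Qed.

Lemma dyck_prefix_inj u u' m m' :
  dyck u ++ false :: m = dyck u' ++ false :: m' -> u = u' /\ m = m'.
Proof.
elim: u u' m m' => [|u IHu v IHv] [|u' v'] m m' //=; first by case.
by case; rewrite -!catA /= => /IHu[-> /IHv[-> ->]].
Qed.

Lemma dyck_inj : injective dyck.
Proof. by move=> u v E; case: (@dyck_prefix_inj u v [::] [::]); rewrite ?E. Qed.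

Lemma cat_eq_cat (T : Type) (s1 s2 t1 t2 : seq T) : s1 ++ t1 = s2 ++ t2 ->
  size s1 <= size s2 -> exists d, s2 = s1 ++ d /\ t1 = d ++ t2.
Proof.
elim: s1 s2 => [|a s1 IH] s2 //=; first by exists s2.
by case: s2 => [|b s2] //= [-> /IH H] /H[d [-> ->]]; exists d.
Qed.

Lemma dyck_prefix t r s : dyck t = r ++ s -> size r <= (count id r).*2.
Proof.
elim: t r s => [|u IHu v IHv] [|b r] s //= [<- E].
have [sr|sr] := leqP (size r) (size (dyck u)).
  by have [s' [/IHu Es _]] := cat_eq_cat (esym E) sr; lia.
have [[|c r'] [Er Es]] := cat_eq_cat E (ltnW sr).
  by move: sr; rewrite Er cats0 ltnn.
case: Es => Ec /IHv Ev.
rewrite Er -Ec size_cat count_cat /= size_dyck count_dyck; lia.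
Qed.

(** The one in front of the suffix is the last that is never closed: if it lay inside another Dyck
    suffix, it would be preceded there by a prefix with more zeros than ones. *)
Lemma dyck_suffix_inj v v' m m' :
  m ++ true :: dyck v = m' ++ true :: dyck v' -> v = v' /\ m = m'.
Proof.
wlog: v v' m m' / size m <= size m'.
  move=> H E; have [mm|mm] := leqP (size m) (size m'); first exact: H.
  by have [-> ->] := H v' v m' m (ltnW mm) (esym E).
move=> mm E.
have [[|b r] [-> Es]] := cat_eq_cat E mm.
  by case: Es => /dyck_inj ->; rewrite cats0.
case: Es => _ Es; have := dyck_prefix Es.
have := congr1 (count id) Es; have := congr1 size Es.
rewrite size_cat count_cat /= !size_dyck !count_dyck; lia.
Qed.

(** Balance forces [m] onto the upper of its two levels, and then the prefix made of a one and the
    complement of [m] has more zeros than ones. *)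
Lemma dyck_neq_upper u v v' m : middle (weight u) m -> dyck v = upper v' m -> False.
Proof.
move=> /andP[/eqP sm cm] E.
have /dyck_prefix : dyck v = (true :: ~w m) ++ true :: dyck v' by [].
have := congr1 (count id) E; have := congr1 size E.
rewrite /= size_cat count_cat /= size_map !size_dyck !count_dyck; have := count_negb m.
by lia.
Qed.

(** The first letter separates the two lifts. Under [lower], [u] is the first return of the
    complement; under [upper], [v] is the Dyck suffix behind the last unclosed one. The remaining
    factor follows by induction. *)
Lemma tpath_inj t t' x : x \in tpath t -> x \in tpath t' -> t = t'.
Proof.
have M t0 m : m \in tpath t0 -> middle (weight t0) m by apply/allP/tpath_middle.
elim: t t' x => [|u IHu v IHv] t' x.
  by rewrite inE => /eqP-> xt; have := M _ _ xt; case: t' {xt}.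
case: t' => [|u' v'].
  by move=> xt; rewrite inE => /eqP xE; have := M _ _ xt; rewrite xE.
rewrite !inE !mem_cat !mem_rev => /or3P[/eqP->|/mapP[m mu ->]|/mapP[m mv ->]]
  /or3P[/eqP E'|/mapP[m' mu' E']|/mapP[m' mv' E']] //.
- exact: (@dyck_inj (N u v)).
- by case: (dyck_neq_upper (v := N u v) (M _ _ mu') E').
- by case: (dyck_neq_upper (v := N u' v') (M _ _ mu) (esym E')).
- case: E' => /dyck_suffix_inj[-> /(can_inj negb_wK) Em].
  by rewrite (IHu u' m mu) // Em.
case: E' => E'; have : dyck u ++ false :: ~w m = dyck u' ++ false :: ~w m'.
  by move: (congr1 (map negb) E'); rewrite !map_cat /= !negb_wK.
move=> /dyck_prefix_inj[-> /(can_inj negb_wK) Em].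
by rewrite (IHv v' m mv) // Em.
Qed.

Lemma tpath_uniq t : uniq (tpath t).
Proof.
elim: t => //= u IHu v IHv.
rewrite cat_uniq rev_uniq !map_inj_uniq ?IHu ?IHv; [|exact: lower_inj|exact: upper_inj].
rewrite mem_cat mem_rev negb_or !andbT /=; apply/andP; split; last first.
  by apply/hasPn=> _ /mapP[m _ ->]; rewrite mem_rev; apply/mapP => -[].
apply/andP; split; last by apply/mapP => -[].
apply/mapP=> -[m mu Em]; apply: (@dyck_neq_upper u (N u v) v m) => //.
exact: (allP (tpath_middle u)).
Qed.

Lemma dyck_prefix_ex y : (count id y).*2 < size y -> exists u m, y = dyck u ++ false :: m.
Proof.
elim: {y}(size y) {-2}y (leqnn (size y)) => [|n IH] [|b y] //= sy cy.
case: b cy => /= cy; last by exists E, y.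
have [||u [m Ey]] := IH y; [by []|by lia|].
have : (count id m).*2 < size m.
  by move: cy; rewrite Ey size_cat count_cat /= size_dyck count_dyck; lia.
have sm : size m <= n by move: sy; rewrite Ey size_cat /=; lia.
by move=> /(IH m sm)[v [m' Em]]; exists (N u v), m'; rewrite Ey Em /= -catA.
Qed.

Lemma dyck_suffix_ex n y : size y <= n -> size y <= (count id y).*2 ->
  (exists2 t, y = dyck t & size y = (count id y).*2) \/ exists v m, y = m ++ true :: dyck v.
Proof.
elim: n y => [|n IH] [|b y] //=; try by left; exists E.
move=> sy cy; case: b cy => /= cy.
  have [c1|c1] := ltnP (count id y).*2 (size y); last first.
    have [[t Et ct]|[v [m Em]]] := IH y sy c1; right.
      by exists t, [::]; rewrite Et.
    by exists v, (true :: m); rewrite Em.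
  have [u [m Ey]] := dyck_prefix_ex c1.
  have sm : size m <= n by move: sy; rewrite Ey size_cat /=; lia.
  have cm : size m = (count id m).*2.
    by move: cy c1; rewrite Ey size_cat count_cat /= size_dyck count_dyck; lia.
  have [|[t Et ct]|[v [m' Em]]] := IH m sm; first by rewrite cm.
    left; exists (N u t); rewrite /= ?Ey -?Et // size_cat count_cat /= size_dyck count_dyck.
    by rewrite cm; lia.
  by right; exists v, (true :: dyck u ++ false :: m'); rewrite Ey Em /= -catA.
have [|[t Et ct]|[v [m Em]]] := IH y sy; try lia.
by right; exists v, (false :: m); rewrite Em.
Qed.

(** The factorizations behind [tpath_inj] always exist. A word starting with 0 has a complement
    whose tail has fewer ones than zeros, hence a first return; one starting with 1 is a Dyck word
    or has an unclosed one. *)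
Lemma tpath_ex k x : middle k x -> exists2 t, weight t = k & x \in tpath t.
Proof.
elim/ltn_ind: k x => k IH [|b x] /andP[/eqP sx cx].
  by exists E => //=; move: sx => /=; lia.
case: b sx cx => /= sx cx; last first.
  have [|u [m Em]] := @dyck_prefix_ex (~w x).
    by have := count_negb x; rewrite size_map; lia.
  have Ex : x = ~w (dyck u) ++ true :: ~w m.
    by move: (congr1 (map negb) Em); rewrite negb_wK map_cat.
  have := count_negb (dyck u); rewrite size_dyck count_dyck => cu.
  move: sx cx; rewrite Ex size_cat count_cat /= !size_map size_dyck => sx cx.
  have [||v wv mv] := IH (k - (weight u).+1) _ (~w m); first by lia.
    by rewrite /middle size_map; lia.
  exists (N u v); first by rewrite /= wv; lia.
  by rewrite inE mem_cat; apply/or3P/Or33/mapP; exists (~w m).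
have [|[t Et ct]|[v [m Em]]] := @dyck_suffix_ex _ (true :: x) (leqnn _).
- by rewrite /=; lia.
- exists t; last by rewrite Et; case: (t) => [|u v]; rewrite /= inE eqxx.
  by have := size_dyck t; rewrite -Et /=; lia.
case: m Em => [|b m] [].
  by move=> Ex; move: sx; rewrite Ex /= size_dyck; lia.
move=> _ Ex; have := count_negb m => cm.
move: sx cx; rewrite Ex size_cat count_cat /= size_dyck count_dyck => sx cx.
have [||u wu mu] := IH (k - (weight v).+1) _ (~w m); first by lia.
  by rewrite /middle size_map; lia.
exists (N u v); first by rewrite /= wu; lia.
rewrite inE mem_cat mem_rev; apply/or3P/Or32/mapP; exists (~w m) => //.
by rewrite /upper negb_wK.
Qed.

(** * Addresses of the edges of tree paths *)

Fixpoint flip1 (x y : bitseq) : bool :=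
  match x, y with
  | a :: x', b :: y' => if a == b then flip1 x' y' else x' == y'
  | _, _ => false
  end.

Lemma flip1C x y : flip1 x y = flip1 y x.
Proof. by elim: x y => [|a x IH] [|b y] //=; rewrite eq_sym IH [x == y]eq_sym. Qed.

Lemma flip1_cat2l s x y : flip1 (s ++ x) (s ++ y) = flip1 x y.
Proof. by elim: s => //= a s IH; rewrite eqxx. Qed.

Lemma flip1_cat2r s x y : size x = size y -> flip1 (x ++ s) (y ++ s) = flip1 x y.
Proof.
elim: x y => [|a x IH] [|b y] //= => [_|[E]]; last by rewrite IH // eqseq_cat // eqxx andbT.
by elim: s => //= a s ->; rewrite eqxx.
Qed.

Lemma flip1_negb x y : flip1 (~w x) (~w y) = flip1 x y.
Proof.
elim: x y => [|a x IH] [|b y] //=; rewrite IH (inj_eq (can_inj negb_wK)).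
by case: a; case: b.
Qed.

Lemma flip1_size x y : flip1 x y -> size x = size y.
Proof.
elim: x y => [|a x IH] [|b y] //=; case: eqP => _; first by move/IH->.
by move/eqP->.
Qed.

Lemma flip1_upper v x y : flip1 x y -> flip1 (upper v x) (upper v y).
Proof.
by move=> xy; rewrite /upper /= flip1_cat2r ?flip1_negb // !size_map (flip1_size xy).
Qed.

Lemma flip1_lower u x y : flip1 x y -> flip1 (lower u x) (lower u y).
Proof. by move=> xy; rewrite /lower /= flip1_cat2l. Qed.

(* Edges of [tpath (N u v)]: the first one, the one joining its two parts,
   and those inherited from [tpath u] and [tpath v]. *)
Inductive edge := Start | Middle | Up of edge | Low of edge.

Fixpoint edge_eqb (e f : edge) : bool :=
  match e, f with
  | Start, Start | Middle, Middle => true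
  | Up a, Up b | Low a, Low b => edge_eqb a b
  | _, _ => false
  end.

Lemma edge_eqbP : Equality.axiom edge_eqb.
Proof.
by elim=> [||a IH|a IH] [||b|b] /=; (try by constructor); apply: (iffP (IH b)) => [->|[->]].
Qed.

HB.instance Definition _ := hasDecEq.Build edge edge_eqbP.

Fixpoint edge_of (t : tree) (e : edge) : bool :=
  match t, e with
  | N u v, Up e' => edge_of u e'
  | N u v, Low e' => edge_of v e'
  | N u v, _ => true
  | E, _ => false
  end.

Fixpoint ends (t : tree) (e : edge) : bitseq * bitseq :=
  match t, e with
  | N u v, Start => (dyck t, upper v (~w (dyck u)))
  | N u v, Middle => (upper v (dyck u), lower u (dyck v))
  | N u v, Up e' => (upper v (ends u e').1, upper v (ends u e').2)
  | N u v, Low e' => (lower u (ends v e').1, lower u (ends v e').2)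
  | E, _ => ([::], [::])
  end.

Definition consec (T : Type) (s : seq T) (x y : T) := exists s1 s2, s = s1 ++ x :: y :: s2.

Lemma consec_catl (T : Type) (s s' : seq T) x y : consec s x y -> consec (s' ++ s) x y.
Proof. by move=> [s1 [s2 ->]]; exists (s' ++ s1), s2; rewrite catA. Qed.

Lemma consec_catr (T : Type) (s s' : seq T) x y : consec s x y -> consec (s ++ s') x y.
Proof. by move=> [s1 [s2 ->]]; exists s1, (s2 ++ s'); rewrite -catA. Qed.

Lemma consec_rev (T : Type) (s : seq T) x y : consec s x y -> consec (rev s) y x.
Proof.
move=> [s1 [s2 ->]]; exists (rev s2), (rev s1).
by rewrite rev_cat !rev_cons -!cats1 -!catA.
Qed.

Lemma consec_map (T T' : Type) (f : T -> T') s x y : consec s x y -> consec (map f s) (f x) (f y).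
Proof. by move=> [s1 [s2 ->]]; exists (map f s1), (map f s2); rewrite map_cat. Qed.

Lemma tpath_head t : exists s, tpath t = dyck t :: s.
Proof. by case: t => [|u v]; eexists. Qed.

Lemma tpath_last t : exists s, tpath t = rcons s (~w (dyck t)).
Proof.
elim: t => [|u _ v [s Es]]; first by exists [::].
exists (dyck (N u v) :: rev (map (upper v) (tpath u)) ++ map (lower u) s).
by rewrite /= Es map_rcons -rcons_cat map_cat.
Qed.

Lemma ends_consec t e : edge_of t e -> let: (p, q) := ends t e in
  consec (tpath t) p q \/ consec (tpath t) q p.
Proof.
elim: t e => // u IHu v IHv [||e|e] /= et.
- have [s Es] := tpath_last u; left; rewrite Es map_rcons rev_rcons /=.
  by exists [::]; eexists.
- have [s Es] := tpath_head u; have [s' Es'] := tpath_head v; left.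
  rewrite Es Es' /= rev_cons -cats1 -catA /=.
  by exists (dyck (N u v) :: rev (map (upper v) s)), (map (lower u) s').
- case: (ends u e) (IHu e et) => p q /= [] H; [right|left];
  by rewrite -cat1s; apply/consec_catl/consec_catr/consec_rev/consec_map.
case: (ends v e) (IHv e et) => p q /= [] H; [left|right];
by rewrite -cat1s catA; apply/consec_catl/consec_map.
Qed.

Lemma tpath_sorted t : sorted flip1 (tpath t).
Proof.
elim: t => //= u IHu v IHv.
have [s Es] := tpath_last u; have [s' Es'] := tpath_head u; have [r Er] := tpath_head v.
have sA : sorted flip1 (rev (map (upper v) (tpath u))).
  rewrite rev_sorted (eq_sorted (e' := flip1)); last by move=> x y; rewrite /= flip1C.
  by apply: homo_sorted IHu => x y; apply: flip1_upper.
have sB : sorted flip1 (map (lower u) (tpath v)).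
  by apply: homo_sorted IHv => x y; apply: flip1_lower.
set A := rev _ in sA *.
have [a Ea] : exists a, A = upper v (~w (dyck u)) :: a.
  by rewrite /A Es map_rcons rev_rcons; eexists.
have [b Eb] : exists b, A = rcons b (upper v (dyck u)).
  by rewrite /A Es' /= rev_cons; eexists.
rewrite cat_path [last _ A](_ : _ = upper v (dyck u)); last by rewrite Eb last_rcons.
move: sA sB; rewrite Ea Er /= => -> ->; rewrite !andbT.
by rewrite /upper /lower !negb_wK /= !flip1_cat2l /= !eqxx.
Qed.

Lemma ends_size t e : edge_of t e ->
  size (ends t e).1 = (weight t).*2 /\ size (ends t e).2 = (weight t).*2.
Proof.
move=> /ends_consec; case: (ends t e) => p q H /=.
have M x : x \in tpath t -> size x = (weight t).*2.
  by move=> /(allP (tpath_middle t))/andP[/eqP].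
by case: H => -[s1 [s2 Es]]; split; apply: M; rewrite Es mem_cat !inE eqxx ?orbT.
Qed.

Lemma dyck_neq_upper_size u v m : size m = size (dyck u) -> dyck (N u v) <> upper v m.
Proof. by move=> sm [] /eqP; rewrite eqseq_cat ?size_map // => /andP[_ /eqP[]]. Qed.

Definition same_ends (T : Type) (p q : T * T) := p = q \/ p = (q.2, q.1).

Lemma same_endsC (T : Type) (p q : T * T) : same_ends p q -> same_ends q p.
Proof. by case: p q => [a b] [c d] [[-> ->]|[-> ->]]; [left|right]. Qed.

Lemma ends_inj1 t e f : edge_of t e -> edge_of t f -> same_ends (ends t e) (ends t f) -> e = f.
Proof.
elim: t e f => // u IHu v IHv.
have sx g : edge_of u g -> size (ends u g).1 = size (dyck u) /\ size (ends u g).2 = size (dyck u).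
  by rewrite size_dyck; apply: ends_size.
have SM : ~ same_ends (ends (N u v) Start) (ends (N u v) Middle).
  by case=> -[] // /dyck_neq_upper_size; apply.
have SU e : edge_of u e -> ~ same_ends (ends (N u v) Start) (ends (N u v) (Up e)).
  by move=> /sx[s1 s2]; case=> /(congr1 fst) /dyck_neq_upper_size; apply.
have UU e f : same_ends (ends (N u v) (Up e)) (ends (N u v) (Up f)) -> same_ends (ends u e) (ends u f).
  rewrite /=; case: (ends u e) (ends u f) => [a b] [c d] /= H.
  by case: H => H; move: (congr1 fst H) (congr1 snd H) => /= /upper_inj-> /upper_inj->; [left|right].
have LL e f : same_ends (ends (N u v) (Low e)) (ends (N u v) (Low f)) -> same_ends (ends v e) (ends v f).
  rewrite /=; case: (ends v e) (ends v f) => [a b] [c d] /= H.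
  by case: H => H; move: (congr1 fst H) (congr1 snd H) => /= /lower_inj-> /lower_inj->; [left|right].
case=> [||e|e] [||f|f] // he hf H.
- by case: (SU f hf H).
- by case: H => /= H; discriminate H.
- by case: (SM (same_endsC H)).
- by case: H => /= H; discriminate H.
- by case: H => /= H; discriminate H.
- by case: (SU e he (same_endsC H)).
- by case: H => /= H; discriminate H.
- by congr Up; apply: IHu => //; apply: UU.
- by case: H => /= H; discriminate H.
- by case: H => /= H; discriminate H.
- by case: H => /= H; discriminate H.
- by case: H => /= H; discriminate H.
by congr Low; apply: IHv => //; apply: LL.
Qed.

(** Exchanges record edges by address; by this lemma deleting one edge leaves every edge with
    another address in place. *)
Lemma ends_inj t e t' e' : edge_of t e -> edge_of t' e' ->
  same_ends (ends t e) (ends t' e') -> (t, e) = (t', e').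
Proof.
move=> he he' H; suff Et : t = t' by subst t'; rewrite (ends_inj1 he he' H).
have M t0 e0 : edge_of t0 e0 -> (ends t0 e0).1 \in tpath t0 /\ (ends t0 e0).2 \in tpath t0.
  move=> /ends_consec; case: (ends t0 e0) => p q [] [s1 [s2 ->]];
  by rewrite !mem_cat !inE !eqxx ?orbT.
have [m1 m2] := M _ _ he; have [m1' m2'] := M _ _ he'.
by case: H => E; rewrite E in m1; [apply: tpath_inj m1 m1'|apply: tpath_inj m1 m2'].
Qed.

(** Under [odd_vertex] these become edges of the odd graph: a flip joins the two levels, and
    complementation joins two words of the lower level, as at the ends of a tree path. *)
Definition odd_adj (x y : bitseq) := flip1 x y || (y == ~w x).

Lemma odd_adjC x y : odd_adj x y = odd_adj y x.
Proof. by rewrite /odd_adj flip1C; congr (_ || _); apply/eqP/eqP => ->; rewrite negb_wK. Qed.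

Lemma consec_next (T : eqType) (s : seq T) x y : uniq s -> consec s x y -> next s x = y.
Proof.
move=> us [s1 [s2 E]]; rewrite -(next_rot (size s1) us) E rot_size_cat.
by rewrite /= eqxx.
Qed.

Lemma open_cycle (T : eqType) (R : rel T) c p : uniq c -> cycle R c -> p \in c ->
  exists s, [/\ perm_eq (next c p :: s) c, path R (next c p) s, last (next c p) s = p
    & forall x, x \in c -> x != p -> consec (next c p :: s) x (next c x)].
Proof.
move=> uc Rc pc; have [i d E] := rot_to pc.
have [s Es] : exists s, rcons d p = next c p :: s.
  rewrite -(next_rot i uc) E; case: d {E} => [|a d] /=; rewrite eqxx; first by exists [::].
  by exists (rcons d p).
have pe : perm_eq (next c p :: s) c by rewrite -Es -rot1_cons -E !perm_rot.
have ue : uniq (next c p :: s) by rewrite (perm_uniq pe).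
exists s; split=> //.
- move: Rc; rewrite -(rot_cycle i) E /= -[path _ _ _]/(path R p (rcons d p)) Es /=.
  by case/andP.
- by rewrite -[last _ s]/(last p (next c p :: s)) -Es last_rcons.
move=> x xc xp; have : x \in rcons d p by rewrite Es (perm_mem pe).
rewrite mem_rcons inE (negPf xp) /= => /splitPr xd; case: xd Es E => d1 d2 Es E.
have [y [r Er]] : exists y r, rcons d2 p = y :: r by case: (d2) => [|y r]; do 2 eexists.
have C : consec (next c p :: s) x y by exists d1, r; rewrite -Es rcons_cat /= Er.
suff -> : next c x = y by [].
rewrite -(consec_next ue C) -Es -rot1_cons -E next_rot ?rot_uniq //.
by rewrite next_rot.
Qed.

Lemma rev_path_ends (T : eqType) (R : rel T) x s : symmetric R -> path R x s ->
  exists s', [/\ rev (x :: s) = last x s :: s', path R (last x s) s' & last (last x s) s' = x].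
Proof.
move=> sR Rs; exists (rev (belast x s)); split.
- by rewrite lastI rev_rcons.
- by rewrite rev_path; under eq_path do rewrite sR.
have : last x (rev (x :: s)) = last x (last x s :: rev (belast x s)) by rewrite lastI rev_rcons.
by rewrite rev_cons last_rcons.
Qed.

(* [joined None S F]: the cycles of the trees in [S] can be merged into one by
   exchanging the edges in [F] only; [joined (Some (p, q)) S F] is the same
   for a path from [p] to [q]. *)
Inductive joined : option (bitseq * bitseq) -> seq tree -> seq (tree * edge) -> Prop :=
| joined1 t : joined None [:: t] [::]
| joined_open S F t e (b : bool) : joined None S F -> t \in S -> edge_of t e -> (t, e) \notin F ->
    joined (Some (if b then ((ends t e).2, (ends t e).1) else ends t e)) S ((t, e) :: F)
| joined_cat p q p' q' S F S' F' : joined (Some (p, q)) S F -> joined (Some (p', q')) S' F' ->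
    flip1 q p' -> joined (Some (p, q')) (S ++ S') (F ++ F')
| joined_close p q S F : joined (Some (p, q)) S F -> flip1 q p -> joined None S F
| joined_weaken o S F S' F' : joined o S F -> perm_eq S S' -> {subset F <= F'} -> joined o S' F'.

(** * Soundness and lifting of the exchange calculus *)

Lemma flatten_tpath_uniq S : uniq S -> uniq (flatten (map tpath S)).
Proof.
elim: S => //= t S IH /andP[tS /IH uS]; rewrite cat_uniq tpath_uniq uS andbT.
apply/hasPn=> x /flattenP[_ /mapP[t' tS' ->]] xt'; apply/negP=> xt.
by move: tS; rewrite (tpath_inj xt xt') tS'.
Qed.

Lemma perm_flatten_map (T T' : eqType) (f : T -> seq T') S S' : perm_eq S S' ->
  perm_eq (flatten (map f S)) (flatten (map f S')).
Proof. by move=> p; apply/perm_flatten/perm_map. Qed.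

Definition joined_sem (o : option (bitseq * bitseq)) (S : seq tree) (F : seq (tree * edge)) : Prop :=
  match o with
  | None => exists c, [/\ perm_eq c (flatten (map tpath S)), cycle odd_adj c
      & forall t e, t \in S -> edge_of t e -> (t, e) \notin F ->
        next c (ends t e).1 = (ends t e).2 \/ next c (ends t e).2 = (ends t e).1]
  | Some (p, q) => exists s, [/\ perm_eq (p :: s) (flatten (map tpath S)),
      path odd_adj p s, last p s = q
      & forall t e, t \in S -> edge_of t e -> (t, e) \notin F ->
        consec (p :: s) (ends t e).1 (ends t e).2 \/ consec (p :: s) (ends t e).2 (ends t e).1]
  end.

Lemma joined_sem_rev p q S F : joined_sem (Some (p, q)) S F -> joined_sem (Some (q, p)) S F.
Proof.
move=> [s [ps Rs ls Hs]]; have [s' [Es Rs' ls']] := rev_path_ends odd_adjC Rs.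
rewrite ls in Es Rs' ls'; exists s'; split=> //; first by rewrite -Es perm_rev.
by move=> t e tS te tF; rewrite -Es; case: (Hs t e tS te tF) => H; [right|left]; apply: consec_rev.
Qed.

Lemma joined_sound o S F : joined o S F -> uniq S -> joined_sem o S F.
Proof.
elim=> {o S F} [t|S F t e b _ IH tS te tF|p q p' q' S F S' F' _ IH _ IH' qp|p q S F _ IH qp|o S F S' F' _ IH pS sF] uS.
- have [s Es] := tpath_head t; have ut := tpath_uniq t.
  exists (tpath t); rewrite /= cats0; split=> //.
    have := tpath_sorted t; have [s' Es'] := tpath_last t; rewrite Es /= rcons_path => st.
    rewrite (sub_path _ st) => [|x y xy]; last by rewrite /odd_adj xy.
    have <- : last [::] (tpath t) = last (dyck t) s by rewrite Es.
    by rewrite Es' last_rcons odd_adjC /odd_adj eqxx orbT.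
  move=> t' e; rewrite inE => /eqP-> te _; have := ends_consec te.
  by case: (ends t e) => p q /= [] H; [left|right]; apply: (consec_next ut).
- have [c [pc Rc Hc]] := IH uS.
  have uc : uniq c by rewrite (perm_uniq pc) flatten_tpath_uniq.
  have mc t' e' : t' \in S -> edge_of t' e' -> (ends t' e').1 \in c /\ (ends t' e').2 \in c.
    move=> tS' te'; rewrite !(perm_mem pc); have := ends_consec te'.
    case: (ends t' e') => p' q' H /=.
    by case: H => -[s1 [s2 Es]]; split; apply/flattenP; exists (tpath t'); rewrite ?map_f // Es mem_cat !inE eqxx ?orbT.
  have [m1 m2] := mc t e tS te.
  have main p q : p \in c -> next c p = q -> same_ends (ends t e) (p, q) ->
      joined_sem (Some (q, p)) S ((t, e) :: F).
    move=> pm Eq He; have [s [ps Rs ls Hs]] := open_cycle uc Rc pm.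
    rewrite Eq in ps Rs ls Hs; exists s; split=> //; first exact: perm_trans pc.
    move=> t' e' tS' te'; rewrite inE negb_or => /andP[ne tF'].
    have [m1' m2'] := mc t' e' tS' te'.
    (* An untouched edge leaving [p] in the direction of the cycle would have the ends of the opened
       edge, and [ends_inj] would identify the two. *)
    have ne' a b' : same_ends (ends t' e') (a, b') -> next c a = b' -> a != p.
      move=> Hab nab; apply: contra ne => /eqP Ea; apply/eqP; apply: ends_inj => //.
      move: Hab; rewrite Ea -nab Ea Eq => Hab.
      by case: He Hab => -> [] ->; [left|right|right|left].
    case: (Hc t' e' tS' te' tF') => E; [left|right].
      by rewrite -E; apply: Hs => //; apply: (ne' _ _ _ E); left; case: (ends t' e').
    by rewrite -E; apply: Hs => //; apply: (ne' _ _ _ E); right; case: (ends t' e').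
  case: (Hc t e tS te tF) => E.
    have M := main _ _ m1 E (or_introl (surjective_pairing _)).
    case: b => //; rewrite [ends t e]surjective_pairing; exact: joined_sem_rev.
  have M := main _ _ m2 E (or_intror (surjective_pairing _)).
  case: b; last by rewrite [ends t e]surjective_pairing.
  exact: joined_sem_rev.
- move: uS; rewrite cat_uniq => /and3P[/IH[s [ps Rs ls Hs]] dS /IH'[s' [ps' Rs' ls' Hs']]].
  exists (s ++ p' :: s'); split.
  + by rewrite map_cat flatten_cat -cat_cons perm_cat.
  + by rewrite cat_path Rs ls /= Rs' /odd_adj qp.
  + by rewrite last_cat.
  move=> t e; rewrite !mem_cat negb_or -cat_cons => /orP[tS|tS] te /andP[tF tF'].
    by case: (Hs t e tS te tF) => H; [left|right]; apply: consec_catr.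
  by case: (Hs' t e tS te tF') => H; [left|right]; apply: consec_catl.
- have [s [ps Rs ls Hs]] := IH uS.
  have us : uniq (p :: s) by rewrite (perm_uniq ps) flatten_tpath_uniq.
  exists (p :: s); split=> //; first by rewrite /= rcons_path Rs ls /odd_adj qp.
  by move=> t e tS te tF; case: (Hs t e tS te tF) => H; [left|right]; apply: (consec_next us).
have uS0 : uniq S by rewrite (perm_uniq pS).
have pf := perm_flatten_map tpath pS.
case: o IH => [[p q]|] /(_ uS0) [s].
  case=> ps Rs ls Hs; exists s; split=> //; first exact: perm_trans pf.
  by move=> t e tS te tF; apply: Hs; rewrite ?(perm_mem pS) //; apply: contra tF; apply: sF.
case=> ps Rs Hs; exists s; split=> //; first exact: perm_trans pf.
by move=> t e tS te tF; apply: Hs; rewrite ?(perm_mem pS) //; apply: contra tF; apply: sF.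
Qed.

Lemma joined_up v o S F : joined o S F ->
  joined (omap (fun pq => (upper v pq.1, upper v pq.2)) o) (map (N^~ v) S)
    (map (fun x => (N x.1 v, Up x.2)) F).
Proof.
elim=> {o S F} [t|S F t e b _ IH tS te tF|p q p' q' S F S' F' _ IH _ IH' qp|p q S F _ IH qp|o S F S' F' _ IH pS sF].
- exact: joined1.
- have := @joined_open _ _ (N t v) (Up e) b IH; rewrite /= => H.
  case: b H => H; apply: H => //; rewrite ?map_f //;
  by apply: contra tF => /mapP[[t' e'] tF' /= [-> ->]].
- by rewrite !map_cat; apply: joined_cat IH IH' _; apply: flip1_upper.
- by apply: joined_close IH _; apply: flip1_upper.
apply: joined_weaken IH _ _; first exact: perm_map.
by move=> _ /mapP[x xF ->]; apply/map_f/sF.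
Qed.

Lemma joined_low u o S F : joined o S F ->
  joined (omap (fun pq => (lower u pq.1, lower u pq.2)) o) (map (N u) S)
    (map (fun x => (N u x.1, Low x.2)) F).
Proof.
elim=> {o S F} [t|S F t e b _ IH tS te tF|p q p' q' S F S' F' _ IH _ IH' qp|p q S F _ IH qp|o S F S' F' _ IH pS sF].
- exact: joined1.
- have := @joined_open _ _ (N u t) (Low e) b IH; rewrite /= => H.
  case: b H => H; apply: H => //; rewrite ?map_f //;
  by apply: contra tF => /mapP[[t' e'] tF' /= [-> ->]].
- by rewrite !map_cat; apply: joined_cat IH IH' _; apply: flip1_lower.
- by apply: joined_close IH _; apply: flip1_lower.
apply: joined_weaken IH _ _; first exact: perm_map.
by move=> _ /mapP[x xF ->]; apply/map_f/sF.
Qed.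

(** Exchanges see a tree only through intact edges of its cycle, so each tree can be replaced by a
    set already merged into one cycle with different edges. This composes hypertrees. *)
Lemma joined_subst (f : tree -> seq tree) G o S F : joined o S F ->
  {in S, forall t, t \in f t /\ joined None (f t) G} -> {in F, forall x, x \notin G} ->
  joined o (flatten (map f S)) (F ++ G).
Proof.
elim=> {o S F} [t|S F t e b _ IH tS te tF|p q p' q' S F S' F' _ IH _ IH' qp|p q S F _ IH qp|o S F S' F' _ IH pS sF] Hf HF.
- by rewrite /= cats0; case: (Hf t (mem_head _ _)).
- apply: joined_open => //.
  + by apply: IH => // x xF; apply: HF; rewrite inE xF orbT.
  + by apply/flattenP; exists (f t); [apply: map_f|case: (Hf t tS)].
  by rewrite mem_cat negb_or tF HF ?mem_head.
- rewrite map_cat flatten_cat.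
  apply: (@joined_weaken _ _ ((F ++ G) ++ (F' ++ G))) => //; last first.
    by move=> x; rewrite !mem_cat; case: (x \in F); case: (x \in F'); case: (x \in G).
  apply: (joined_cat _ _ qp).
    by apply: IH => [t tS|x xF]; [apply: Hf|apply: HF]; rewrite mem_cat ?tS ?xF.
  by apply: IH' => [t tS|x xF]; [apply: Hf|apply: HF]; rewrite mem_cat ?tS ?xF orbT.
- by apply: joined_close qp; apply: IH.
apply: (@joined_weaken _ (flatten (map f S)) (F ++ G)).
- by apply: IH => [t tS|x xF]; [apply: Hf; rewrite -(perm_mem pS)|apply/HF/sF].
- exact: perm_flatten_map.
by move=> x; rewrite !mem_cat => /orP[/sF->|->]; rewrite ?orbT.
Qed.

(** * Enumeration of the trees of a given weight *)

Fixpoint tree_lists (k : nat) : seq (seq tree) :=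
  if k is k'.+1 then
    let l := tree_lists k' in
    rcons l (flatten [seq allpairs N (nth [::] l i) (nth [::] l (k' - i)) | i <- iota 0 k])
  else [:: [:: E]].

(** The lists of all smaller weights are tabulated to keep evaluation cheap; the resulting order
    fixes the tree numbers used in the certificates. *)
Definition trees (k : nat) : seq tree := nth [::] (tree_lists k) k.

Lemma size_tree_lists k : size (tree_lists k) = k.+1.
Proof. by elim: k => //= k IH; rewrite size_rcons IH. Qed.

Lemma nth_tree_lists k i : i <= k -> nth [::] (tree_lists k) i = trees i.
Proof.
elim: k => [|k IH] ik; first by case: i ik.
case: (ltnP i k.+1) => [ik'|ki]; first by rewrite /= nth_rcons size_tree_lists ik' IH.
by have -> : i = k.+1 by lia.
Qed.

Definition block (i j : nat) : seq tree := allpairs N (trees i) (trees j).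

Lemma treesS k : trees k.+1 = flatten [seq block i (k - i) | i <- iota 0 k.+1].
Proof.
have -> : trees k.+1 = nth [::] (rcons (tree_lists k) (flatten
    [seq allpairs N (nth [::] (tree_lists k) i) (nth [::] (tree_lists k) (k - i)) | i <- iota 0 k.+1])) k.+1 by [].
rewrite nth_rcons size_tree_lists ltnn eqxx; apply: (congr1 flatten).
apply/eq_in_map => i; rewrite mem_iota add0n ltnS => ik.
by rewrite !nth_tree_lists // leq_subr.
Qed.

Lemma uniq_flatten_key (I T : eqType) (f : I -> seq T) (key : T -> I) s : uniq s ->
  {in s, forall i, uniq (f i) /\ {in f i, forall x, key x = i}} -> uniq (flatten (map f s)).
Proof.
elim: s => //= i s IH /andP[is_ us] H; rewrite cat_uniq.
have [ui ki] := H i (mem_head _ _); rewrite ui IH //; last first.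
  by move=> j js; apply: H; rewrite inE js orbT.
rewrite andbT; apply/hasPn=> x /flattenP[_ /mapP[j js ->]] xj; apply/negP=> xi.
have [_ kj] : uniq (f j) /\ {in f j, forall x, key x = j} by apply: H; rewrite inE js orbT.
by move: is_; rewrite -(ki x xi) (kj x xj) js.
Qed.

Lemma mem_block i j u v : (N u v \in block i j) = (u \in trees i) && (v \in trees j).
Proof.
apply/allpairsP/andP => [[[a b] /= [ha hb E]]|[hu hv]]; last by exists (u, v).
by case: E ha hb => <- <-.
Qed.

Lemma mem_trees k t : (t \in trees k) = (weight t == k).
Proof.
elim/ltn_ind: k t => -[|k] IH t; first by case: t.
rewrite treesS; apply/flattenP/eqP => [[s /mapP[i]]|wt].
  rewrite mem_iota add0n ltnS => ik -> /allpairsP[[u v] /= [hu hv E]].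
  move: hu hv; rewrite {t}E /=.
  by rewrite !IH ?leq_subr //; last lia; move=> /eqP-> /eqP->; lia.
case: t wt => [//|u v] wt; have {}wt : weight u + weight v = k by case: wt.
exists (block (weight u) (k - weight u)).
  by apply/mapP; exists (weight u); rewrite // mem_iota; lia.
rewrite mem_block !IH ?eqxx //=; lia.
Qed.

Lemma block_uniq i j : uniq (trees i) -> uniq (trees j) -> uniq (block i j).
Proof. by move=> ui uj; apply: allpairs_uniq => // -[a b] [c d] _ _ /= [-> ->]. Qed.

Lemma trees_uniq k : uniq (trees k).
Proof.
elim/ltn_ind: k => -[|k] IH //.
rewrite treesS; apply: (@uniq_flatten_key _ _ _ (fun t => if t is N u _ then weight u else 0)).
  exact: iota_uniq.
move=> i; rewrite mem_iota add0n ltnS => ik; split.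
  by apply: block_uniq; apply: IH; lia.
by move=> _ /allpairsP[[u v] /= [hu _ ->]]; move: hu; rewrite mem_trees => /eqP.
Qed.

Definition rooted (x : tree * edge) : bool :=
  match x with (N E _, Start) | (N E _, Middle) => true | _ => false end.

(* Edges that the exchanges at one level leave free for the next levels. *)
Definition spare (x : tree * edge) : bool :=
  match x with
  | (N E _, Start) | (N E _, Middle) => true
  | (N _ (N E v), Low Start) => v != E
  | (N _ (N E _), Low Middle) => true
  | _ => false
  end.

Definition joinable k := exists2 F, joined None (trees k) F & all (predC spare) F.

(** * Checking exchange certificates *)

Fixpoint extract (cs : seq (seq tree)) (t : tree) : option (seq tree * seq (seq tree)) :=
  if cs is c :: cs' then
    if t \in c then Some (c, cs')
    else if extract cs' t is Some (d, ds) then Some (d, c :: ds) else None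
  else None.

Fixpoint edges (t : tree) : seq edge :=
  if t is N u v then Start :: Middle :: map Up (edges u) ++ map Low (edges v) else [::].

Definition oriented (b : bool) (pq : bitseq * bitseq) := if b then (pq.2, pq.1) else pq.

(** Walks along an alternating cycle: listed edges are opened, and the flips between consecutive
    ones replace them. Each class met is removed from [cs], so it is merged only once. *)
Fixpoint run_exchange (T : seq tree) (l : seq (nat * nat * bool)) cs F (p q : bitseq) S :=
  if l is (i, j, b) :: l' then
    let t := nth E T i in let e := nth Start (edges t) j in
    if extract cs t is Some (c, cs') then
      let (p', q') := oriented b (ends t e) in
      if [&& edge_of t e, (t, e) \notin F & flip1 q p'] then
        run_exchange T l' cs' ((t, e) :: F) p q' (S ++ c)
      else None
    else None
  else if flip1 q p then Some (S :: cs, F) else None.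

Definition start_exchange (T : seq tree) (l : seq (nat * nat * bool)) cs F :=
  if l is (i, j, b) :: l' then
    let t := nth E T i in let e := nth Start (edges t) j in
    if extract cs t is Some (c, cs') then
      let (p, q) := oriented b (ends t e) in
      if edge_of t e && ((t, e) \notin F) then
        run_exchange T l' cs' ((t, e) :: F) p q c
      else None
    else None
  else None.

Fixpoint run_exchanges T ls cs F :=
  if ls is l :: ls' then
    if start_exchange T l cs F is Some (cs', F') then run_exchanges T ls' cs' F' else None
  else Some (cs, F).

Definition check_certificate k ls :=
  let T := trees k in
  if run_exchanges T ls [seq [:: t] | t <- T] [::] is Some ([:: c], F) then
    perm_eq c T && all (predC spare) F
  else false.

Lemma extract_sound cs t c cs' : extract cs t = Some (c, cs') ->
  [/\ t \in c, c \in cs & {subset cs' <= cs}].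
Proof.
elim: cs c cs' => //= d ds IH c cs'; case: ifP => [td [<- <-]|_].
  by split=> [//||x xs]; rewrite inE ?eqxx ?xs ?orbT.
case: (extract ds t) IH => // -[d' ds'] /(_ _ _ erefl)[H1 H2 H3] [<- <-]; split=> //.
  by rewrite inE H2 orbT.
by move=> x; rewrite !inE => /orP[->//|/H3->]; rewrite orbT.
Qed.

Lemma run_exchange_sound T l cs F p q S cs' F' :
  joined (Some (p, q)) S F -> {in cs, forall c, joined None c F} ->
  run_exchange T l cs F p q S = Some (cs', F') -> {in cs', forall c, joined None c F'}.
Proof.
elim: l cs F q S => /= [|[[i j] b] l IH] cs F q S HS Hcs.
  case: ifP => // qp [<- <-] c; rewrite inE => /orP[/eqP->|]; last exact: Hcs.
  exact: joined_close HS qp.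
case Ex: (extract _ _) => [[c cs1]|] //.
have [tc ccs scs] := extract_sound Ex.
case Eo: (oriented _ _) => [p' q'] ; case: ifP => // /and3P[et tF qp]; apply: IH.
  apply: (@joined_weaken _ (S ++ c) (F ++ ((nth E T i, nth Start (edges (nth E T i)) j) :: F))) => //.
    apply: joined_cat HS _ qp; rewrite -Eo /oriented.
    by have := @joined_open c F _ _ b (Hcs c ccs) tc et tF.
  by move=> x; rewrite mem_cat => /orP[xF|//]; rewrite inE xF orbT.
move=> d dcs; apply: (joined_weaken (Hcs d (scs d dcs)) (perm_refl _)).
by move=> x xF; rewrite inE xF orbT.
Qed.

Lemma start_exchange_sound T l cs F cs' F' : {in cs, forall c, joined None c F} ->
  start_exchange T l cs F = Some (cs', F') -> {in cs', forall c, joined None c F'}.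
Proof.
case: l => //= -[[i j] b] l Hcs; case Ex: (extract _ _) => [[c cs1]|] //.
have [tc ccs scs] := extract_sound Ex.
case Eo: (oriented _ _) => [p q]; case: ifP => // /andP[et tF]; apply: run_exchange_sound.
  by have := @joined_open c F _ _ b (Hcs c ccs) tc et tF; rewrite -[if b then _ else _]/(oriented b _) Eo.
move=> d dcs; apply: (joined_weaken (Hcs d (scs d dcs)) (perm_refl _)).
by move=> x xF; rewrite inE xF orbT.
Qed.

Lemma check_certificate_sound k ls : check_certificate k ls -> joinable k.
Proof.
rewrite /check_certificate; case E: run_exchanges => [[[|c []] F]|] // /andP[pS sF].
exists F => //; apply: (joined_weaken _ pS (fun x xF => xF)).
have : {in [:: c], forall d, joined None d F}; last by apply; apply: mem_head.
have : {in [seq [:: t] | t <- trees k], forall c, joined None c [::]}.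
  by move=> _ /mapP[t _ ->]; apply: joined1.
move: [seq [:: t] | t <- trees k] ([::] : seq (tree * edge)) E => cs0 F0.
elim: ls cs0 F0 => /= [|l ls IH] cs F0; first by move=> [<- <-].
case El: start_exchange => [[cs' F']|] // /IH H Hcs; apply: H.
exact: start_exchange_sound Hcs El.
Qed.

(* Found by computer search. An entry [(i, j, b)] is the [j]-th edge of the
   [i]-th tree, reversed when [b] is true; each list is an alternating cycle. *)
Definition certificate3 : seq (seq (nat * nat * bool)) :=
  [:: [:: (1, 4, false); (4, 3, true); (3, 1, false)];
      [:: (0, 4, false); (4, 1, true); (2, 3, false)]].

Definition certificate4 : seq (seq (nat * nat * bool)) :=
  [:: [:: (1, 6, false); (4, 5, true); (3, 3, false)];
      [:: (2, 6, false); (13, 1, true); (7, 3, false)];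
      [:: (9, 3, false); (10, 5, false); (12, 6, false); (13, 2, true)];
      [:: (0, 6, false); (4, 3, true); (2, 5, false)];
      [:: (5, 6, false); (12, 1, true); (8, 5, true)];
      [:: (6, 5, false); (11, 4, true); (9, 1, false)]].

Definition certificate5 : seq (seq (nat * nat * bool)) :=
  [:: [:: (28, 7, false); (35, 2, true); (33, 5, true); (36, 3, false)];
      [:: (21, 8, false); (34, 1, true); (26, 6, false)];
      [:: (37, 5, false); (38, 8, false); (41, 4, true)];
      [:: (3, 6, false); (11, 8, false); (12, 5, true); (9, 3, false)];
      [:: (0, 8, false); (4, 5, true); (3, 7, false); (2, 4, false)];
      [:: (20, 5, false); (28, 0, false); (31, 4, true); (24, 4, true)];
      [:: (5, 6, false); (27, 8, false); (36, 1, true); (19, 3, false)];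
      [:: (9, 5, false); (10, 8, false); (13, 4, true)];
      [:: (5, 8, false); (12, 3, true); (8, 7, true)];
      [:: (19, 9, false); (41, 8, true); (29, 2, false); (39, 1, false)];
      [:: (14, 9, false); (17, 4, true); (16, 7, true); (18, 5, false)];
      [:: (32, 7, false); (34, 8, true); (37, 3, true); (40, 5, false)];
      [:: (7, 5, false); (16, 5, true); (23, 1, true); (25, 3, false)];
      [:: (17, 3, false); (30, 0, false); (38, 9, false)];
      [:: (6, 4, false); (22, 3, true); (20, 1, false)];
      [:: (1, 4, false); (22, 1, true); (15, 3, false)]].

Definition certificate6 : seq (seq (nat * nat * bool)) :=
  [:: [:: (29, 5, false); (32, 11, false); (39, 4, true)];
      [:: (31, 4, false); (37, 4, false); (40, 6, true); (36, 9, true)];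
      [:: (19, 11, false); (41, 11, false); (31, 3, false)];
      [:: (99, 7, false); (107, 7, true); (118, 3, true); (123, 5, false)];
      [:: (4, 4, false); (10, 4, false); (12, 9, true)];
      [:: (76, 6, false); (84, 3, true); (83, 5, false); (81, 2, false)];
      [:: (63, 11, false); (121, 9, true); (108, 2, false); (119, 1, false)];
      [:: (68, 11, false); (130, 10, true); (96, 2, false); (126, 1, false)];
      [:: (47, 3, false); (68, 0, false); (66, 7, false); (72, 7, true)];
      [:: (43, 9, false); (116, 9, true); (106, 5, false); (113, 1, false)];
      [:: (26, 11, false); (99, 10, true); (97, 3, true); (130, 1, false)];
      [:: (64, 9, false); (71, 9, true); (104, 1, true); (113, 6, false)];
      [:: (117, 5, false); (126, 2, false); (119, 8, true); (124, 7, true)];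
      [:: (93, 8, false); (101, 10, false); (102, 7, true); (99, 5, false)];
      [:: (50, 0, false); (103, 0, false); (92, 10, true); (97, 7, true)];
      [:: (44, 8, false); (50, 7, true); (52, 5, false); (49, 10, true)];
      [:: (67, 10, false); (125, 6, false); (98, 1, false)];
      [:: (94, 6, false); (112, 10, true); (111, 3, true); (108, 5, false)];
      [:: (73, 3, false); (109, 0, false); (103, 8, true); (128, 5, true)];
      [:: (120, 9, false); (121, 5, true); (129, 4, false); (122, 8, true)];
      [:: (19, 8, false); (88, 1, true); (80, 3, false); (66, 4, true)];
      [:: (7, 9, false); (9, 4, false); (10, 8, true)];
      [:: (63, 8, false); (85, 7, false); (110, 1, false); (83, 10, true)];
      [:: (67, 0, false); (90, 0, false); (91, 11, true)];
      [:: (17, 5, false); (28, 2, false); (37, 11, true); (22, 4, true)];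
      [:: (48, 6, false); (73, 5, false); (71, 1, false)];
      [:: (44, 3, false); (79, 0, false); (77, 8, false); (86, 7, true)];
      [:: (5, 8, false); (27, 3, true); (24, 5, false); (19, 6, true)];
      [:: (1, 6, false); (73, 1, true); (69, 3, false); (57, 5, false)];
      [:: (52, 11, false); (53, 11, true); (54, 7, true); (55, 9, false)];
      [:: (95, 10, false); (102, 5, true); (100, 6, true); (98, 8, false)];
      [:: (33, 7, false); (35, 4, false); (36, 6, true)];
      [:: (14, 8, false); (24, 10, false); (30, 3, true); (21, 6, false)];
      [:: (14, 10, false); (18, 7, true); (16, 9, false)];
      [:: (23, 10, false); (127, 1, true); (76, 3, false)];
      [:: (45, 8, false); (53, 7, true); (51, 5, false)];
      [:: (0, 8, false); (8, 5, true); (7, 7, false); (5, 4, false)];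
      [:: (25, 11, false); (38, 10, false); (34, 3, false)];
      [:: (9, 10, false); (13, 7, true); (11, 9, false)];
      [:: (56, 8, false); (87, 1, true); (74, 5, true)];
      [:: (85, 8, false); (89, 5, true); (87, 7, false)];
      [:: (29, 4, false); (105, 3, true); (91, 1, false)];
      [:: (2, 5, false); (3, 10, false); (13, 4, true)];
      [:: (56, 11, false); (59, 6, true); (58, 9, true); (60, 7, false)];
      [:: (61, 10, false); (65, 7, true); (63, 9, false)];
      [:: (70, 7, false); (81, 0, false); (82, 6, true)];
      [:: (75, 9, false); (115, 8, true); (111, 1, false)];
      [:: (25, 10, false); (129, 1, true); (78, 3, false)];
      [:: (42, 10, false); (46, 7, true); (44, 9, false)];
      [:: (15, 4, false); (62, 3, true); (57, 1, false)];
      [:: (114, 11, false); (131, 8, false); (121, 3, false)];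
      [:: (6, 6, false); (22, 5, true); (20, 3, false)]].

(** Weight 2 is absent, since joining its two trees would give a Hamilton cycle of the Petersen
    graph. *)
Lemma joinable_small k : k \in [:: 0; 1; 3; 4; 5; 6] -> joinable k.
Proof.
rewrite !inE => /or4P[/eqP->|/eqP->|/eqP->|/or3P[/eqP->|/eqP->|/eqP->]].
- by exists [::] => //; apply: joined1.
- by exists [::] => //; apply: joined1.
- by apply: (@check_certificate_sound _ certificate3); vm_compute.
- by apply: (@check_certificate_sound _ certificate4); vm_compute.
- by apply: (@check_certificate_sound _ certificate5); vm_compute.
by apply: (@check_certificate_sound _ certificate6); vm_compute.
Qed.

(* Edges of [N u v] that may be used by exchanges lifted from [u] or [v]. The
   trees [N E t] form the hub to which all other trees will be attached. *)
Definition inherited (x : tree * edge) : bool :=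
  match x with
  | (N u v, Up e) => ~~ rooted (u, e)
  | (N u v, Low e) => (u != E) && ~~ rooted (v, e)
  | _ => false
  end.

(** * The recursive step: attaching blocks to the hub *)

Definition component X := exists2 F, joined None X F & all inherited F.

Lemma inherited_spare x : inherited x -> ~~ spare x.
Proof. by case: x => -[|[|u1 u2] [|[|v1 v2] v3]] [||[||e|e]|[||e|e]] //=. Qed.

Lemma spare_rooted x : ~~ spare x -> ~~ rooted x.
Proof. by case: x => -[|[|? ?] [|[|? ?] ?]] []. Qed.

Lemma component_low d j : d != E -> joinable j -> component (map (N d) (trees j)).
Proof.
move=> dE [F HF sF]; exists (map (fun x => (N d x.1, Low x.2)) F); first exact: joined_low HF.
apply/allP=> _ /mapP[[t e] xF ->]; apply/andP; split=> //.
exact: spare_rooted (allP sF _ xF).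
Qed.

Lemma component_up d i : joinable i -> component (map (N^~ d) (trees i)).
Proof.
move=> [F HF sF]; exists (map (fun x => (N x.1 d, Up x.2)) F); first exact: joined_up HF.
apply/allP=> _ /mapP[[t e] xF ->].
exact: spare_rooted (allP sF _ xF).
Qed.

(** A representative of each weight; its shape is immaterial. *)
Fixpoint chain k := if k is k'.+1 then N E (chain k') else E.

Lemma weight_chain k : weight (chain k) = k.
Proof. by elim: k => //= k ->. Qed.

Lemma block_columns i j : perm_eq (flatten [seq map (N^~ v) (trees i) | v <- trees j]) (block i j).
Proof.
apply: uniq_perm.
- apply: (@uniq_flatten_key _ _ _ (fun t => if t is N _ v then v else E)); first exact: trees_uniq.
  move=> v _; split; first by rewrite map_inj_uniq ?trees_uniq // => a b [].
  by move=> _ /mapP[u _ ->].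
- by apply: block_uniq; apply: trees_uniq.
case=> [|u v]; last rewrite mem_block.
  apply/flattenP/allpairsP => [[s /mapP[v _ ->] /mapP[u]] //|[p [_ _]] //].
apply/flattenP/andP => [[s /mapP[v' hv ->] /mapP[u' hu [-> ->]]] //|[hu hv]].
by exists (map (N^~ v) (trees i)); apply: map_f.
Qed.

(** Every column [N _ v] is joined by the same [Up] exchanges, and the row of [u0], which meets each
    column once, is joined by [Low] exchanges; [joined_subst] combines the two. *)
Lemma component_block i j : 0 < i -> joinable i -> joinable j -> component (block i j).
Proof.
case: i => // i _ [G HG sG] [F HF sF]; pose u0 := chain i.+1.
pose G' := flatten [seq map (fun x => (N x.1 v, Up x.2)) G | v <- trees j].
pose f t := if t is N _ v then map (N^~ v) (trees i.+1) else [::].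
have low x : x \in map (fun x => (N u0 x.1, Low x.2)) F -> x \notin G'.
  move=> /mapP[y _ ->]; apply/negP=> /flattenP[_ /mapP[v _ ->] /mapP[z _ []]] //.
have := joined_subst (joined_low u0 HF) _ low.
move=> /(_ f); rewrite -map_comp => H; have {}H : joined None (block i.+1 j) (map (fun x => (N u0 x.1, Low x.2)) F ++ G').
  apply: joined_weaken (H _) (block_columns _ _) (fun x xF => xF).
  move=> _ /mapP[v vj ->] /=; split; first by rewrite map_f // mem_trees weight_chain.
  apply: joined_weaken (joined_up v HG) (perm_refl _) _ => x xG.
  by apply/flattenP; eexists; first by apply: map_f vj.
exists (map (fun x => (N u0 x.1, Low x.2)) F ++ G') => //.
rewrite all_cat; apply/andP; split; apply/allP.
  by move=> _ /mapP[[t e] xF ->]; apply: spare_rooted (allP sF _ xF).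
by move=> x /flattenP[_ /mapP[v _ ->] /mapP[[t e] yG ->]]; apply: spare_rooted (allP sG _ yG).
Qed.

Ltac flip_words :=
  by rewrite /= ?map_cat /= ?negb_wK -?catA /= ?(flip1_cat2l, eqxx) /= ?(flip1_cat2l, eqxx).

Section JoinableStep.
Variable k : nat.
Hypotheses (k_gt6 : 6 < k) (IH : forall j, j < k -> j != 2 -> joinable j).

Let hub := map (N E) (trees k.-1).

Section Hub.
Variable F1 : seq (tree * edge).
Hypotheses (HF1 : joined None (trees k.-1) F1) (sF1 : all (predC spare) F1).

Definition key_below (b : nat) (x : tree * edge) : bool :=
  match x with (N E (N u w), Low _) => weight u < b | _ => true end.

Lemma key_below_le b b' x : b <= b' -> key_below b x -> key_below b' x.
Proof. by case: x => -[|[|? ?] [|? ?]] [||?|?] //= bb /leq_trans; apply. Qed.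

Let F0 := map (fun x => (N E x.1, Low x.2)) F1.

(* The exchanges used so far have touched only hub trees [N E (N u w)] with
   [weight u < b], apart from those lifted from the level below. *)
Definition hub_state b X := {subset hub <= X} /\ exists F,
  [/\ joined None X F, all (predC spare) F & all (fun x => (x \in F0) || key_below b x) F].

Lemma hub_state_perm b X Y : hub_state b X -> perm_eq X Y -> hub_state b Y.
Proof.
move=> [hX [F [HF sF bF]]] pXY; split; first by move=> x /hX; rewrite (perm_mem pXY).
by exists F; split=> //; apply: joined_weaken HF pXY (fun x xF => xF).
Qed.

Lemma hub_state_le b b' X : b <= b' -> hub_state b X -> hub_state b' X.
Proof.
move=> bb [hX [F [HF sF bF]]]; split=> //; exists F; split=> //.
by apply/allP=> x /(allP bF) /orP[->//|/(key_below_le bb) ->]; rewrite orbT.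
Qed.

Lemma hub_state0 : hub_state 0 hub.
Proof.
split=> //; exists F0; split; first exact: joined_low HF1.
- apply/allP=> _ /mapP[[t e] xF ->]; have := spare_rooted (allP sF1 _ xF).
  by case: t {xF} => [|[|? ?] ?]; case: e.
by apply/allP=> x ->.
Qed.

(** The exchanges lifted into the hub avoid spare edges, and by the bound [b] later ones have not
    reached weight [weight u]. So the chosen edge is intact; the cycle is opened there and closed
    through the path of [X']. *)
Lemma attach b X u w e (f : bool) p q X' F' : hub_state b X -> b <= weight u ->
  weight u + weight w = k.-2 -> edge_of (N u w) e -> spare (N u w, e) ->
  oriented f (ends (N E (N u w)) (Low e)) = (p, q) ->
  forall p' q', joined (Some (p', q')) X' F' -> flip1 q p' -> flip1 q' p ->
  all (predC spare) F' -> all (key_below 0) F' -> ~~ spare (N E (N u w), Low e) ->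
  hub_state (weight u).+1 (X ++ X').
Proof.
move=> [hX [F [HF sF bF]]] bu wuw euw suw Eo p' q' HX' qp' q'p sF' kF' ns.
have nF : (N E (N u w), Low e) \notin F.
  apply/negP=> /[dup] /(allP bF) /orP[/mapP[[t e'] xF /= [Et Ee]]|] /=.
    by move: xF; rewrite -Et -Ee => /(allP sF1)/negP[].
  by rewrite ltnNge bu.
have th : N E (N u w) \in hub.
  by apply: map_f; rewrite mem_trees /= wuw; nat_lia.
have HX : joined (Some (p, q)) X ((N E (N u w), Low e) :: F).
  have := @joined_open _ _ (N E (N u w)) (Low e) f HF (hX _ th) euw nF.
  by rewrite -[if f then _ else _]/(oriented f _) Eo.
split; first by move=> x xh; rewrite mem_cat hX.
exists (((N E (N u w), Low e) :: F) ++ F'); split.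
- exact: joined_close (joined_cat HX HX' qp') q'p.
- by rewrite all_cat sF' andbT /= ns.
rewrite all_cat /= ltnSn orbT /=; apply/andP; split; apply/allP=> x.
  move=> /(allP bF) /orP[->//|/(key_below_le (leqW bu)) ->]; by rewrite orbT.
by move=> /(allP kF') /(key_below_le (leq0n _)) ->; rewrite orbT.
Qed.

Lemma inherited_key x : inherited x -> key_below 0 x.
Proof. by case: x => -[|[|? ?] [|? ?]] []. Qed.

Lemma all_inherited F : all inherited F -> all (predC spare) F /\ all (key_below 0) F.
Proof.
by move=> iF; split; [apply: sub_all iF; apply: inherited_spare|apply: sub_all iF; apply: inherited_key].
Qed.

(* The three words 111u000v, 101u010v, 110u010v: an alternating hexagon. *)
Lemma attach_two b X u v Y Z : hub_state b X -> b <= weight u -> weight u + weight v = k - 3 -> v != E ->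
  component Y -> N (N E u) (N E v) \in Y -> component Z -> N (N (N u E) E) v \in Z ->
  hub_state (weight u).+1 (X ++ (Y ++ Z)).
Proof.
move=> HX bu wk vE [FY HY iY] tY [FZ HZ iZ] tZ.
have nY : (N (N E u) (N E v), Up Middle) \notin FY by apply/negP=> /(allP iY).
have nZ : (N (N (N u E) E) v, Middle) \notin FZ by apply/negP=> /(allP iZ).
have PY := @joined_open _ _ _ (Up Middle) true HY tY isT nY.
have PZ := @joined_open _ _ _ Middle false HZ tZ isT nZ.
rewrite /= /upper /lower in PY PZ.
have [sY kY] := all_inherited iY; have [sZ kZ] := all_inherited iZ.
have PYZ := joined_cat PY PZ.
apply: (@attach b X u (N E v) (Low Start) true _ _ _ _ HX bu _ _ _ erefl _ _ (PYZ _)).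
- by rewrite /=; nat_lia.
- by [].
- by move: vE; clear; case: u => [|[|? ?] ?].
- flip_words.
- flip_words.
- flip_words.
- by rewrite all_cat /= sY sZ; clear; case: v => [|[|? ?] ?].
- by rewrite all_cat /= kY kZ.
by clear; case: u => [|? ?].
Qed.

(* The words 111u00100, 111u00010, 101u01010, 110u01010: an alternating octagon. *)
Lemma attach_three b X u Y Z W : hub_state b X -> b <= weight u -> weight u = k - 4 ->
  component Y -> N (N E u) (N E (N E E)) \in Y ->
  component Z -> N (N (N u E) (N E E)) E \in Z ->
  component W -> N (N (N u E) E) (N E E) \in W ->
  hub_state (weight u).+1 (X ++ ((Y ++ Z) ++ W)).
Proof.
move=> HX bu wk [FY HY iY] tY [FZ HZ iZ] tZ [FW HW iW] tW.
have nY : (N (N E u) (N E (N E E)), Up Middle) \notin FY by apply/negP=> /(allP iY).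
have nZ : (N (N (N u E) (N E E)) E, Middle) \notin FZ by apply/negP=> /(allP iZ).
have nW : (N (N (N u E) E) (N E E), Low Start) \notin FW by apply/negP=> /(allP iW).
have PY := @joined_open _ _ _ (Up Middle) true HY tY isT nY.
have PZ := @joined_open _ _ _ Middle false HZ tZ isT nZ.
have PW := @joined_open _ _ _ (Low Start) true HW tW isT nW.
rewrite /= /upper /lower in PY PZ PW.
have [sY kY] := all_inherited iY; have [sZ kZ] := all_inherited iZ.
have [sW kW] := all_inherited iW.
have PYZW f1 f2 := joined_cat (joined_cat PY PZ f1) PW f2.
apply: (@attach b X u (N E (N E E)) (Low Start) true _ _ _ _ HX bu _ _ _ erefl _ _ (PYZW _ _)).
- by rewrite /=; nat_lia.
- by [].
- by clear; case: u => [|[|? ?] ?].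
- flip_words.
- flip_words.
- flip_words.
- flip_words.
(* The opened edge of [W] is not spare because [spare] exempts [Low Start] when the second factor is
   [N E E]. *)
- by rewrite !all_cat /= sY sZ sW.
- by rewrite !all_cat /= kY kZ kW.
by clear; case: u => [|? ?].
Qed.

(* The words 111000v, 101010v, 110100v, 110010v: an alternating octagon. *)
Lemma attach_start X v Y Z W : hub_state 0 X -> weight v = k - 3 ->
  component Y -> N (N E (N E E)) v \in Y ->
  component Z -> N (N E E) (N E v) \in Z ->
  component W -> N (N (N E E) E) v \in W ->
  hub_state 1 (X ++ ((Y ++ Z) ++ W)).
Proof.
move=> HX wk [FY HY iY] tY [FZ HZ iZ] tZ [FW HW iW] tW.
have nY : (N (N E (N E E)) v, Start) \notin FY by apply/negP=> /(allP iY).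
have nZ : (N (N E E) (N E v), Up Middle) \notin FZ by apply/negP=> /(allP iZ).
have nW : (N (N (N E E) E) v, Middle) \notin FW by apply/negP=> /(allP iW).
have PY := @joined_open _ _ _ Start true HY tY isT nY.
have PZ := @joined_open _ _ _ (Up Middle) true HZ tZ isT nZ.
have PW := @joined_open _ _ _ Middle false HW tW isT nW.
rewrite /= /upper /lower in PY PZ PW.
have [sY kY] := all_inherited iY; have [sZ kZ] := all_inherited iZ.
have [sW kW] := all_inherited iW.
have PYZW f1 f2 := joined_cat (joined_cat PY PZ f1) PW f2.
apply: (@attach 0 X E (N E v) (Low Middle) false _ _ _ _ HX (leqnn _) _ _ _ erefl _ _ (PYZW _ _)).
- by rewrite /=; nat_lia.
- by [].
- by [].
- flip_words.
- flip_words.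
- flip_words.
- flip_words.
- by rewrite !all_cat /= sY sZ sW; clear; case: v => [|[|? ?] ?].
- by rewrite !all_cat /= kY kZ kW.
by [].
Qed.

Let d1 := N (N E E) E.
Let d2 := N E (N E E).

Let block2_rows j : block 2 j = map (N d2) (trees j) ++ map (N d1) (trees j).
Proof. by rewrite /block /= cats0. Qed.

Let block2_cols i : perm_eq (map (N^~ d1) (trees i) ++ map (N^~ d2) (trees i)) (block i 2).
Proof.
apply: perm_trans (block_columns i 2); rewrite /= cats0.
by rewrite perm_catC.
Qed.

Let joinable0 : joinable 0. Proof. exact: joinable_small. Qed.
Let joinable1 : joinable 1. Proof. exact: joinable_small. Qed.

Let comp_block i j : 0 < i -> i + j = k.-1 -> i != 2 -> j != 2 -> component (block i j).
Proof. by move=> i0 ij i2 j2; apply: component_block => //; apply: IH => //; nat_lia. Qed.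

Let B i := block i (k.-1 - i).

(** Hexagons attach blocks two at a time. The bounds on [b] keep both weights of every block away
    from two, so these blocks are components. *)
Let attach_pairs r b X : hub_state b X -> 2 <= b -> b + r.*2 <= k - 5 ->
  hub_state (b + r.*2) (X ++ flatten (map B (iota b.+1 r.*2))).
Proof.
elim: r b X => [|r IHr] b X HX b2 bk; first by rewrite addn0 cats0.
have wu := weight_chain b.
have := @attach_two b X (chain b) (chain (k - 3 - b)) (B b.+1) (B b.+2) HX.
rewrite !weight_chain leqnn => /(_ isT) H.
have {}H : hub_state b.+1 (X ++ (B b.+1 ++ B b.+2)).
  apply: H.
  - by nat_lia.
  - have -> : k - 3 - b = (k - 4 - b).+1 by nat_lia.
    by [].
  - by apply: comp_block; nat_lia.
  - by rewrite mem_block !mem_trees /= !weight_chain; nat_lia.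
  - by apply: comp_block; nat_lia.
  by rewrite mem_block !mem_trees /= !weight_chain; nat_lia.
have := IHr b.+2 _ (hub_state_le (leqnSn _) H); rewrite /= -!catA => H'.
by have := H'; rewrite doubleS -!addSnnS; apply; nat_lia.
Qed.

Let blocks_split a b c : a + b = c -> map B (iota 0 c) = map B (iota 0 a) ++ map B (iota a b).
Proof. by move=> <-; rewrite iotaD map_cat add0n. Qed.

Lemma hub_state_full : exists b, hub_state b (trees k).
Proof.
have Hk j : j < k -> j != 2 -> joinable j := @IH j.
have cB1 : component (B 1) by apply: comp_block; nat_lia.
have cr1 : component (map (N d1) (trees (k - 3))).
  by apply: component_low => //; apply: IH; nat_lia.
have cr2 : component (map (N d2) (trees (k - 3))).
  by apply: component_low => //; apply: IH; nat_lia.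
have B2E : B 2 = map (N d2) (trees (k - 3)) ++ map (N d1) (trees (k - 3)).
  by rewrite -block2_rows /B; congr block; nat_lia.
have B0E : B 0 = hub by rewrite /B /block /= cats0 subn0.
(* The start absorbs the two rows of [B 2] and leaves an even number of blocks up to [B (k - 5)].
   For odd [k] one octagon takes both rows with [B 1]; for even [k] two hexagons take them, one with
   [B 1] and one with [B 3]. *)
have [b [X [b2 b3 ob [HX pX]]]] : exists b X, [/\ 2 <= b, b <= k - 5, odd (k - 5 - b) = false &
    hub_state b X /\ perm_eq X (flatten (map B (iota 0 b.+1)))].
  have [ok|ek] := boolP (odd k).
    exists 2, (hub ++ ((map (N d2) (trees (k - 3)) ++ B 1) ++ map (N d1) (trees (k - 3)))); split=> //; [by nat_lia|by move: ok k_gt6; clear; lia|].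
    split.
      apply: hub_state_le (leqnSn 1) _.
      apply: (@attach_start hub (chain (k - 3))) => //; first exact: hub_state0.
      - by rewrite weight_chain.
      - by apply: map_f; rewrite mem_trees weight_chain.
      - by rewrite mem_block !mem_trees /= weight_chain; nat_lia.
      by apply: map_f; rewrite mem_trees weight_chain.
    apply/permP=> p; rewrite /= B2E B0E !count_cat /=; nat_lia.
  have v3 : weight (chain (k - 3)) = k - 3 := weight_chain _.
  have H1 : hub_state 1 (hub ++ (B 1 ++ map (N d1) (trees (k - 3)))).
    apply: (@attach_two 0 hub E (chain (k - 3))) => //; first exact: hub_state0.
    - have -> : k - 3 = (k - 4).+1 by nat_lia.
      by [].
    - by rewrite mem_block !mem_trees /= v3; nat_lia.
    by apply: map_f; rewrite mem_trees v3.
  exists 3, ((hub ++ (B 1 ++ map (N d1) (trees (k - 3)))) ++ (map (N d2) (trees (k - 3)) ++ B 3)).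
  have k7 : 7 < k by rewrite ltn_neqAle k_gt6 andbT; apply: contra ek => /eqP <-.
  have v4 : weight (chain (k - 4)) = k - 4 := weight_chain _.
  split=> //; [by nat_lia|by move: ek k7; clear; lia|].
  split.
    apply: hub_state_le (leqnSn 2) _.
    apply: (@attach_two 1 _ (N E E) (chain (k - 4))) => //.
    - by rewrite /= v4; nat_lia.
    - have -> : k - 4 = (k - 5).+1 by nat_lia.
      by [].
    - by apply: map_f; rewrite mem_trees /= v4; nat_lia.
    - by apply: comp_block; nat_lia.
    by rewrite mem_block !mem_trees /= v4; nat_lia.
  apply/permP=> p; rewrite /= B2E B0E !count_cat /=; nat_lia.
pose r := (k - 5 - b)./2.
have rE : b + r.*2 = k - 5 by move: ob b3 k_gt6; rewrite /r; clear; lia.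
have := attach_pairs HX b2 (_ : b + r.*2 <= k - 5); rewrite rE leqnn => /(_ isT).
set X2 := X ++ _ => H2.
have pX2 : perm_eq X2 (flatten (map B (iota 0 (k - 4)))).
  rewrite (@blocks_split b.+1 r.*2); last by nat_lia.
  by rewrite flatten_cat perm_cat2r.
have c5 := weight_chain (k - 5); have c4 := weight_chain (k - 4).
(* [B (k - 3)], whose second factors have weight two, consists of the columns of [d1] and [d2]. The
   first go with [B (k - 4)] in a hexagon, the others with the last two blocks in an octagon. *)
have H3 : hub_state (k - 4) (X2 ++ (B (k - 4) ++ map (N^~ d1) (trees (k - 3)))).
  have E4 : (weight (chain (k - 5))).+1 = k - 4 by rewrite c5; nat_lia.
  rewrite -[X in hub_state X]E4; apply: (@attach_two (k - 5) X2 (chain (k - 5)) d1) => //.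
  - by rewrite c5.
  - by rewrite c5 (_ : weight d1 = 2) //; nat_lia.
  - by apply: comp_block; nat_lia.
  - by rewrite mem_block !mem_trees /= c5; nat_lia.
  - by apply: component_up; apply: IH; nat_lia.
  by rewrite (@map_f _ _ (N^~ d1)) // mem_trees /= c5; nat_lia.
have H4 := @attach_three (k - 4) _ (chain (k - 4)) (map (N^~ d2) (trees (k - 3))) (B (k - 1)) (B (k - 2)) H3.
exists (k - 3); apply: hub_state_perm (_ : hub_state _ (_ ++ _)) _.
  rewrite -[X in hub_state X](_ : (weight (chain (k - 4))).+1 = k - 3); last by rewrite c4; nat_lia.
  apply: H4; rewrite ?c4 //.
  - by apply: component_up; apply: IH; nat_lia.
  - by rewrite (@map_f _ _ (N^~ d2)) // mem_trees /= c4; nat_lia.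
  - have -> : B (k - 1) = block (k - 1) 0 by rewrite /B; congr block; nat_lia.
    by apply: component_block => //; [nat_lia|apply: IH; nat_lia].
  - by rewrite mem_block !mem_trees /= c4; nat_lia.
  - have -> : B (k - 2) = block (k - 2) 1 by rewrite /B; congr block; nat_lia.
    by apply: component_block => //; [nat_lia|apply: IH; nat_lia].
  by rewrite mem_block !mem_trees /= c4; nat_lia.
have -> : trees k = flatten (map B (iota 0 k)).
  by have := treesS k.-1; rewrite (ltn_predK k_gt6).
rewrite (@blocks_split (k - 4) 4); last by nat_lia.
have E3 : (k - 4).+1 = k - 3 by nat_lia.
have E2 : (k - 3).+1 = k - 2 by nat_lia.
have E1 : (k - 2).+1 = k - 1 by nat_lia.
rewrite [iota (k - 4) 4]/= E3 E2 E1.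
have B3E : B (k - 3) = block (k - 3) 2 by rewrite /B; congr block; nat_lia.
apply/permP=> p; have := permP pX2 p; have := permP (block2_cols (k - 3)) p.
rewrite flatten_cat /= B3E !count_cat /=; nat_lia.
Qed.

End Hub.

Lemma joinable_step : joinable k.
Proof.
have [F1 HF1 sF1] : joinable k.-1 by apply: IH; nat_lia.
by have [b [_ [F [HF sF _]]]] := hub_state_full HF1 sF1; exists F.
Qed.

End JoinableStep.

Lemma joinable_trees k : k != 2 -> joinable k.
Proof.
elim/ltn_ind: k => k IH k2; have [k6|k6] := ltnP 6 k; first exact: joinable_step.
by apply: joinable_small; move: k k6 k2 {IH} => [|[|[|[|[|[|[|]]]]]]].
Qed.

(** * From the middle levels to odd graphs *)

Definition kneser_cycle n k :=
  exists c, [/\ uniq c, c =i words n k & cycle disjointw c].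

(** The new letter records the level; complementing the upper level turns inclusion into
    disjointness. *)
Definition odd_vertex (k : nat) (x : bitseq) : bitseq :=
  if count id x == k then false :: x else true :: ~w x.

Lemma odd_vertex_inj k : {in middle k &, injective (odd_vertex k)}.
Proof.
move=> x y _ _; rewrite /odd_vertex; case: ifP => _; case: ifP => _ // [] //.
exact: (can_inj negb_wK).
Qed.

Lemma flip1_disjointw x y : flip1 x y ->
  (count id y == (count id x).+1) && disjointw x (~w y) || (count id x == (count id y).+1) && disjointw y (~w x).
Proof.
elim: x y => [|a x IH] [|b y] //=; rewrite !disjointw_cons.
have [->|ab] := eqVneq a b.
  by move/IH; case: b => /=; rewrite ?add0n ?add1n ?eqSS.
by move=> /eqP->; rewrite disjointw_negb; case: a b ab => [] [] //= _; rewrite eqxx ?orbT.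
Qed.

Lemma odd_adj_disjointw k x y : middle k x -> middle k y -> odd_adj x y ->
  disjointw (odd_vertex k x) (odd_vertex k y).
Proof.
move=> /andP[/eqP sx cx] /andP[/eqP sy cy] /orP[/flip1_disjointw|/eqP Ey].
  rewrite /odd_vertex => /orP[/andP[/eqP c d]|/andP[/eqP c d]].
    have -> : (count id x == k) by lia.
    by rewrite ifF ?disjointw_cons //; apply/eqP; lia.
  have -> : (count id y == k) by lia.
  by rewrite ifF ?disjointw_cons ?andbF 1?disjointwC //; apply/eqP; lia.
have := count_negb x; rewrite -Ey => cn.
rewrite /odd_vertex; have -> : (count id x == k) by lia.
have -> : (count id y == k) by lia.
by rewrite disjointw_cons Ey disjointw_negb.
Qed.

Lemma odd_vertex_words k y : (y \in words k.*2.+1 k) -> exists2 x, middle k x & y = odd_vertex k x.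
Proof.
move=> /wordsP[]; case: y => // -[] y /= [sy] cy.
  exists (~w y); first by rewrite /middle size_map sy eqxx /=; have := count_negb y; lia.
  rewrite /odd_vertex ifF ?negb_wK //; have := count_negb y => cn; apply/eqP; lia.
exists y; first by rewrite /middle sy eqxx -cy; lia.
by rewrite /odd_vertex -cy add0n eqxx.
Qed.

Lemma words_odd_vertex k x : middle k x -> odd_vertex k x \in words k.*2.+1 k.
Proof.
move=> /andP[/eqP sx cx]; apply/wordsP; rewrite /odd_vertex.
by case: eqP => cxk /=; rewrite ?size_map sx; split=> //; have := count_negb x; lia.
Qed.

Lemma kneser_odd k : k != 2 -> kneser_cycle k.*2.+1 k.
Proof.
move=> /joinable_trees[F HF _].
have [c [pc Rc _]] := joined_sound HF (trees_uniq k).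
have mid x : (x \in c) = middle k x.
  rewrite (perm_mem pc); apply/flattenP/idP => [[_ /mapP[t tk ->]]|/tpath_ex[t wt xt]].
    by move: tk; rewrite mem_trees => /eqP <- /(allP (tpath_middle t)).
  by exists (tpath t) => //; apply: map_f; rewrite mem_trees wt.
exists (map (odd_vertex k) c); split.
- rewrite map_inj_in_uniq; first by rewrite (perm_uniq pc) flatten_tpath_uniq ?trees_uniq.
  by move=> x y; rewrite !mid; apply: odd_vertex_inj.
- move=> y; apply/mapP/idP => [[x]|/odd_vertex_words[x xm ->]].
    by rewrite mid => xm ->; apply: words_odd_vertex.
  by exists x; rewrite ?mid.
rewrite cycle_map; apply: (sub_in_cycle (P := middle k)) Rc.
  by move=> x y; apply: odd_adj_disjointw.
by apply/allP=> x; rewrite mid.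
Qed.

(** * Kneser graphs of excess two *)

(** Both junctions of [s1] with the reversed [s2] join a former neighbour of [Y] to one of [Z]. For
    complementary halves these lie in opposite halves, hence are disjoint. *)
Lemma cycle_uncross (T : eqType) (R : rel T) Y Z s1 s2 : symmetric R ->
  (forall t w, R Y t -> R Z w -> R w t) -> cycle R (Y :: s1 ++ Z :: s2) -> cycle R (s1 ++ rev s2).
Proof.
move=> sR H; rewrite /= rcons_cat rcons_cons cat_path /= rcons_path.
case: s1 => [|a s1] /=; case: s2 => [|b s2] //=.
- move=> /and3P[_ /andP[Zb p] lY].
  have [s' [-> ps' ls']] := rev_path_ends sR p; rewrite /= rcons_path ps' ls' /=.
  by apply: H => //; rewrite sR.
- by rewrite cats0 rcons_path => /and3P[/andP[Ya ->] lZ _] /=; apply: H => //; rewrite sR.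
move=> /and3P[/andP[Ya p1] lZ /andP[/andP[Zb p2] lY]].
have [s' [-> ps' ls']] := rev_path_ends sR p2.
rewrite rcons_cat cat_path p1 /= rcons_path ps' ls' /=.
by apply/andP; split; apply: H; rewrite // sR.
Qed.

Lemma disjointw_halves y t w : size t = size y -> size w = size y ->
  disjointw y t -> disjointw (~w y) w -> disjointw w t.
Proof.
elim: y t w => [|a y IH] [|b t] [|c w] //= [st] [sw].
rewrite !disjointw_cons => /andP[ab /(IH _ _ st sw) H] /andP[ac /H ->].
by case: a b c ab ac => [] [] [].
Qed.

(* Without their first letters, the words of [c] are the vertices of K(2k+2,k)
   and complementary pairs of (k+1)-sets, which are removed one pair at a time. *)
Lemma remove_halves k c : uniq c -> {subset c <= words k.+1.*2.+1 k.+1} ->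
  {subset map (cons true) (words k.*2.+2 k) <= c} ->
  (forall y, false :: y \in c -> false :: ~w y \in c) ->
  cycle (fun x y => disjointw (behead x) (behead y)) c -> kneser_cycle k.*2.+2 k.
Proof.
elim: {c}(size c) {-2}c (leqnn (size c)) => [|n IH] c sc uc cV Vc cC Rc.
  exists [::]; split=> // x; apply/esym/negbTE/negP=> xk.
  by have := Vc _ (map_f _ xk); case: c sc {uc cV Vc cC Rc}.
have [/hasP[[|[] y] // Yc _]|nh] := boolP (has (fun x => ~~ head true x) c); last first.
  have all1 x : x \in c -> exists2 y, x = true :: y & y \in words k.*2.+2 k.
    move=> xc; have /wordsP[] := cV x xc; case: x xc => // b y xc /= [sy] cy.
    case: b xc cy => xc cy; last by case/negP: nh; apply/hasP; exists (false :: y).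
    by exists y => //; apply/wordsP; rewrite sy; move: cy => [].
  exists (map behead c); split.
  - rewrite map_inj_in_uniq // => x x' /all1[y -> _] /all1[y' -> _] /= -> //.
  - move=> y; apply/mapP/idP => [[x /all1[y' -> yk] ->]|yk] //.
    by exists (true :: y) => //; apply/Vc/map_f.
  by rewrite cycle_map.
have Zc := cC y Yc; have [i d Ed] := rot_to Yc.
have ny : ~w y != y.
  by have /wordsP[] := cV _ Yc; case: y {Yc Zc Ed} => // -[].
have Zd : false :: ~w y \in d.
  by move: Zc; rewrite -(mem_rot i) Ed inE eqseq_cons (negPf ny).
case/splitPr: Zd Ed => s1 s2 Ed.
have pc : perm_eq [:: false :: y, false :: ~w y & s1 ++ rev s2] c.
  apply: (@perm_trans _ (rot i c)); last by rewrite perm_rot.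
  by rewrite Ed; apply/permP=> p; rewrite /= !count_cat /= count_rev; lia.
have uc' : uniq [:: false :: y, false :: ~w y & s1 ++ rev s2] by rewrite (perm_uniq pc).
have mc x : (x \in c) = [|| x == false :: y, x == false :: ~w y | x \in s1 ++ rev s2].
  by rewrite -(perm_mem pc) !inE.
apply: (IH (s1 ++ rev s2)).
- by move: sc; rewrite -(perm_size pc) /= ltnS; apply: ltnW.
- by move: uc' => /= /and3P[].
- by move=> x xc'; apply: cV; rewrite mc xc' !orbT.
- by move=> x xk; have := Vc x xk; rewrite mc; case/mapP: xk => w _ ->.
- move=> y' yc'; have : false :: ~w y' \in c by apply: cC; rewrite mc yc' !orbT.
  move: uc' => /= /and3P[]; rewrite inE negb_or => /andP[_ n1] n2 _.
  rewrite mc => /or3P[/eqP[E]|/eqP[/(can_inj negb_wK) E]|//].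
    by case/negP: n2; rewrite -E negb_wK.
  by case/negP: n1; rewrite -E.
pose R x z := [&& size x == k.+1.*2.+1, size z == k.+1.*2.+1 & disjointw (behead x) (behead z)].
have sR : symmetric R by move=> x z; rewrite /R disjointwC andbCA.
have : cycle R (rot i c).
  rewrite rot_cycle; apply: (sub_in_cycle (P := mem c)) Rc; last exact/allP.
  by move=> x z /cV/wordsP[sx _] /cV/wordsP[sz _] /= dxz; rewrite /R sx sz eqxx.
rewrite Ed => /(cycle_uncross sR) H.
have {}H : cycle R (s1 ++ rev s2).
  apply: H => t w /and3P[_ /eqP st d1] /and3P[_ /eqP sw d2]; rewrite /R st sw eqxx /=.
  have /wordsP[[sy] _] := cV _ Yc.
  by apply: (disjointw_halves _ _ d1 d2); rewrite size_behead ?st ?sw sy.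
by apply: sub_cycle H => x z /and3P[].
Qed.

Lemma kneser_excess2 k : kneser_cycle k.+1.*2.+1 k.+1 -> kneser_cycle k.*2.+2 k.
Proof.
move=> [c [uc cV Rc]]; apply: (@remove_halves k c) => //.
- by move=> x; rewrite cV.
- move=> _ /mapP[y /wordsP[sy cy] ->]; rewrite cV; apply/wordsP => /=.
  by rewrite sy cy add1n.
- move=> y; rewrite !cV => /wordsP[[sy] cy]; apply/wordsP => /=; rewrite size_map sy.
  by split=> //; have := count_negb y; move: cy => /=; lia.
apply: sub_cycle Rc => -[|a x] -[|b y]; last by rewrite disjointw_cons => /andP[].
- by [].
- by case: y.
by case: x.
Qed.

Lemma kneser_excess_gt2 m k : 2 < m -> kneser_cycle (k.*2 + m) k.
Proof.
move=> m2; have [c [uc cV Rc _]] := padded_cycle_exists k m2.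
exists c; split=> //; apply: (sub_in_cycle (P := mem c)) Rc; last exact/allP.
have sc z : z \in c -> size z = k.*2 + m by rewrite cV => /wordsP[].
move=> x y /sc sx /sc sy; by apply: disjointw_sub; rewrite ?size_pad ?subw_pad.
Qed.

Lemma kneser_4_1 : kneser_cycle 4 1.
Proof.
pose c := [:: [:: true; false; false; false]; [:: false; true; false; false];
  [:: false; false; true; false]; [:: false; false; false; true]].
exists c; split=> // x; rewrite mem_words.
by move: x => [|[] [|[] [|[] [|[] [|b x]]]]].
Qed.

Lemma kneser_hamiltonian n k : 0 < k -> k.*2 < n -> (n, k) <> (5, 2) -> kneser_cycle n k.
Proof.
move=> k0 kn nk; have [m Em] : exists m, n = k.*2 + m.+1 by exists (n - k.*2).-1; lia.
case: m Em => [|[|m]] Em; last by rewrite Em; apply: kneser_excess_gt2.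
- rewrite Em addn1; apply: kneser_odd; apply: contra_notN nk => /eqP k2.
  by rewrite Em k2.
(* Here the reduction to the odd graph of [k.+1] would need K(5,2). *)
have [k1|k1] := eqVneq k 1; first by rewrite Em k1; exact: kneser_4_1.
by rewrite Em addn2; apply: kneser_excess2; apply: kneser_odd; rewrite eqSS.
Qed.

(** * Generalized Johnson graphs *)

Definition meet (x y : bitseq) := count (fun p => p.1 && p.2) (zip x y).

Definition johnson_cycle n k s :=
  exists c, [/\ uniq c, c =i words n k & cycle (fun x y => meet x y == s) c].

Lemma meetC x y : meet x y = meet y x.
Proof. by rewrite /meet; elim: x y => [|a x IH] [|b y] //=; rewrite IH andbC. Qed.

Lemma meet_id x : meet x x = count id x.
Proof. by rewrite /meet; elim: x => //= a x ->; rewrite andbb. Qed.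

Lemma meet_cat x x' y y' : size x = size y -> meet (x ++ x') (y ++ y') = meet x y + meet x' y'.
Proof. by move=> E; rewrite /meet zip_cat // count_cat. Qed.

Lemma meet_nseq j a b : meet (nseq j a) (nseq j b) = (a && b) * j.
Proof.
by rewrite /meet; elim: j => [|j IH] /=; rewrite ?muln0 // IH; case: (a && b); rewrite ?mul1n ?mul0n.
Qed.

Lemma count_bool2 (p : pred (bool * bool)) s :
  count p s = p (true, true) * count (fun q => q.1 && q.2) s
    + p (true, false) * count (fun q => q.1 && ~~ q.2) s
    + p (false, true) * count (fun q => ~~ q.1 && q.2) s
    + p (false, false) * count (fun q => ~~ q.1 && ~~ q.2) s.
Proof.
elim: s => [|[a b] s IH]; first by rewrite /= !muln0.
by rewrite /= IH; case: a b => [] [] /=; lia.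
Qed.

(** A pair of letters has four values, and the length, the two weights and the intersection
    determine how often each occurs. *)
Lemma perm_eq_zip (x y x' y' : bitseq) : size x = size y -> size x' = size y' -> size x = size x' ->
  count id x = count id x' -> count id y = count id y' -> meet x y = meet x' y' ->
  perm_eq (zip x y) (zip x' y').
Proof.
move=> sxy sxy' sxx cx cy m.
have F (a b : bitseq) : size a = size b -> 
  [/\ count id a = count fst (zip a b), count id b = count snd (zip a b) & size a = count predT (zip a b)].
  by elim: a b => [|c a IH] [|d b] //= [/IH[-> -> ->]].
have [c1 c2 c3] := F _ _ sxy; have [c1' c2' c3'] := F _ _ sxy'.
move: cx cy m sxx; rewrite c1 c2 c3 c1' c2' c3' /meet.
rewrite (count_bool2 fst (zip x y)) (count_bool2 fst (zip x' y')).
rewrite (count_bool2 snd (zip x y)) (count_bool2 snd (zip x' y')).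
rewrite (count_bool2 predT (zip x y)) (count_bool2 predT (zip x' y')) /= !mul1n !mul0n.
move=> h1 h2 h3 h4.
apply/permP=> p; rewrite (count_bool2 p (zip x y)) (count_bool2 p (zip x' y')).
have [-> -> -> ->] : [/\ count (fun q => q.1 && q.2) (zip x y) = count (fun q => q.1 && q.2) (zip x' y'),
  count (fun q => q.1 && ~~ q.2) (zip x y) = count (fun q => q.1 && ~~ q.2) (zip x' y'),
  count (fun q => ~~ q.1 && q.2) (zip x y) = count (fun q => ~~ q.1 && q.2) (zip x' y') &
  count (fun q => ~~ q.1 && ~~ q.2) (zip x y) = count (fun q => ~~ q.1 && ~~ q.2) (zip x' y')].
  by split; lia.
by [].
Qed.

Lemma permute_positions (x y x' y' : bitseq) : size x = size y -> size x' = size y' ->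
  perm_eq (zip x' y') (zip x y) ->
  exists I, [/\ perm_eq I (iota 0 (size x)), x' = map (nth false x) I & y' = map (nth false y) I].
Proof.
move=> sxy sxy' /(perm_iotaP (false, false))[I pI EI]; exists I.
have mI : map (nth (false, false) (zip x y)) I = [seq (nth false x i, nth false y i) | i <- I].
  by apply: eq_map => i; rewrite nth_zip.
split; first by move: pI; rewrite size1_zip // sxy.
  by rewrite -(unzip1_zip (eq_leq sxy')) EI mI /unzip1 -map_comp.
by rewrite -(unzip2_zip (eq_leq (esym sxy'))) EI mI /unzip2 -map_comp.
Qed.

Section Permute.
Variables (N : nat) (I : seq nat).
Hypothesis pI : perm_eq I (iota 0 N).
Let pi (w : bitseq) := map (nth false w) I.

Lemma permute_perm w : size w = N -> perm_eq (pi w) w.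
Proof.
by move=> sw; rewrite -[X in perm_eq _ X](mkseq_nth false w) /mkseq sw; apply: perm_map.
Qed.

Lemma permute_words k w : w \in words N k -> pi w \in words N k.
Proof.
move=> /wordsP[sw cw]; apply/wordsP; rewrite (perm_size (permute_perm sw)).
by rewrite (permP (permute_perm sw) id).
Qed.

Lemma permute_inj w v : size w = N -> size v = N -> pi w = pi v -> w = v.
Proof.
move=> sw sv E; apply: (@eq_from_nth _ false); rewrite ?sw ?sv // => i iN.
have iI : i \in I by rewrite (perm_mem pI) mem_iota.
have := congr1 (fun s => nth false s (index i I)) E; rewrite /pi.
by rewrite !(nth_map 0) ?index_mem // nth_index.
Qed.

Lemma permute_meet w v : size w = N -> size v = N -> meet (pi w) (pi v) = meet w v.
Proof.
move=> sw sv; suff P : perm_eq (zip (pi w) (pi v)) (zip w v) by exact: (permP P).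
have -> : zip (pi w) (pi v) = map (nth (false, false) (zip w v)) I.
  rewrite /pi; elim: (I) => //= i J ->; rewrite nth_zip ?sw //.
rewrite -[X in perm_eq _ X](mkseq_nth (false, false)) /mkseq size1_zip ?sw ?sv //.
exact: perm_map.
Qed.

End Permute.

(** Any edge can be moved to any other by a permutation of positions, so the closing edge of a
    Hamilton cycle may be prescribed. *)
Lemma johnson_edge n k s A B : johnson_cycle n k s -> A \in words n k -> B \in words n k ->
  meet A B = s -> exists t, [/\ uniq (A :: t), A :: t =i words n k,
    path (fun x y => meet x y == s) A t & last A t = B].
Proof.
move=> [c [uc cV Rc]] AV BV mAB.
case: c uc cV Rc => [|x t] uc cV Rc; first by move: AV; rewrite -cV.
have xV : x \in words n k by rewrite -cV mem_head.
have yV : last x t \in words n k by rewrite -cV mem_last.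
have /wordsP[sx cx] := xV; have /wordsP[sy cy] := yV.
have /wordsP[sA cA] := AV; have /wordsP[sB cB] := BV.
move: Rc; rewrite /= rcons_path => /andP[Rt /eqP m].
have [|||I [pI EA EB]] := @permute_positions x (last x t) A B; rewrite ?sx ?sA ?sB //.
  by apply: perm_eq_zip; rewrite ?sx ?sy ?sA ?sB ?cx ?cy ?cA ?cB // mAB meetC m.
rewrite sx in pI; pose pi (w : bitseq) := map (nth false w) I.
have szc z : z \in x :: t -> size z = n by rewrite cV => /wordsP[].
have uc' : uniq (map pi (x :: t)).
  by rewrite map_inj_in_uniq // => w v /szc sw /szc sv; apply: (permute_inj pI).
exists (map pi t); rewrite EA -[_ :: _]/(map pi (x :: t)); split=> //.
- have [] // := @uniq_min_size _ (map pi (x :: t)) (words n k) uc'.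
    by move=> _ /mapP[w wc ->]; apply: (permute_words pI); rewrite -cV.
  by rewrite -(perm_size (uniq_perm uc (words_uniq n k) cV)) [X in _ <= X]size_map.
- rewrite -[map (nth false x) I]/(pi x) path_map.
  apply: (sub_in_path (P := mem (x :: t))) Rt; last exact/allP.
  by move=> w v /szc sw /szc sv /=; rewrite (permute_meet pI).
by rewrite -[map (nth false x) I]/(pi x) last_map EB.
Qed.

Lemma mem_words_cons n k b x : (b :: x \in words n.+1 k) = if b then (0 < k) && (x \in words n k.-1) else x \in words n k.
Proof. by rewrite !mem_words /= eqSS; case: b => /=; rewrite ?add0n // add1n; case: k => //= ; rewrite andbF. Qed.

(** The new letter contributes to intersections only between two words starting with 1, where it
    raises [s] to [s.+1]. The two joining edges change this letter, so [A], [C] and [B], [D] must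
    already meet in [s.+1] elements. *)
Lemma johnson_step n k s A B C D : johnson_cycle n k.+1 s.+1 -> johnson_cycle n k s ->
  A \in words n k.+1 -> B \in words n k.+1 -> meet A B = s.+1 ->
  C \in words n k -> D \in words n k -> meet C D = s ->
  meet A C = s.+1 -> meet B D = s.+1 -> johnson_cycle n.+1 k.+1 s.+1.
Proof.
move=> H1 H2 AV BV mAB CV DV mCD mAC mBD.
have [t [ut tV Rt lt]] := johnson_edge H1 AV BV mAB.
have [t' [ut' tV' Rt' lt']] := johnson_edge H2 CV DV mCD.
have sR : symmetric (fun x y => meet x y == s) by move=> x y; rewrite meetC.
have [r [Er Rr lr]] := rev_path_ends sR Rt'; rewrite lt' in Er Rr lr.
exists (map (cons false) (A :: t) ++ map (cons true) (D :: r)); split.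
- rewrite cat_uniq !map_inj_uniq; try by move=> x y [].
  rewrite ut -Er rev_uniq ut' andbT; apply/hasPn=> _ /mapP[x _ ->].
  by apply/mapP=> -[].
- case=> [|b x].
    by rewrite mem_words; apply/negbTE; rewrite mem_cat negb_or; apply/andP; split; apply/mapP=> -[].
  have nm (c : bool) (u : seq bitseq) : (~~ c :: x \in map (cons c) u) = false.
    by apply/mapP=> -[y _ [E _]]; case: c E.
  have im (c : bool) (u : seq bitseq) : (c :: x \in map (cons c) u) = (x \in u).
    by apply: mem_map => y z [].
  rewrite mem_cat mem_words_cons -Er; case: b.
    by rewrite (nm false) im mem_rev tV'.
  by rewrite (nm true) im tV orbF.
rewrite /= rcons_cat cat_path /= rcons_path !path_map !last_map lt lr.
rewrite -[meet (false :: B) _]/(meet B D) mBD eqxx meetC -[meet (false :: A) _]/(meet A C) mAC eqxx andbT.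
apply/andP; split; first exact: Rt.
by apply: sub_path Rr => x y /=; rewrite /meet /= add1n eqSS.
Qed.

Definition layout p q r (a b c d e : bool) : bitseq :=
  nseq p true ++ a :: nseq q b ++ c :: nseq q d ++ e :: nseq r false.

Lemma meet_layout p q r a b c d e a' b' c' d' e' :
  meet (layout p q r a b c d e) (layout p q r a' b' c' d' e') =
  p + ((a && a') + ((b && b') * q + ((c && c') + ((d && d') * q + (e && e'))))).
Proof.
have mc x y s t : meet (x :: s) (y :: t) = (x && y) + meet s t by [].
rewrite /layout !(meet_cat, mc, meet_nseq) ?size_nseq //=.
by rewrite mul1n mul0n addn0.
Qed.

Lemma layout_word p q r a b c d e : layout p q r a b c d e \in
  words (p + q.*2 + r).+3 (p + (a + (b * q + (c + (d * q + e))))).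
Proof.
apply/wordsP; split; first by rewrite /layout !(size_cat, size_nseq) /=; rewrite !(size_cat, size_nseq) /= size_cat /= !size_nseq; lia.
by rewrite -meet_id meet_layout !andbb.
Qed.

Lemma johnson_ind_step n k s : s < k -> k.*2 - s < n ->
  johnson_cycle n k.+1 s.+1 -> johnson_cycle n k s -> johnson_cycle n.+1 k.+1 s.+1.
Proof.
move=> sk kn H1 H2.
(* The four words share [s] ones, and [k = s + q + 1]. They occupy [s + 2q + 3] positions, one more
   than [2k - s], which is why the bound on [n] is strict; [r] counts the remaining positions. *)
pose q := k - s.+1; pose r := n - (s + q.*2).+3.
have En : (s + q.*2 + r).+3 = n by rewrite /r /q; lia.
have Ek : s + q.+1 = k by rewrite /q; lia.
pose W := layout s q r.
apply: (@johnson_step n k s (W true false false true true) (W true true true false false)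
  (W true true false false false) (W false false true true false)) => //; rewrite /W.
- by have := layout_word s q r true false false true true; rewrite En; congr (_ \in words _ _); lia.
- by have := layout_word s q r true true true false false; rewrite En; congr (_ \in words _ _); lia.
- by rewrite meet_layout /=; lia.
- by have := layout_word s q r true true false false false; rewrite En; congr (_ \in words _ _); lia.
- by have := layout_word s q r false false true true false; rewrite En; congr (_ \in words _ _); lia.
- by rewrite meet_layout /=; lia.
- by rewrite meet_layout /=; lia.
by rewrite meet_layout /=; lia.
Qed.

(** * Complementation and the induction on the ground set *)

Lemma disjointw_meet x y : disjointw x y = (meet x y == 0).
Proof. by rewrite /disjointw /meet -leqn0 leqNgt has_count. Qed.

Lemma meet_negb x y : size x = size y ->
  meet (~w x) (~w y) + (count id x + count id y) = size x + meet x y.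
Proof.
rewrite /meet; elim: x y => [|a x IH] [|b y] //= [/IH]; case: a b => [] [] /=; lia.
Qed.

(** In a ground set of size [2k - s] two [k]-sets meet in [s] elements exactly when their
    complements are disjoint; the resulting Kneser graph has excess [s], and J(5,3,1) corresponds to
    K(5,2). *)
Lemma johnson_complement k s : 0 < s -> s < k -> ~ (k = 3 /\ s = 1) -> johnson_cycle (k.*2 - s) k s.
Proof.
move=> s0 sk nks; have [c [uc cV Rc]] : kneser_cycle (k.*2 - s) (k - s).
  by apply: kneser_hamiltonian; [lia|lia|move=> [h1 h2]; apply: nks; lia].
have szc z : z \in c -> size z = k.*2 - s /\ count id z = k - s by rewrite cV => /wordsP.
exists (map (map negb) c); split.
- by rewrite map_inj_uniq //; exact: can_inj negb_wK.
- move=> x; apply/mapP/wordsP => [[y /szc[sy cy] ->]|[sx cx]].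
    by rewrite size_map; split=> //; have := count_negb y; lia.
  exists (~w x); last by rewrite negb_wK.
  by rewrite cV; apply/wordsP; rewrite size_map; split=> //; have := count_negb x; lia.
rewrite cycle_map; apply: (sub_in_cycle (P := mem c)) Rc; last exact/allP.
move=> x y /szc[sx cx] /szc[sy cy] /=; rewrite disjointw_meet => /eqP m.
by have := meet_negb (etrans sx (esym sy)); rewrite m cx cy sx => E; apply/eqP; lia.
Qed.

Definition word6 (x : nat) : bitseq := [seq odd (x %/ 2 ^ i) | i <- [:: 5; 4; 3; 2; 1; 0]].

Lemma johnson_6_3_1 : johnson_cycle 6 3 1.
Proof.
exists (map word6 [:: 56; 38; 49; 44; 50; 41; 52; 42; 37; 28; 19; 14; 35; 25; 7; 26; 21; 11; 22; 13]).
split; [by []| |by []] => x; rewrite mem_words.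
by move: x => [|[] [|[] [|[] [|[] [|[] [|[] [|b x]]]]]]].
Qed.

Lemma johnson_cycle_exists n k s : 0 < k -> s < k -> k.*2 - s + (s == 0) <= n ->
  ~ ((n, k, s) = (5, 2, 0) \/ (n, k, s) = (5, 3, 1)) -> johnson_cycle n k s.
Proof.
elim: n k s => [|n IH] k s k0 sk kn ex; first by lia.
case: s sk kn ex => [|s] sk kn ex.
  have [c [uc cV Rc]] : kneser_cycle n.+1 k.
    by apply: kneser_hamiltonian => //; [lia|move=> [En Ek]; apply: ex; left; rewrite En Ek].
  by exists c; split=> //; apply: sub_cycle Rc => x y; rewrite disjointw_meet.
have [En|kn'] := eqVneq n.+1 (k.*2 - s.+1).
  rewrite En; apply: johnson_complement => // -[k3 s1]; apply: ex; right.
  by rewrite En k3 s1.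
case: k k0 sk kn kn' ex => // k _ sk kn kn' ex.
(* For J(6,3,1) both constituents, J(5,3,1) and J(5,2,0), are exceptional; for every other triple
   reached here neither is. *)
have [[-> -> ->]|n6] := (n, k, s) =P (5, 2, 0); first exact: johnson_6_3_1.
apply: johnson_ind_step; [by lia|by lia| |].
  apply: IH => //; first by lia.
  by case=> [|[h1 h2 h3]]; [case|apply: n6; rewrite h1 h2 h3].
apply: IH => //; [by lia|by lia|].
by case=> // -[h1 h2 h3]; lia.
Qed.

(** * Translation from words to sets *)

Definition indicator n (A : {set 'I_n}) : bitseq := [seq i \in A | i <- enum 'I_n].
Definition support_set n (x : bitseq) : {set 'I_n} := [set i : 'I_n | nth false x i].

Lemma support_setK n x : size x = n -> indicator (support_set n x) = x.
Proof.
move=> sx; apply: (@eq_from_nth _ false); rewrite size_map size_enum_ord // => i iN.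
by rewrite (nth_map (Ordinal iN)) ?size_enum_ord // inE nth_enum_ord.
Qed.

Lemma indicatorK n (A : {set 'I_n}) : support_set n (indicator A) = A.
Proof.
apply/setP=> i; rewrite inE (nth_map i) ?size_enum_ord //; congr (_ \in A).
by apply: val_inj; rewrite /= nth_enum_ord.
Qed.

Lemma count_indicator n (A : {set 'I_n}) : count id (indicator A) = #|A|.
Proof. by rewrite count_map cardE -size_filter /enum_mem filter_predT. Qed.

Lemma meet_indicator n (A B : {set 'I_n}) : meet (indicator A) (indicator B) = #|A :&: B|.
Proof.
by rewrite -count_indicator /meet /indicator; elim: (enum 'I_n) => //= i e ->; rewrite inE.
Qed.

Lemma indicator_words n k (A : {set 'I_n}) : (indicator A \in words n k) = (#|A| == k).
Proof. by rewrite mem_words size_map size_enum_ord eqxx count_indicator. Qed.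

Lemma bin_ge n k : 0 < k -> k < n -> n <= 'C(n, k).
Proof.
elim: n k => // n IH [|k] // _ kn; rewrite binS.
have [->|k0] := posnP k; first by rewrite bin1 bin0 addn1.
have kn' : k < n by [].
have [kn1|nk] := ltnP k.+1 n.
  have := IH k.+1 isT kn1; have : 0 < 'C(n, k) by rewrite bin_gt0 ltnW.
  by lia.
have := IH k k0 kn'; have -> : k.+1 = n by lia.
by rewrite binn; lia.
Qed.

Theorem theorem2 (n k s : nat) :
  1 <= k -> s < k -> 2 * k - s + (s == 0) <= n ->
  ~ ((n, k, s) = (5, 2, 0) \/ (n, k, s) = (5, 3, 1)) ->
  johnson_hamiltonian n k s.
Proof.
move=> k0 sk kn ex.
have [c [uc cV Rc]] : johnson_cycle n k s.
  by apply: johnson_cycle_exists => //; rewrite -mul2n.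
have szc x : x \in c -> size x = n by rewrite cV => /wordsP[].
have uc' : uniq (map (support_set n) c).
  rewrite map_inj_in_uniq // => x y /szc sx /szc sy E.
  by rewrite -(support_setK sx) E support_setK.
have cV' (A : {set 'I_n}) : (A \in map (support_set n) c) = johnson_vertex k A.
  rewrite /johnson_vertex -indicator_words -cV; apply/mapP/idP => [[x xc ->]|Ac].
    by rewrite support_setK ?szc.
  by exists (indicator A); rewrite ?indicatorK.
exists (map (support_set n) c); split=> //.
(* The bounds give [k < n] and [n >= 3], so there are at least [n] vertices and hence at least
   three. *)
- rewrite -(card_uniqP uc').
  have -> : #|map (support_set n) c| = #|[set A : {set 'I_n} | #|A| == k]|.
    by apply: eq_card => A; rewrite cV' inE.
  rewrite card_draws card_ord (leq_trans _ (bin_ge k0 _)) //; last by lia.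
  by case: s sk kn {ex Rc} => [|s] sk kn; lia.
rewrite cycle_map; apply: (sub_in_cycle (P := mem c)) Rc; last exact/allP.
move=> x y /szc sx /szc sy /=.
by rewrite /johnson_adj -meet_indicator !support_setK.
Qed.
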